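(* Let $s,r\ge0$ be integers with $s\ge r-2$. All classical connections on $E$ naturally given by a classical connection $\Lambda$ on $M$ (in order $s$) and by a general linear connection $K$ on $E$ (in order $r$) are of maximal order one (i.e. depend only on the $1$-jets of $\Lambda$ and $K$) and are of the form $$\widetilde D(\Lambda,K)=D(\Lambda,K)+h^K\big(S(\Lambda)\big)+L\otimes G(\Lambda,K)+e_2\,R[K](L)+H(\Lambda,K),$$ where $D(\Lambda,K)$ is the standard induced classical connection on $E$, $L$ is the Liouville vertical vector field on $E$, $e_2\in\mathbb R$, and $$S(\Lambda)=a_1T+a_2\,I_{TM}\otimes\hat T+a_3\,\hat T\otimes I_{TM},$$ $$\begin{aligned}G(\Lambda,K)={}&b_1C^{12}_{13}(T\otimes T)+b_2C^{12}_{31}(T\otimes T)+b_3C^{12}_{12}(T\otimes T)+c_1C^1_1\widetilde\nabla T+c_2\overline{C^1_1\widetilde\nabla T}+c_3C^1_3\widetilde\nabla T\\&+d_1C^1_1R[\widetilde\Lambda]+d_2C^1_2R[\widetilde\Lambda]+e_1C^1_1R[K],\end{aligned}$$ $$H(\Lambda,K)=h_1\,\nu_K\otimes\hat T+h_2\,\hat T\otimes\nu_K,$$ with real coefficients $a_1,a_2,a_3,b_1,b_2,b_3,c_1,c_2,c_3,d_1,d_2,e_1,h_1,h_2$. (All objects are defined in the context.)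
   Context: All manifolds and maps are smooth; the summation convention is used. $p:E\to M$ is a vector bundle with $m$-dimensional base and $n$-dimensional fibres, with local linear fibre coordinates $(x^A)=(x^\lambda,y^i)$; Greek indices run over $1,\dots,m$, small Latin indices over $1,\dots,n$, capital indices over both kinds. $(\partial_\lambda,\partial_i)$ and $(d^\lambda,d^i)$ are the induced local bases of sections of $TE$ and $T^*E$. A general linear connection $K$ on $E$ is a linear section $K:E\to J^1E$, equivalently $K=d^\lambda\otimes(\partial_\lambda+K_j{}^i{}_\lambda y^j\partial_i)$ with $K_j{}^i{}_\lambda$ local functions on $M$. A classical connection $\Lambda$ on $M$ (not necessarily symmetric) is a linear connection on $TM\to M$, $\Lambda=d^\lambda\otimes(\partial_\lambda+\Lambda_\nu{}^\mu{}_\lambda\dot x^\nu\dot\partial_\mu)$. Thus covariant derivatives are $\nabla_\lambda s^i=\partial_\lambda s^i-K_j{}^i{}_\lambda s^j$ and $\nabla_\lambda X^\mu=\partial_\lambda X^\mu-\Lambda_\nu{}^\mu{}_\lambda X^\nu$. A classical connection on $E$ is a linear connection on $TE\to E$, $D=d^C\otimes(\partial_C+D_B{}^A{}_C\,\dot x^B\dot\partial_A)$; the difference of two such connections is a $(1,2)$-tensor field $\Phi_B{}^A{}_C\,d^B\otimes\partial_A\otimes d^C$ on $E$. Symmetrization and torsion: $\widetilde\Lambda_\mu{}^\lambda{}_\nu=\frac12(\Lambda_\mu{}^\lambda{}_\nu+\Lambda_\nu{}^\lambda{}_\mu)$, $T_\mu{}^\lambda{}_\nu=\frac12(\Lambda_\mu{}^\lambda{}_\nu-\Lambda_\nu{}^\lambda{}_\mu)$;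 $\hat T$ is the contraction $\hat T_\mu=T_\rho{}^\rho{}_\mu$; $I_{TM}$ is the identity $(1,1)$-tensor. $\widetilde\nabla$ (also a semicolon, derivative index last) is the covariant differential with respect to $\widetilde\Lambda$. The curvature of $K$ is $R[K]=R_j{}^i{}_{\lambda\mu}\,d^j\otimes\partial_i\otimes d^\lambda\wedge d^\mu=-2(\partial_\lambda K_j{}^i{}_\mu+K_j{}^p{}_\lambda K_p{}^i{}_\mu)\,d^j\otimes\partial_i\otimes d^\lambda\wedge d^\mu$, with $R_j{}^i{}_{\lambda\mu}$ antisymmetric in $\lambda,\mu$; $\widetilde R_\nu{}^\rho{}_{\lambda\mu}$ are the components of $R[\widetilde\Lambda]$, defined by the same formula with $E=TM$. In components $S(\Lambda)_\mu{}^\lambda{}_\nu=a_1T_\mu{}^\lambda{}_\nu+a_2\delta^\lambda_\mu\hat T_\nu+a_3\hat T_\mu\delta^\lambda_\nu$. $C^{ij}_{kl}$ and $C^i_k$ denote contraction of the $i$-th (and $j$-th) upper index with the $k$-th (and $l$-th) lower index, and the bar denotes exchange of the two subscripts, so that $G_{\mu\nu}=b_1T_\rho{}^\rho{}_\mu T_\sigma{}^\sigma{}_\nu+b_2T_\sigma{}^\rho{}_\mu T_\rho{}^\sigma{}_\nu+b_3T_\rho{}^\rho{}_\sigma T_\mu{}^\sigma{}_\nu+c_1T_\rho{}^\rho{}_{\mu;\nu}+c_2T_\rho{}^\rho{}_{\nu;\mu}+c_3T_\mu{}^\rho{}_{\nu;\rho}+d_1\widetilde R_\rho{}^\rho{}_{\mu\nu}+d_2\widetilde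 R_\mu{}^\rho{}_{\rho\nu}+e_1R_p{}^p{}_{\mu\nu}$. $h^K:TM\to TE$ is the horizontal lift, $h^K(\partial_\lambda)=\partial_\lambda+K_j{}^i{}_\lambda y^j\partial_i$; $\nu_K=(d^i-K_j{}^i{}_\lambda y^jd^\lambda)\otimes\partial_i$ is the vertical projection $TE\to VE$ viewed as a vertical-valued 1-form; $L=y^i\partial_i$. Forms on $M$ are pulled back to $E$ and $VE\subset TE$, so as sections of $T^*E\otimes TE\otimes T^*E$: $h^K(S(\Lambda))=S_\mu{}^\lambda{}_\nu\,d^\mu\otimes h^K(\partial_\lambda)\otimes d^\nu$, $L\otimes G=y^iG_{\mu\nu}\,d^\mu\otimes\partial_i\otimes d^\nu$, $R[K](L)=R_j{}^i{}_{\mu\nu}y^j\,d^\mu\otimes\partial_i\otimes d^\nu$, $\nu_K\otimes\hat T=\hat T_\nu\,(d^i-K_j{}^i{}_\lambda y^jd^\lambda)\otimes\partial_i\otimes d^\nu$, $\hat T\otimes\nu_K=\hat T_\mu\,d^\mu\otimes\partial_i\otimes(d^i-K_j{}^i{}_\lambda y^jd^\lambda)$. $D(\Lambda,K)$ is the unique classical connection $D$ on $E$ with $\nabla^D_{h^K(X)}h^K(Y)=h^K(\nabla^\Lambda_XY)$, $\nabla^D_{h^K(X)}s^V=(\nabla^K_Xs)^V$, $\nabla^D_{s^V}h^K(X)=0$, $\nabla^D_{s^V}\sigma^V=0$ for all vector fields $X,Y$ on $M$ and sections $s,\sigma$ of $E$ ($s^V$ is the vertical lift). In coordinates $D_\mu{}^\lambda{}_\nu=\Lambda_\mu{}^\lambda{}_\nu$,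 $D_\mu{}^i{}_\nu=(\partial_\nu K_p{}^i{}_\mu-K_r{}^i{}_\nu K_p{}^r{}_\mu+K_p{}^i{}_\rho\Lambda_\mu{}^\rho{}_\nu)y^p$, $D_\mu{}^i{}_k=K_k{}^i{}_\mu$, $D_j{}^i{}_\nu=K_j{}^i{}_\nu$, and all other components vanish. Naturality: a classical connection on $E$ naturally given by $\Lambda$ in order $s$ and $K$ in order $r$ is a rule assigning to every vector bundle $E\to M$ with the given $m,n$ and every pair $(\Lambda,K)$ a classical connection on $E$ whose value at $u\in E$ is a smooth function of $u$ and of the jets $j^s\Lambda,j^rK$ at $p(u)$, and which commutes with all local fibre-linear diffeomorphisms of vector bundles covering embeddings of bases. *)

(* Defs.v *)
From HB Require Import structures.
From mathcomp Require Import all_boot all_order all_algebra.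
From mathcomp Require Import all_classical all_reals all_analysis.
Set Implicit Arguments.
Unset Strict Implicit.
Unset Printing Implicit Defensive.
Import Order.TTheory GRing.Theory Num.Theory.
Import numFieldNormedType.Exports.
Local Open Scope classical_set_scope.
Local Open Scope ring_scope.

Definition partial (R : realType) (d : nat) (i : 'I_d) (f : 'rV[R]_d -> R) :
    'rV[R]_d -> R :=
  fun x => derive f x (delta_mx 0 i).

Definition partials (R : realType) (d : nat) (l : seq 'I_d)
    (f : 'rV[R]_d -> R) : 'rV[R]_d -> R :=
  foldr (fun i g => partial i g) f l.

(* C^oo on an open set [U]: every iterated partial derivative is (Frechet)
   differentiable, hence continuous, at the points of [U]. *)
Definition smooth_on (R : realType) (d : nat) (U : set 'rV[R]_d)
    (f : 'rV[R]_d -> R) : Prop :=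
  forall (l : seq 'I_d) (x : 'rV[R]_d), U x -> differentiable (partials l f) x.

(* [vb_data]/[is_vb]: vector bundles with [m]-dimensional base and fibre
   dimension [n], presented by an atlas of vector bundle charts.  The fibres
   are vector spaces; [crd c] and [triv c] are the fibre-linear coordinates
   (x^lambda) and (y^i), whose values matter over [dom c] only. *)
Record vb_data (R : realType) (m n : nat) := VbData {
  base : topologicalType;
  fiber : base -> lmodType R;
  chart : Type;
  dom : chart -> set base;
  crd : chart -> base -> 'rV[R]_m;
  triv : chart -> forall x : base, {linear fiber x -> 'rV[R]_n}
}.
Arguments base {R m n} _.
Arguments fiber {R m n} _ _.
Arguments chart {R m n} _.
Arguments dom {R m n} _ _ _.
Arguments crd {R m n} _ _ _.
Arguments triv {R m n} _ _ _.

Definition img (R : realType) (m n : nat) (E : vb_data R m n) (c : chart E) :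
    set 'rV[R]_m :=
  crd E c @` dom E c.

(* Fibrewise maps [(g, G) : E1 -> E2], considered over a subset [V] of the
   base of [E1] only. *)
Definition overlap (R : realType) (m n : nat) (E1 E2 : vb_data R m n)
    (V : set (base E1)) (g : base E1 -> base E2)
    (c1 : chart E1) (c2 : chart E2) : set (base E1) :=
  [set x | [/\ V x, dom E1 c1 x & dom E2 c2 (g x)]].

(* The coordinate expression of [(g, G)] is x' = f(x), y'^i = A_j^i(x) y^j,
   the entry [A x j i] being A_j^i(x). *)
Definition coord_expr (R : realType) (m n : nat) (E1 E2 : vb_data R m n)
    (V : set (base E1)) (g : base E1 -> base E2)
    (G : forall x, fiber E1 x -> fiber E2 (g x))
    (c1 : chart E1) (c2 : chart E2)
    (f : 'rV[R]_m -> 'rV[R]_m) (A : 'rV[R]_m -> 'M[R]_n) : Prop :=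
  forall x, overlap V g c1 c2 x ->
    crd E2 c2 (g x) = f (crd E1 c1 x) /\
    forall v : fiber E1 x,
      triv E2 c2 (g x) (G x v) = triv E1 c1 x v *m A (crd E1 c1 x).

Definition smooth_expr (R : realType) (m n : nat) (E1 E2 : vb_data R m n)
    (V : set (base E1)) (g : base E1 -> base E2)
    (G : forall x, fiber E1 x -> fiber E2 (g x)) : Prop :=
  forall (c1 : chart E1) (c2 : chart E2),
    exists (f : 'rV[R]_m -> 'rV[R]_m) (A : 'rV[R]_m -> 'M[R]_n),
    let U := crd E1 c1 @` overlap V g c1 c2 in
    [/\ coord_expr V G c1 c2 f A,
        forall l, smooth_on U (fun x => f x 0 l),
        forall j i, smooth_on U (fun x => A x j i)
      & forall x, U x -> jacobian f x \in unitmx /\ A x \in unitmx].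

Record is_vb (R : realType) (m n : nat) (E : vb_data R m n) : Prop := IsVb {
  base_hausdorff : hausdorff_space (base E);
  base_second_countable : @second_countable (base E);
  dom_open : forall c, open (dom E c);
  dom_cover : forall x, exists c, dom E c x;
  crd_inj : forall c, {in dom E c &, injective (crd E c)};
  (* [crd c] is a homeomorphism from [dom c] onto an open set *)
  crd_homeo : forall c (W : set (base E)), W `<=` dom E c ->
    (open W <-> open (crd E c @` W));
  triv_bij : forall c x, dom E c x -> bijective (triv E c x);
  transitions : smooth_expr (E1 := E) (E2 := E) setT (g := id) (fun _ v => v)
}.

Record vbundle (R : realType) (m n : nat) := VBundle {
  vb_carrier :> vb_data R m n;
  vb_axioms : is_vb vb_carrier
}.

(* Local fibre-linear diffeomorphism, defined over the open set [V] and
   covering an embedding [g] of [V]; bases having the same dimension, [g] is an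
   injective local diffeomorphism. *)
Record local_iso (R : realType) (m n : nat) (E1 E2 : vbundle R m n)
    (V : set (base E1)) (g : base E1 -> base E2)
    (G : forall x, fiber E1 x -> fiber E2 (g x)) : Prop := LocalIso {
  iso_dom_open : open V;
  iso_cont : forall W : set (base E2), open W -> open (V `&` g @^-1` W);
  iso_inj : {in V &, injective g};
  iso_smooth : smooth_expr V G
}.

(* Components [Gam x j i l] = Gamma_j^i_l(x) of a linear connection on a bundle
   of rank [k] over a [d]-dimensional base:
   nabla_l s^i = d_l s^i - Gamma_j^i_l s^j. *)
Definition coefs (R : realType) (d k : nat) :=
  'rV[R]_d -> 'I_k -> 'I_k -> 'I_d -> R.

(* Transformation law of the components of a linear connection under the
   fibre-linear map x' = f(x), y'^i = A_j^i(x) y^j: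
   Gam_j^i_l A_i^i' = Gam'_j'^i'_l'(f(x)) A_j^j' d_l f^l' - d_l A_j^i'. *)
Definition transforms (R : realType) (d k : nat) (U : set 'rV[R]_d)
    (f : 'rV[R]_d -> 'rV[R]_d) (A : 'rV[R]_d -> 'M[R]_k)
    (Gam Gam' : coefs R d k) : Prop :=
  forall x, U x -> forall (j i' : 'I_k) (l : 'I_d),
    \sum_i Gam x j i l * A x i i' =
    \sum_j' \sum_l' Gam' (f x) j' i' l' * A x j j' * jacobian f x l l'
    - partial l (fun z => A z j i') x.

(* In the induced coordinates (x^A) = (x^lambda, y^i) on the total space, a
   point is [row_mx x y]. *)
Definition over (R : realType) (m n : nat) (U : set 'rV[R]_m) :
    set 'rV[R]_(m + n) :=
  [set z | U (lsubmx z)].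

Definition tot_map (R : realType) (m n : nat) (f : 'rV[R]_m -> 'rV[R]_m)
    (A : 'rV[R]_m -> 'M[R]_n) : 'rV[R]_(m + n) -> 'rV[R]_(m + n) :=
  fun z => row_mx (f (lsubmx z)) (rsubmx z *m A (lsubmx z)).

(* [(g, G)] maps one connection to the other, for connections on the tangent
   bundle of the base, on the bundle itself, and on the tangent bundle of the
   total space respectively.  [f], [A] are determined by [(g, G)] on an open
   set, which is the only place where they are used. *)
Definition maps_base (R : realType) (m n : nat) (E1 E2 : vb_data R m n)
    (V : set (base E1)) (g : base E1 -> base E2)
    (G : forall x, fiber E1 x -> fiber E2 (g x))
    (L1 : chart E1 -> coefs R m m) (L2 : chart E2 -> coefs R m m) : Prop :=
  forall c1 c2 f A, coord_expr V G c1 c2 f A ->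
    transforms (crd E1 c1 @` overlap V g c1 c2) f (jacobian f)
      (L1 c1) (L2 c2).

Definition maps_bundle (R : realType) (m n : nat) (E1 E2 : vb_data R m n)
    (V : set (base E1)) (g : base E1 -> base E2)
    (G : forall x, fiber E1 x -> fiber E2 (g x))
    (K1 : chart E1 -> coefs R m n) (K2 : chart E2 -> coefs R m n) : Prop :=
  forall c1 c2 f A, coord_expr V G c1 c2 f A ->
    transforms (crd E1 c1 @` overlap V g c1 c2) f A (K1 c1) (K2 c2).

Definition maps_total (R : realType) (m n : nat) (E1 E2 : vb_data R m n)
    (V : set (base E1)) (g : base E1 -> base E2)
    (G : forall x, fiber E1 x -> fiber E2 (g x))
    (D1 : chart E1 -> coefs R (m + n) (m + n))
    (D2 : chart E2 -> coefs R (m + n) (m + n)) : Prop :=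
  forall c1 c2 f A, coord_expr V G c1 c2 f A ->
    transforms (over (crd E1 c1 @` overlap V g c1 c2))
      (tot_map f A) (jacobian (tot_map f A)) (D1 c1) (D2 c2).

(* A classical connection on M (a linear connection on TM -> M). *)
Record base_conn (R : realType) (m n : nat) (E : vbundle R m n) := BaseConn {
  bcoef :> chart E -> coefs R m m;
  bcoef_smooth : forall c mu la nu,
    smooth_on (img c) (fun x => bcoef c x mu la nu);
  bcoef_law : maps_base (E1 := E) (E2 := E) setT (g := id) (fun _ v => v)
    bcoef bcoef
}.

(* A general linear connection on E -> M. *)
Record lin_conn (R : realType) (m n : nat) (E : vbundle R m n) := LinConn {
  lcoef :> chart E -> coefs R m n;
  lcoef_smooth : forall c j i la,
    smooth_on (img c) (fun x => lcoef c x j i la);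
  lcoef_law : maps_bundle (E1 := E) (E2 := E) setT (g := id) (fun _ v => v)
    lcoef lcoef
}.

(* A classical connection on the manifold E (a linear connection on TE -> E). *)
Record total_conn (R : realType) (m n : nat) (E : vbundle R m n) := TotalConn {
  tcoef :> chart E -> coefs R (m + n) (m + n);
  tcoef_smooth : forall c B A C,
    smooth_on (over (img c)) (fun z => tcoef c z B A C);
  tcoef_law : maps_total (E1 := E) (E2 := E) setT (g := id) (fun _ v => v)
    tcoef tcoef
}.

Definition conn_rule (R : realType) (m n : nat) :=
  forall E : vbundle R m n, base_conn E -> lin_conn E -> total_conn E.

Definition natural (R : realType) (m n : nat) (Dt : conn_rule R m n) : Prop :=
  forall (E1 E2 : vbundle R m n) (V : set (base E1))
    (g : base E1 -> base E2) (G : forall x, fiber E1 x -> fiber E2 (g x)),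
  local_iso V G ->
  forall (L1 : base_conn E1) (K1 : lin_conn E1)
    (L2 : base_conn E2) (K2 : lin_conn E2),
  maps_base V G L1 L2 -> maps_bundle V G K1 K2 ->
  maps_total V G (Dt E1 L1 K1) (Dt E2 L2 K2).

(* Index set of the coordinates x^lambda, y^i, d_l Lambda_mu^la_nu (|l| <= s),
   d_l K_j^i_la (|l| <= r) on the jet space.  Partial derivatives are indexed by
   sequences of directions; since they are symmetric this only repeats
   coordinates. *)
Definition jet_index (m n s r : nat) : finType :=
  ('I_m + 'I_n
   + (s.-bseq 'I_m * 'I_m * 'I_m * 'I_m)
   + (r.-bseq 'I_m * 'I_n * 'I_n * 'I_m))%type.

Definition jet_coord (R : realType) (m n s r : nat) (L : coefs R m m)
    (K : coefs R m n) (z : 'rV[R]_(m + n)) (k : jet_index m n s r) : R :=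
  match k with
  | inl (inl (inl la)) => lsubmx z 0 la
  | inl (inl (inr i)) => rsubmx z 0 i
  | inl (inr (l, mu, la, nu)) =>
      partials l (fun x => L x mu la nu) (lsubmx z)
  | inr (l, j, i, la) => partials l (fun x => K x j i la) (lsubmx z)
  end.

Definition jets (R : realType) (m n s r : nat) (L : coefs R m m)
    (K : coefs R m n) (z : 'rV[R]_(m + n)) : 'rV[R]_#|jet_index m n s r| :=
  \row_k jet_coord L K z (enum_val k).

Definition jet_base (R : realType) (m n s r : nat)
    (w : 'rV[R]_#|jet_index m n s r|) : 'rV[R]_m :=
  \row_la w 0 (enum_rank (inl (inl (inl la)) : jet_index m n s r)).

(* The value at [u] is a smooth function of [u], j^s Lambda and j^r K. *)
Definition of_order (R : realType) (m n s r : nat) (Dt : conn_rule R m n) :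
    Prop :=
  forall (E : vbundle R m n) (c : chart E) (B A C : 'I_(m + n)),
  exists2 F : 'rV[R]_#|jet_index m n s r| -> R,
    smooth_on [set w | img c (jet_base w)] F &
    forall (L : base_conn E) (K : lin_conn E) (z : 'rV[R]_(m + n)),
      img c (lsubmx z) -> Dt E L K c z B A C = F (jets s r (L c) (K c) z).

(* Components, in one chart, of the objects entering the classification.
   Index order is that of the printed symbols, read from left to right, e.g.
   [torsion L x mu la nu] = T_mu^la_nu. *)

Definition symmetrized (R : realType) (m : nat) (L : coefs R m m) :
    coefs R m m :=
  fun x mu la nu => 2^-1 * (L x mu la nu + L x nu la mu).

Definition torsion (R : realType) (m : nat) (L : coefs R m m) : coefs R m m :=
  fun x mu la nu => 2^-1 * (L x mu la nu - L x nu la mu).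

Definition torsion_tr (R : realType) (m : nat) (L : coefs R m m)
    (x : 'rV[R]_m) (mu : 'I_m) : R :=
  \sum_rho torsion L x rho rho mu.

(* T_mu^rho_nu;si , the derivative being taken with respect to the symmetrized
   connection *)
Definition nabla_torsion (R : realType) (m : nat) (L : coefs R m m)
    (x : 'rV[R]_m) (mu rho nu si : 'I_m) : R :=
  let St := symmetrized L x in
  partial si (fun z => torsion L z mu rho nu) x
  - \sum_tau St tau rho si * torsion L x mu tau nu
  + \sum_tau St mu tau si * torsion L x tau rho nu
  + \sum_tau St nu tau si * torsion L x mu rho tau.

(* R_j^i_la,mu : the part of
   -2 (d_la K_j^i_mu + K_j^p_la K_p^i_mu) antisymmetric in la, mu *)
Definition curvature (R : realType) (m k : nat) (K : coefs R m k)
    (x : 'rV[R]_m) (j i : 'I_k) (la mu : 'I_m) : R :=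
  let Q la mu := partial la (fun z => K z j i mu) x
                 + \sum_p K x j p la * K x p i mu in
  - (Q la mu - Q mu la).

Definition S_tensor (R : realType) (m : nat) (a1 a2 a3 : R) (L : coefs R m m) :
    coefs R m m :=
  fun x mu la nu =>
    a1 * torsion L x mu la nu
    + a2 * ((la == mu)%:R * torsion_tr L x nu)
    + a3 * (torsion_tr L x mu * (la == nu)%:R).

Definition G_tensor (R : realType) (m n : nat)
    (b1 b2 b3 c1 c2 c3 d1 d2 e1 : R) (L : coefs R m m) (K : coefs R m n)
    (x : 'rV[R]_m) (mu nu : 'I_m) : R :=
  let T := torsion L x in
  let dT := nabla_torsion L x in
  let Rt := curvature (symmetrized L) x in
  b1 * (\sum_rho \sum_si T rho rho mu * T si si nu)
  + b2 * (\sum_rho \sum_si T si rho mu * T rho si nu)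
  + b3 * (\sum_rho \sum_si T rho rho si * T mu si nu)
  + c1 * (\sum_rho dT rho rho mu nu)
  + c2 * (\sum_rho dT rho rho nu mu)
  + c3 * (\sum_rho dT mu rho nu rho)
  + d1 * (\sum_rho Rt rho rho mu nu)
  + d2 * (\sum_rho Rt mu rho rho nu)
  + e1 * (\sum_p curvature K x p p mu nu).

(* Vectors and covectors at a point of the total space are rows of components
   in the bases (d_lambda, d_i) and (d^lambda, d^i); a section of
   T*E (x) TE (x) T*E has components Phi_B^A_C. *)

Definition tens3 (R : realType) (d : nat) (al v be : 'rV[R]_d)
    (B A C : 'I_d) : R :=
  al 0 B * v 0 A * be 0 C.

(* d_lambda or d^lambda *)
Definition bas (R : realType) (m n : nat) (la : 'I_m) : 'rV[R]_(m + n) :=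
  delta_mx 0 (lshift n la).

(* d_i or d^i *)
Definition fib (R : realType) (m n : nat) (i : 'I_n) : 'rV[R]_(m + n) :=
  delta_mx 0 (rshift m i).

(* h^K(d_lambda) *)
Definition hor (R : realType) (m n : nat) (K : coefs R m n)
    (z : 'rV[R]_(m + n)) (la : 'I_m) : 'rV[R]_(m + n) :=
  bas R n la + \sum_i \sum_j (K (lsubmx z) j i la * rsubmx z 0 j) *: fib R m i.

(* the covector d^i - K_j^i_lambda y^j d^lambda *)
Definition nu_form (R : realType) (m n : nat) (K : coefs R m n)
    (z : 'rV[R]_(m + n)) (i : 'I_n) : 'rV[R]_(m + n) :=
  fib R m i
  - \sum_la \sum_j (K (lsubmx z) j i la * rsubmx z 0 j) *: bas R n la.

(* h^K(S) *)
Definition hor_S (R : realType) (m n : nat) (K : coefs R m n)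
    (S : coefs R m m) : coefs R (m + n) (m + n) :=
  fun z B A C => \sum_mu \sum_la \sum_nu
    S (lsubmx z) mu la nu * tens3 (bas R n mu) (hor K z la) (bas R n nu) B A C.

(* L (x) G *)
Definition liouville_G (R : realType) (m n : nat)
    (G : 'rV[R]_m -> 'I_m -> 'I_m -> R) : coefs R (m + n) (m + n) :=
  fun z B A C => \sum_i \sum_mu \sum_nu
    rsubmx z 0 i * G (lsubmx z) mu nu
    * tens3 (bas R n mu) (fib R m i) (bas R n nu) B A C.

(* R[K](L) *)
Definition curv_liouville (R : realType) (m n : nat) (K : coefs R m n) :
    coefs R (m + n) (m + n) :=
  fun z B A C => \sum_j \sum_i \sum_mu \sum_nu
    curvature K (lsubmx z) j i mu nu * rsubmx z 0 j
    * tens3 (bas R n mu) (fib R m i) (bas R n nu) B A C.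

(* H = h1 nu_K (x) That + h2 That (x) nu_K *)
Definition H_tensor (R : realType) (m n : nat) (h1 h2 : R)
    (L : coefs R m m) (K : coefs R m n) : coefs R (m + n) (m + n) :=
  fun z B A C =>
    h1 * (\sum_i \sum_nu torsion_tr L (lsubmx z) nu
            * tens3 (nu_form K z i) (fib R m i) (bas R n nu) B A C)
    + h2 * (\sum_mu \sum_i torsion_tr L (lsubmx z) mu
            * tens3 (bas R n mu) (fib R m i) (nu_form K z i) B A C).

(* D(Lambda, K), through its components in the induced coordinates; the cases
   are D_mu^la_nu, D_mu^i_nu, D_mu^i_k and D_j^i_nu. *)
Definition std_conn (R : realType) (m n : nat) (L : coefs R m m)
    (K : coefs R m n) : coefs R (m + n) (m + n) :=
  fun z B A C =>
    let x := lsubmx z in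
    match fintype.split B, fintype.split A, fintype.split C with
    | inl mu, inl la, inl nu => L x mu la nu
    | inl mu, inr i, inl nu =>
        \sum_p (partial nu (fun t => K t p i mu) x
                - \sum_r K x r i nu * K x p r mu
                + \sum_rho K x p i rho * L x mu rho nu) * rsubmx z 0 p
    | inl mu, inr i, inr k => K x k i mu
    | inr j, inr i, inl nu => K x j i nu
    | _, _, _ => 0
    end.

(* Main.v *)
(* Naturality in bundle charts reduces everything to trivial bundles over open
   subsets of R^m.  Homotheties of the fibres and of the base, combined with the
   smoothness of the rule as a function of jets, show that the components of Dt at
   the origin are polynomial in the jets of the two connections: D_mu^la_nu,
   D_mu^i_k and D_j^i_nu are linear in the values of Lambda and K, D_mu^i_nu is
   linear in the fibre coordinate y with coefficients of degree two, quadratic in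
   the values plus linear in the first derivatives, and the other components
   vanish.  In particular only 1-jets matter.  In coordinates where K and the
   symmetric part of Lambda vanish at the origin, the remaining coefficients are
   GL(m) x GL(n)-invariant tensors, hence by Schur-Weyl duality combinations of
   contractions.  Invariance under x_mu |-> x_mu + x_mu^3 and under the fibre
   changes 1 + x_mu^2 beta / 2 relates the coefficients of the first derivatives,
   which leaves curvatures, covariant derivatives of the torsion and the standard
   connection; transforming back to arbitrary coordinates gives the formula. *)
Require Import Defs.
From mathcomp Require Import all_boot all_order all_fingroup all_algebra.
From mathcomp Require Import all_classical all_reals all_analysis.
From mathcomp Require Import ring lra.
Import Defs.
Set Implicit Arguments.
Unset Strict Implicit.
Unset Printing Implicit Defensive.
Import Order.TTheory GRing.Theory Num.Theory.
Import numFieldNormedType.Exports.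
Local Open Scope classical_set_scope.
Local Open Scope ring_scope.

(** * Smooth functions *)

Section Partial.
Variable R : realType.

(** Two gradings shape the argument. Under fibre homotheties [D_B^A_C] has degree in [y] equal to
    the number of fibre indices in [A] minus that in [B] and [C]. Under base homotheties a
    derivative of order [k] of a component has weight [k + 1], and [D_B^A_C] has as weight the
    number of base indices in [B] and [C] minus that in [A]. This weight is at most two, so
    derivatives of order two or more cannot occur, whatever [s] and [r] are. Base homotheties are
    usable only at the origin of a star-shaped domain. Statements are therefore proved there, for
    connections with affine components, and carried elsewhere by locality and by changes of
    coordinates. A second order change of coordinates removes [K] and the symmetric part of [Lambda]
    at a point, but not their first derivatives. A change whose first nonlinear term is one order
    higher keeps the zero values and alters only first derivatives. Applied to the zero connections,
    such changes give the linear relations between the six coefficients of the derivatives of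
    [Lambda], and between the four for [K]. *)

Lemma near_differentiable (V W : normedModType R) (f g : V -> W) (x : V) :
  (\near x, f x = g x) -> differentiable f x -> differentiable g x.
Proof.
move=> fg df.
(* [g] is [f] plus a function that vanishes near [x], and the latter has differential zero there. *)
suff dh : differentiable (g - f) x.
  have e : f + (g - f) = g by apply/funext => y; rewrite !fctE addrC subrK.
  by have := differentiableD df dh; rewrite e.
have hn : \near x, (g - f) x = 0.
  by apply: filterS fg => y fgy; rewrite !fctE fgy subrr.
have e : (g - f) \o shift x = cst ((g - f) x) + (\0 : {linear V -> W}) +o_ 0 id.
  apply/eqaddoP => _/posnumP[e].
  move: (hn); rewrite (near_shift 0 x) subr0 /= => hn0.
  near=> h.
  have -> : (g - f \o shift x - (cst ((g - f) x) + (\0 : {linear V -> W}))) h = 0.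
    rewrite /= !fctE /=.
    have h1 : (g - f) (h + x) = 0 by near: h.
    have h2 : (g - f) x = 0 by exact: (nbhs_singleton hn).
    by move: h1 h2; rewrite !fctE /= => -> ->; rewrite addr0 subrr.
  by rewrite normr0 mulr_ge0.
have c0 : continuous (\0 : {linear V -> W}) by move=> y; exact: cvg_cst.
apply/diff_locallyP; rewrite (diff_unique c0 e); split => //.
Unshelve. all: by end_near. Qed.

Variable d : nat.
Implicit Types (f g : 'rV[R]_d -> R) (x : 'rV[R]_d) (i : 'I_d).

Lemma near_partial f g x i : (\near x, f x = g x) -> partial i f x = partial i g x.
Proof. by move=> fg; exact: (near_eq_derive _ fg). Qed.

Lemma eq_on_partial (U : set 'rV[R]_d) f g x i : open U -> U x ->
  (forall y, U y -> f y = g y) -> partial i f x = partial i g x.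
Proof.
move=> oU Ux fg; apply: near_partial.
by apply: filterS (open_nbhs_nbhs (conj oU Ux)) => y; exact: fg.
Qed.

Lemma eq_on_differentiable (U : set 'rV[R]_d) f g x : open U -> U x ->
  (forall y, U y -> f y = g y) -> differentiable f x -> differentiable g x.
Proof.
move=> oU Ux fg; apply: near_differentiable.
by apply: filterS (open_nbhs_nbhs (conj oU Ux)) => y; exact: fg.
Qed.

Lemma diffableD f g x : differentiable f x -> differentiable g x ->
  differentiable (fun y => f y + g y : R) x.
Proof. exact: differentiableD. Qed.

Lemma diffableN f x : differentiable f x -> differentiable (fun y => - f y : R) x.
Proof. exact: differentiableN. Qed.

Lemma diffableM f g x : differentiable f x -> differentiable g x ->
  differentiable (fun y => f y * g y : R) x.
Proof. exact: differentiableM. Qed.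

Lemma diffable_cst c x : differentiable (fun _ : 'rV[R]_d => c : R) x.
Proof. exact: differentiable_cst. Qed.

Lemma diffable_coord i x : differentiable (fun y : 'rV[R]_d => y 0 i : R) x.
Proof. exact: differentiable_coord. Qed.

Lemma diffable_sum (I : Type) (r : seq I) (P : pred I) (F : I -> 'rV[R]_d -> R) x :
  (forall k, P k -> differentiable (F k) x) ->
  differentiable (fun y => \sum_(k <- r | P k) F k y : R) x.
Proof.
move=> dF; rewrite (_ : (fun y => _) = \sum_(k <- r | P k) F k); last first.
  by apply/funext => y; rewrite fct_sumE.
elim/big_ind : _ => [|? ? ? ?|//]; [exact: differentiable_cst | exact: differentiableD].
Qed.

Lemma partialD f g x i : differentiable f x -> differentiable g x ->
  partial i (fun y => f y + g y) x = partial i f x + partial i g x.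
Proof. by move=> df dg; apply: deriveD; exact: diff_derivable. Qed.

Lemma partialN f x i : differentiable f x ->
  partial i (fun y => - f y) x = - partial i f x.
Proof. by move=> df; apply: deriveN; exact: diff_derivable. Qed.

Lemma partialB f g x i : differentiable f x -> differentiable g x ->
  partial i (fun y => f y - g y) x = partial i f x - partial i g x.
Proof. by move=> df dg; apply: deriveB; exact: diff_derivable. Qed.

Lemma partialM f g x i : differentiable f x -> differentiable g x ->
  partial i (fun y => f y * g y) x = partial i f x * g x + f x * partial i g x.
Proof.
move=> df dg; rewrite /partial deriveM; [|exact: diff_derivable..].
by rewrite addrC; congr (_ + _); rewrite [LHS]mulrC.
Qed.

Lemma partial_cst c x i : partial i (fun _ : 'rV[R]_d => c) x = 0.
Proof. exact: derive_cst. Qed.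

Lemma partialZ c f x i : differentiable f x ->
  partial i (fun y => c * f y) x = c * partial i f x.
Proof.
move=> df; rewrite (partialM (f := fun=> c)) ?partial_cst ?mul0r ?add0r//.
Qed.

Lemma partial_sum (I : Type) (r : seq I) (P : pred I) (F : I -> 'rV[R]_d -> R) x i :
  (forall k, P k -> differentiable (F k) x) ->
  partial i (fun y => \sum_(k <- r | P k) F k y) x =
  \sum_(k <- r | P k) partial i (F k) x.
Proof.
move=> dF; elim: r => [|k r IH].
  by under eq_fun do rewrite big_nil; rewrite big_nil partial_cst.
rewrite big_cons; case: ifPn => Pk; last first.
  by rewrite -IH; congr (partial _ _ x); apply/funext => y; rewrite big_cons (negbTE Pk).
rewrite -IH -partialD; [|exact: dF|exact: diffable_sum].
by congr (partial _ _ x); apply/funext => y; rewrite big_cons Pk.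
Qed.

Lemma partial_coord (j i : 'I_d) x :
  partial i (fun y : 'rV[R]_d => y 0 j) x = (i == j)%:R.
Proof.
rewrite /partial; apply: cvg_lim => //; apply: cvg_near_cst.
near=> h => /=; rewrite !mxE eqxx eq_sym addrK /= /GRing.scale /= mulrA mulVf ?mul1r //.
by near: h; exact: nbhs_dnbhs_neq.
Unshelve. all: by end_near. Qed.

End Partial.

Section Chain.
Variables (R : realType) (d e : nat).

Lemma diffable_row (f : 'rV[R]_d -> 'rV[R]_e) x :
  (forall k, differentiable (fun y => f y 0 k : R) x) -> differentiable f x.
Proof.
move=> df; rewrite (_ : f = \sum_k (fun y => f y 0 k *: delta_mx 0 k)).
  by apply: differentiable_sum => k; exact: differentiableZl.
by apply/funext => y; rewrite fct_sumE -row_sum_delta.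
Qed.

Lemma diffable_comp (h : 'rV[R]_e -> R) (f : 'rV[R]_d -> 'rV[R]_e) x :
  (forall k, differentiable (fun y => f y 0 k : R) x) -> differentiable h (f x) ->
  differentiable (fun y => h (f y) : R) x.
Proof. by move=> df dh; apply: differentiable_comp => //; exact: diffable_row. Qed.

Lemma jacobianE (f : 'rV[R]_d -> 'rV[R]_e) x l k :
  (forall k, differentiable (fun y => f y 0 k : R) x) ->
  jacobian f x l k = partial l (fun y => f y 0 k) x.
Proof.
move=> df; have dfx := diffable_row df.
have := deriveEjacobian (delta_mx 0 l) dfx.
rewrite -rowE => /rowP/(_ k); rewrite [in RHS]mxE => <-.
by rewrite derive_mx ?mxE//; exact: diff_derivable.
Qed.

Lemma partial_comp (h : 'rV[R]_e -> R) (f : 'rV[R]_d -> 'rV[R]_e) x i :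
  (forall k, differentiable (fun y => f y 0 k : R) x) -> differentiable h (f x) ->
  partial i (fun y => h (f y)) x =
  \sum_k partial k h (f x) * partial i (fun y => f y 0 k) x.
Proof.
move=> df dh; have dfx := diffable_row df.
rewrite /partial deriveE; last exact: diffable_comp.
rewrite (diff_comp dfx dh) /= -(deriveE _ dfx) derive_mx; last exact: diff_derivable.
rewrite [X in 'd h _ X]row_sum_delta linear_sum; apply: eq_bigr => k _.
by rewrite linearZ /= mxE /partial -deriveE // mulrC.
Qed.

End Chain.

Section Smooth.
Variable R : realType.

(* Closed under partial derivatives and made of differentiable functions, so that
   its members are smooth. *)
Inductive smooth_closure d (U : set 'rV[R]_d) : ('rV[R]_d -> R) -> Prop :=
| SC_smooth f : smooth_on U f -> smooth_closure U f
| SC_add f g : smooth_closure U f -> smooth_closure U g ->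
    smooth_closure U (fun x => f x + g x)
| SC_mul f g : smooth_closure U f -> smooth_closure U g ->
    smooth_closure U (fun x => f x * g x)
| SC_inv f : smooth_closure U f -> (forall x, U x -> f x != 0) ->
    smooth_closure U (fun x => (f x)^-1)
| SC_comp e (U' : set 'rV[R]_e) h (f : 'rV[R]_d -> 'rV[R]_e) :
    smooth_on U' h -> (forall x, U x -> U' (f x)) ->
    (forall k, smooth_on U (fun x => f x 0 k)) ->
    smooth_closure U (fun x => h (f x))
| SC_eq f g : smooth_closure U f -> (forall x, U x -> f x = g x) ->
    smooth_closure U g.

Lemma smooth_partial d (U : set 'rV[R]_d) f i :
  smooth_on U f -> smooth_on U (partial i f).
Proof.
move=> sf l x Ux; rewrite -[partials l _]/(partials l (partials [:: i] f)).
by rewrite /partials -foldr_cat; exact: sf.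
Qed.

Lemma smooth_diff d (U : set 'rV[R]_d) f x : smooth_on U f -> U x -> differentiable f x.
Proof. by move=> sf; exact: (sf [::]). Qed.

Lemma smooth_cst d (U : set 'rV[R]_d) c : smooth_on U (fun=> c).
Proof.
suff H l : exists c', partials l (fun _ : 'rV[R]_d => c) = fun=> c'.
  by move=> l x _; have [c' ->] := H l; exact: diffable_cst.
elim: l => [|i l [c' /= ->]]; first by exists c.
by exists 0; apply/funext => x; exact: partial_cst.
Qed.

(** Each rule of calculus is available on [U] only, so the derivative is first assembled from the
    constructors and then identified through [SC_eq]. Openness of [U] lets equality on [U] pass to
    partial derivatives. *)
Lemma smooth_closure_partial d (U : set 'rV[R]_d) f : open U -> smooth_closure U f ->
  (forall x, U x -> differentiable f x) /\ forall i, smooth_closure U (partial i f).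
Proof.
move=> oU; elim => {f}.
- move=> f sf; split; first by move=> x; exact: smooth_diff.
  by move=> i; apply/SC_smooth/smooth_partial.
- move=> f g _ [df pf] _ [dg pg]; split; first by move=> x Ux; apply: diffableD; auto.
  move=> i; apply: (SC_eq (SC_add (pf i) (pg i))) => x Ux.
  by rewrite partialD; auto.
- move=> f g sf [df pf] sg [dg pg]; split; first by move=> x Ux; apply: diffableM; auto.
  move=> i; apply: (SC_eq (SC_add (SC_mul (pf i) sg) (SC_mul sf (pg i)))) => x Ux.
  by rewrite partialM; auto.
- move=> f sf [df pf] f0; split.
    by move=> x Ux; apply: differentiableV; auto.
  move=> i; have s1 := SC_smooth (@smooth_cst _ U (-1)).
  have si := SC_inv sf f0.
  apply: (SC_eq (SC_mul s1 (SC_mul (SC_mul si si) (pf i)))) => x Ux.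
  rewrite /partial deriveV; [|exact: f0|exact/diff_derivable/df].
  by rewrite /GRing.scale /= expr2 invfM mulN1r mulNr.
- move=> e U' h f sh Uf sf; split.
    move=> x Ux; apply: diffable_comp; last exact: (smooth_diff sh (Uf _ Ux)).
    by move=> k; exact: (smooth_diff (sf k) Ux).
  move=> i.
  have H : smooth_closure U (fun x => \sum_k partial k h (f x) *
      partial i (fun y => f y 0 k) x).
    elim: (index_enum _) => [|k r IH].
      apply: (SC_eq (SC_smooth (@smooth_cst _ U 0))) => x _.
      by rewrite big_nil.
    apply: (SC_eq (SC_add (SC_mul _ _) IH)); last first.
    - by move=> x _; rewrite big_cons.
    - exact/SC_smooth/smooth_partial.
    - exact: (SC_comp (smooth_partial k sh) Uf sf).
  apply: (SC_eq H) => x Ux; rewrite partial_comp //.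
    by move=> k; exact: (smooth_diff (sf k) Ux).
  exact: (smooth_diff sh (Uf _ Ux)).
- move=> f g sf [df pf] fg; split.
    by move=> x Ux; apply: (eq_on_differentiable oU Ux fg); auto.
  move=> i; apply: (SC_eq (pf i)) => x Ux; exact: (eq_on_partial _ oU Ux fg).
Qed.

Lemma smooth_closure_smooth d (U : set 'rV[R]_d) f : open U -> smooth_closure U f ->
  smooth_on U f.
Proof.
move=> oU sf l; suff : smooth_closure U (partials l f).
  by move=> /(smooth_closure_partial oU)[].
by elim: l => //= i l /(smooth_closure_partial oU)[].
Qed.

Section Closure.
Variables (d : nat) (U : set 'rV[R]_d).
Hypothesis oU : open U.
Implicit Types f g : 'rV[R]_d -> R.

Lemma smooth_add f g : smooth_on U f -> smooth_on U g -> smooth_on U (fun x => f x + g x).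
Proof. by move=> sf sg; apply/smooth_closure_smooth/SC_add => //; exact: SC_smooth. Qed.

Lemma smooth_mul f g : smooth_on U f -> smooth_on U g -> smooth_on U (fun x => f x * g x).
Proof. by move=> sf sg; apply/smooth_closure_smooth/SC_mul => //; exact: SC_smooth. Qed.

Lemma smooth_inv f : smooth_on U f -> (forall x, U x -> f x != 0) ->
  smooth_on U (fun x => (f x)^-1).
Proof. by move=> sf f0; apply/smooth_closure_smooth/SC_inv => //; exact: SC_smooth. Qed.

Lemma smooth_comp e (U' : set 'rV[R]_e) h (f : 'rV[R]_d -> 'rV[R]_e) :
  smooth_on U' h -> (forall x, U x -> U' (f x)) ->
  (forall k, smooth_on U (fun x => f x 0 k)) -> smooth_on U (fun x => h (f x)).
Proof.
by move=> sh Uf sf; apply/smooth_closure_smooth => //; exact: (SC_comp sh Uf sf).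
Qed.

Lemma smooth_eq f g : smooth_on U f -> (forall x, U x -> f x = g x) -> smooth_on U g.
Proof. by move=> sf fg; apply/smooth_closure_smooth/(SC_eq _ fg) => //; exact: SC_smooth. Qed.

Lemma smooth_opp f : smooth_on U f -> smooth_on U (fun x => - f x).
Proof.
move=> sf; apply: (smooth_eq (smooth_mul (@smooth_cst _ U (-1)) sf)) => x _.
by rewrite mulN1r.
Qed.

Lemma smooth_sub f g : smooth_on U f -> smooth_on U g -> smooth_on U (fun x => f x - g x).
Proof. by move=> sf sg; apply: smooth_add => //; exact: smooth_opp. Qed.

Lemma smooth_sum (I : Type) (r : seq I) (P : pred I) (F : I -> 'rV[R]_d -> R) :
  (forall k, smooth_on U (F k)) -> smooth_on U (fun x => \sum_(k <- r | P k) F k x).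
Proof.
move=> sF; elim: r => [|k r IH].
  by under eq_fun do rewrite big_nil; exact: smooth_cst.
under eq_fun do rewrite big_cons.
by case: (P k) => //; exact: smooth_add.
Qed.

Lemma smooth_prod (I : Type) (r : seq I) (P : pred I) (F : I -> 'rV[R]_d -> R) :
  (forall k, smooth_on U (F k)) -> smooth_on U (fun x => \prod_(k <- r | P k) F k x).
Proof.
move=> sF; elim: r => [|k r IH].
  by under eq_fun do rewrite big_nil; exact: smooth_cst.
under eq_fun do rewrite big_cons.
by case: (P k) => //; exact: smooth_mul.
Qed.

Lemma smooth_coord i : smooth_on U (fun x => x 0 i).
Proof.
move=> l x _.
have [->|[c ->]] : partials l (fun y : 'rV[R]_d => y 0 i) = (fun y => y 0 i) \/
    exists c, partials l (fun y : 'rV[R]_d => y 0 i) = fun=> c.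
- elim: l => [|j l [IH|[c IH]]]; [by left | right | right].
  + exists (j == i)%:R; rewrite /= IH; apply/funext => y; exact: partial_coord.
  + exists 0; rewrite /= IH; apply/funext => y; exact: partial_cst.
- exact: diffable_coord.
- exact: diffable_cst.
Qed.

Lemma smooth_det n (A : 'rV[R]_d -> 'M[R]_n) :
  (forall i j, smooth_on U (fun x => A x i j)) -> smooth_on U (fun x => \det (A x)).
Proof.
move=> sA; apply: smooth_sum => s; apply: smooth_mul; first exact: smooth_cst.
by apply: smooth_prod.
Qed.

Lemma smooth_invmx n (A : 'rV[R]_d -> 'M[R]_n) :
  (forall i j, smooth_on U (fun x => A x i j)) ->
  (forall x, U x -> A x \in unitmx) ->
  forall i j, smooth_on U (fun x => invmx (A x) i j).
Proof.
move=> sA uA i j.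
apply: (@smooth_eq (fun x => (\det (A x))^-1 * ((-1) ^+ (j + i) * \det (row' j (col' i (A x)))))); last first.
  by move=> x Ux; rewrite /invmx uA// !mxE.
apply: smooth_mul.
  apply: smooth_inv; first exact: smooth_det.
  by move=> x Ux; have := uA x Ux; rewrite unitmxE unitfE.
apply: smooth_mul; first exact: smooth_cst.
apply: smooth_det => k l; rewrite [X in smooth_on _ X](_ : _ = fun x => A x (lift j k) (lift i l))//.
by apply/funext => x; rewrite !mxE.
Qed.

End Closure.

Lemma smooth_subset d (U V : set 'rV[R]_d) f : V `<=` U -> smooth_on U f -> smooth_on V f.
Proof. by move=> VU sf l x /VU; exact: sf. Qed.

Lemma open_lsubmx m n (U : set 'rV[R]_m) : open U -> open (over (n := n) U).
Proof.
by move=> oU; apply: (@open_comp _ _ (@lsubmx R 1 m n)) => // z _; exact: continuous_lsubmx.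
Qed.

End Smooth.

(** * Connections on trivial bundles *)

Section Transforms.
Variable R : realType.

(** Given by its entries, so that it can be rewritten and differentiated entry by entry.
    [jacobian_jac] identifies it with [jacobian] where [f] is smooth. *)
Definition jac d e (f : 'rV[R]_d -> 'rV[R]_e) (x : 'rV[R]_d) : 'M[R]_(d, e) :=
  \matrix_(l, k) partial l (fun y => f y 0 k) x.

Lemma jacobian_jac d e (U : set 'rV[R]_d) (f : 'rV[R]_d -> 'rV[R]_e) x :
  (forall l, smooth_on U (fun x => f x 0 l)) -> U x -> jacobian f x = jac f x.
Proof.
move=> sf Ux; apply/matrixP => l k; rewrite [RHS]mxE.
by apply: jacobianE => q; exact: (smooth_diff (sf q) Ux).
Qed.

Lemma jac_ext d (U : set 'rV[R]_d) (f f' : 'rV[R]_d -> 'rV[R]_d) x : open U -> U x ->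
  (forall x, U x -> f' x = f x) -> jac f' x = jac f x.
Proof.
move=> oU Ux ff; apply/matrixP => l l'; rewrite !mxE.
by apply: (eq_on_partial _ oU Ux) => y Uy; rewrite ff.
Qed.

(* [transforms] with a matrix-valued function [J] in place of the library's
   Jacobian. *)
Definition transf d k (U : set 'rV[R]_d) (f : 'rV[R]_d -> 'rV[R]_d)
    (J : 'rV[R]_d -> 'M[R]_d) (A : 'rV[R]_d -> 'M[R]_k) (Gam Gam' : coefs R d k) : Prop :=
  forall x, U x -> forall (j i' : 'I_k) (l : 'I_d),
    \sum_i Gam x j i l * A x i i' =
    \sum_j' \sum_l' Gam' (f x) j' i' l' * A x j j' * J x l l'
    - partial l (fun z => A z j i') x.

Lemma transforms_transf d k (U : set 'rV[R]_d) (f : 'rV[R]_d -> 'rV[R]_d)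
    (A : 'rV[R]_d -> 'M[R]_k) (G1 G2 : coefs R d k) :
  (forall l, smooth_on U (fun x => f x 0 l)) ->
  transforms U f A G1 G2 <-> transf U f (jac f) A G1 G2.
Proof.
move=> sf; split=> H x Ux j i' l; have := H x Ux j i' l; have := jacobian_jac sf Ux.
- by move: (jacobian f x) => J ->.
- by move: (jacobian f x) => J ->.
Qed.

(** The law contains a derivative of [A], so agreement is required on an open set and not just at a
    point. *)
Lemma transf_ext d k (U : set 'rV[R]_d) (f f' : 'rV[R]_d -> 'rV[R]_d) J J'
    (A A' : 'rV[R]_d -> 'M[R]_k) (G1 G2 : coefs R d k) : open U ->
  (forall x, U x -> f' x = f x) -> (forall x, U x -> J' x = J x) ->
  (forall x, U x -> A' x = A x) ->
  transf U f J A G1 G2 -> transf U f' J' A' G1 G2.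
Proof.
move=> oU ff JJ AA H x Ux j i' l; have := H x Ux j i' l.
have -> : partial l (fun z => A' z j i') x = partial l (fun z => A z j i') x.
  by apply: (eq_on_partial _ oU Ux) => y Uy; rewrite AA.
by rewrite (JJ _ Ux) (AA _ Ux) (ff _ Ux).
Qed.

Lemma transforms_ext d k (U : set 'rV[R]_d) (f f' : 'rV[R]_d -> 'rV[R]_d)
    (A A' : 'rV[R]_d -> 'M[R]_k) (G1 G2 : coefs R d k) : open U ->
  (forall l, smooth_on U (fun x => f x 0 l)) ->
  (forall x, U x -> f' x = f x) -> (forall x, U x -> A' x = A x) ->
  transforms U f A G1 G2 -> transforms U f' A' G1 G2.
Proof.
move=> oU sf ff AA /(transforms_transf _ _ _ sf) H; apply/transforms_transf.
  by move=> l; apply: (smooth_eq oU (sf l)) => x Ux; rewrite ff.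
by apply: transf_ext H => // x Ux; exact: (jac_ext oU Ux ff).
Qed.

Lemma sum_delta k (F : 'I_k -> R) i : \sum_j F j * (i == j)%:R = F i.
Proof.
rewrite (bigD1 i) //= eqxx mulr1 big1 ?addr0// => j ji.
by rewrite eq_sym (negbTE ji) mulr0.
Qed.

Lemma sum_delta' k (F : 'I_k -> R) i : \sum_j F j * (j == i)%:R = F i.
Proof. by under eq_bigr do rewrite eq_sym; exact: sum_delta. Qed.

Lemma jac_id d (x : 'rV[R]_d) : jac id x = 1%:M.
Proof. by apply/matrixP => l l'; rewrite mxE partial_coord mxE. Qed.

Lemma transf_id d k (U : set 'rV[R]_d) (G1 G2 : coefs R d k) :
  transf U id (jac id) (fun=> 1%:M) G1 G2 <->
  (forall x, U x -> forall j i l, G1 x j i l = G2 x j i l).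
Proof.
have E x j i' l : (\sum_i G1 x j i l * (1%:M : 'M[R]_k) i i' =
    \sum_j' \sum_l' G2 (id x) j' i' l' * (1%:M : 'M[R]_k) j j' * jac id x l l'
    - partial l (fun z => (1%:M : 'M[R]_k) j i') x) <-> G1 x j i' l = G2 x j i' l.
  rewrite partial_cst subr0 jac_id.
  have -> : \sum_i G1 x j i l * (1%:M : 'M[R]_k) i i' = G1 x j i' l.
    by under eq_bigr do rewrite mxE; rewrite sum_delta'.
  suff -> : \sum_j' \sum_l' G2 (id x) j' i' l' * (1%:M : 'M[R]_k) j j' * (1%:M : 'M[R]_d) l l'
    = G2 x j i' l by [].
  under eq_bigr => j' _.
    under eq_bigr do rewrite mxE [(1%:M : 'M[R]_d) _ _]mxE.
    rewrite sum_delta.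
    over.
  by rewrite sum_delta.
by split=> H x Ux j i l; apply/E; exact: H.
Qed.

Lemma transforms_id d k (U : set 'rV[R]_d) (G1 G2 : coefs R d k) :
  transforms U id (fun=> 1%:M) G1 G2 <->
  (forall x, U x -> forall j i l, G1 x j i l = G2 x j i l).
Proof.
apply: iff_trans (transforms_transf _ _ _ _) _; last exact: transf_id.
by move=> l; exact: smooth_coord.
Qed.

End Transforms.

Section SecondCountable.
Variables (R : realType) (m : nat) (U : set 'rV[R]_m).

(** The traces on [U] of the balls with rational centre and radius [1/(N+1)] form a countable
    basis. *)
Lemma second_countable_sub : @second_countable U.
Proof.
pose ctr (q : 'rV[rat]_m) : 'rV[R]_m := map_mx ratr q.
pose b (p : 'rV[rat]_m * nat) : set U := set_val @^-1` ball (ctr p.1) (p.2.+1%:R^-1).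
exists (range b); first exact: sub_countable (card_image_le _ _) (countableP _).
split=> [_ [p _ <-]|x W].
  exists (ball (ctr p.1) (p.2.+1%:R^-1)) => //.
  exact: ball_open.
case=> _ [[Q oQ <-] /= Qx QW].
have /nbhs_ballP[_/posnumP[e] eQ] := open_nbhs_nbhs (conj oQ Qx).
have e2 : (0 : R) < e%:num / 2 by [].
(* A radius below [e / 2] keeps the chosen ball inside the ball of radius [e] by the triangle
   inequality. *)
have [N Ne] := ltr_add_invr e2.
rewrite add0r in Ne.
have np : (0 : R) < N.+1%:R^-1 by rewrite invr_gt0.
have /choice[q qP] : forall j, exists q : rat, `|set_val x 0 j - ratr q| < N.+1%:R^-1.
  move=> j; have [] := @rat_in_itvoo R (set_val x 0 j - N.+1%:R^-1) (set_val x 0 j + N.+1%:R^-1).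
    by rewrite ltrD2l gtrN.
  move=> q; rewrite in_itv /= => /andP[q1 q2]; exists q.
  by rewrite ltr_distlC q1.
exists (b (\row_j q j, N)).
  split; first by exists (\row_j q j, N).
  split => // i j; rewrite !mxE (ord1 i) /ball /= distrC; exact: qP.
move=> y by_; apply: QW; apply: eQ.
rewrite [e%:num]splitr; apply: ball_triangle (le_ball (ltW Ne) by_).
apply: (le_ball (ltW Ne)); split => // i j; rewrite !mxE (ord1 i) /ball /=; exact: qP.
Qed.

End SecondCountable.

Section Flat.
Variables (R : realType) (m n : nat).

Definition idlin (k : nat) : {linear 'rV[R]_k -> 'rV[R]_k} := idfun.

(* The trivial bundle U x R^n. *)
Definition flat_data (U : set 'rV[R]_m) : vb_data R m n :=
  @VbData R m n U (fun=> 'rV[R]_n) unit (fun=> setT) (fun _ x => set_val x)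
    (fun _ _ => idlin n).

(** The identity on fibres is linear and injective, so testing the fibre map on the standard basis
    vectors recovers every row of the matrix. *)
Lemma flat_coord_exprE (U V : set 'rV[R]_m) (g : V -> U) (A : 'rV[R]_m -> 'M[R]_n)
    c1 c2 f' A' :
  coord_expr (E1 := flat_data V) (E2 := flat_data U) setT (g := g)
    (fun x v => v *m A (set_val x)) c1 c2 f' A' <->
  (forall x : V, set_val (g x) = f' (set_val x)) /\
  (forall x, V x -> A x = A' x).
Proof.
split=> [H|[Hf HA] x _]; last first.
  by split=> [|v /=]; [exact: Hf | rewrite HA //; exact: set_valP].
split=> [x|x Vx]; first by have [] := H x (And3 I I I).
have [_ /= Hv] := H (SigSub (mem_set Vx)) (And3 I I I).
by apply/row_matrixP => i; rewrite !rowE; exact: Hv.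
Qed.

Lemma flat_overlap (U V : set 'rV[R]_m) (g : V -> U) c1 c2 :
  crd (flat_data V) c1 @` overlap (E1 := flat_data V) (E2 := flat_data U) setT g c1 c2 = V.
Proof.
apply/seteqP; split=> [_ [x _ <-]|x Vx]; first exact: set_valP.
by exists (SigSub (mem_set Vx)).
Qed.

Lemma flat_smooth_expr (U V : set 'rV[R]_m) (g : V -> U) f (A : 'rV[R]_m -> 'M[R]_n) :
  (forall x : V, set_val (g x) = f (set_val x)) ->
  (forall l, smooth_on V (fun x => f x 0 l)) ->
  (forall i j, smooth_on V (fun x => A x i j)) ->
  (forall x, V x -> jac f x \in unitmx /\ A x \in unitmx) ->
  smooth_expr (E1 := flat_data V) (E2 := flat_data U) setT (g := g)
    (fun x v => v *m A (set_val x)).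
Proof.
move=> gf sf sA uu c1 c2; exists f, A; rewrite flat_overlap; split => //.
  exact/flat_coord_exprE.
by move=> x Vx; rewrite (jacobian_jac sf Vx); exact: uu.
Qed.

Lemma flat_axioms (U : set 'rV[R]_m) : open U -> is_vb (flat_data U).
Proof.
move=> oU; split.
- move=> x y xy; apply: val_inj; apply: (@norm_hausdorff R 'rV[R]_m) => A B Ax By.
  have cv := @initial_continuous U _ set_val.
  have [z [Az Bz]] := xy _ _ (cv x _ Ax) (cv y _ By).
  by exists (set_val z).
- exact: second_countable_sub.
- by move=> c; exact: openT.
- by move=> x; exists tt.
- by move=> c x y _ _; exact: val_inj.
- move=> c W _; split=> [[Q oQ <-]|oW].
    rewrite (_ : _ @` _ = U `&` Q); first exact: openI.
    apply/seteqP; split=> [_ [x Qx <-]|x [Ux Qx]]; first by split => //; exact: set_valP.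
    by exists (SigSub (mem_set Ux)).
  exists (set_val @` W) => //; apply/seteqP; split=> [x [y Wy /val_inj <-]//|x Wx].
  by exists x.
- by move=> c x _; exists id.
- have := @flat_smooth_expr U U id id (fun=> 1%:M).
  rewrite (_ : (fun (x : U) v => v *m 1%:M) = fun _ v => v); last first.
    by apply/funext => x; apply/funext => v; rewrite mulmx1.
  apply => //.
  + by move=> l; exact: smooth_coord.
  + by move=> i j; exact: smooth_cst.
  + by move=> x _; rewrite jac_id !unitmx1.
Qed.

Definition flat (U : set 'rV[R]_m) (oU : open U) : vbundle R m n :=
  VBundle (flat_axioms oU).

Lemma flat_img (U : set 'rV[R]_m) (oU : open U) c : img (E := flat oU) c = U.
Proof.
apply/seteqP; split=> [_ [x _ <-]|x Ux]; first exact: set_valP.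
by exists (SigSub (mem_set Ux)).
Qed.

Section FlatMaps.
Variables (U V : set 'rV[R]_m) (oU : open U) (oV : open V).
Variables (f : 'rV[R]_m -> 'rV[R]_m) (A : 'rV[R]_m -> 'M[R]_n).
Hypothesis sf : forall l, smooth_on V (fun x => f x 0 l).
Variable g : V -> U.
Hypothesis gf : forall x : V, set_val (g x) = f (set_val x).

Let G := (fun (x : base (flat oV)) (v : fiber (flat oV) x) => v *m A (set_val x)) :
  forall x : base (flat oV), fiber (flat oV) x -> fiber (flat oU) (g x).

(** [maps_base] and its analogues quantify over all coordinate expressions. On [V] these all agree
    with [f] and [A], so checking the law for one of them suffices. *)
Lemma flat_coord_expr_on c1 c2 f' A' :
  coord_expr (E1 := flat oV) (E2 := flat oU) setT G c1 c2 f' A' ->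
  (forall x, V x -> f' x = f x) /\ (forall x, V x -> A' x = A x).
Proof.
move=> /flat_coord_exprE[Hf HA]; split=> x Vx; last by rewrite HA.
have := Hf (SigSub (mem_set Vx)); have := gf (SigSub (mem_set Vx)).
by move=> -> ->.
Qed.

Lemma flat_maps_bundle (K1 K2 : unit -> coefs R m n) :
  transf V f (jac f) A (K1 tt) (K2 tt) ->
  maps_bundle (E1 := flat oV) (E2 := flat oU) setT G K1 K2.
Proof.
move=> H [] [] f' A' /flat_coord_expr_on[ff AA]; rewrite flat_overlap.
by apply: (transforms_ext oV sf ff AA); apply/transforms_transf.
Qed.

Lemma flat_maps_base (L1 L2 : unit -> coefs R m m) :
  transf V f (jac f) (jac f) (L1 tt) (L2 tt) ->
  maps_base (E1 := flat oV) (E2 := flat oU) setT G L1 L2.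
Proof.
move=> H [] [] f' A' /flat_coord_expr_on[ff AA]; rewrite flat_overlap.
apply: (transforms_ext (f := f) (A := jac f) oV sf ff); last exact/transforms_transf.
have sf' l : smooth_on V (fun x => f' x 0 l).
  by apply: (smooth_eq oV (sf l)) => x Vx; rewrite ff.
by move=> x Vx; rewrite (jacobian_jac sf' Vx); exact: (jac_ext oV Vx ff).
Qed.

Hypothesis sA : forall i j, smooth_on V (fun x => A x i j).

Lemma tot_map_smooth k : smooth_on (over (n := n) V) (fun z => tot_map f A z 0 k).
Proof.
have oVn := open_lsubmx (n := n) oV.
have sl h : smooth_on V h -> smooth_on (over (n := n) V) (fun z : 'rV[R]_(m + n) => h (lsubmx z) : R).
  move=> sh; apply: (smooth_comp oVn sh) => // i.
  rewrite (_ : (fun x => _) = fun z : 'rV[R]_(m + n) => z 0 (lshift n i)).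
    exact: smooth_coord.
  by apply/funext => z; rewrite mxE.
rewrite -(splitK k); case: (fintype.split k) => i /=.
- under eq_fun do rewrite /tot_map row_mxEl.
  exact: (sl (fun x => f x 0 i)).
- under eq_fun do rewrite /tot_map row_mxEr mxE.
  apply: smooth_sum => // j; apply: smooth_mul => //; last exact: (sl (fun x => A x j i)).
  rewrite (_ : (fun x => _) = fun z : 'rV[R]_(m + n) => z 0 (rshift m j)).
    exact: smooth_coord.
  by apply/funext => z; rewrite mxE.
Qed.

Hypothesis uu : forall x, V x -> jac f x \in unitmx /\ A x \in unitmx.
Hypothesis finj : {in V &, injective f}.

Lemma flat_local_iso : local_iso (E1 := flat oV) (E2 := flat oU) setT G.
Proof.
split.
- exact: openT.
- move=> W [Q oQ <-]; rewrite setTI.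
  exists (f @^-1` Q `&` V).
    rewrite openE => x [Qx Vx]; apply: filterI; last first.
      by have := oV; rewrite openE; exact.
    have cf : {for x, continuous f}.
      by apply/differentiable_continuous/diffable_row => k; exact: (smooth_diff (sf k) Vx).
    by apply: cf; exact: open_nbhs_nbhs.
  apply/seteqP; split=> [x [Qx _]|x Qx]; first by rewrite /preimage /= gf.
  by split; [move: Qx; rewrite /preimage /= gf | exact: set_valP].
- move=> x y _ _ xy; apply: val_inj; apply: finj; [exact/mem_set/set_valP..|].
  by rewrite -!gf xy.
- exact: (flat_smooth_expr gf sf sA uu).
Qed.

Lemma flat_natural (Dt : conn_rule R m n) : natural Dt ->
  forall (L1 : base_conn (flat oV)) (K1 : lin_conn (flat oV))
    (L2 : base_conn (flat oU)) (K2 : lin_conn (flat oU)),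
  transf V f (jac f) (jac f) (L1 tt) (L2 tt) ->
  transf V f (jac f) A (K1 tt) (K2 tt) ->
  transf (over (n := n) V) (tot_map f A) (jac (tot_map f A)) (jac (tot_map f A))
    (Dt _ L1 K1 tt) (Dt _ L2 K2 tt).
Proof.
move=> Dn L1 K1 L2 K2 HL HK.
have := Dn _ _ _ _ _ flat_local_iso _ _ _ _ (flat_maps_base HL) (flat_maps_bundle HK).
have fA : coord_expr (E1 := flat oV) (E2 := flat oU) setT G tt tt f A.
  by apply/flat_coord_exprE; split.
move=> /(_ tt tt f A fA); rewrite flat_overlap => /(transforms_transf _ _ _ tot_map_smooth).
have oVn := open_lsubmx (n := n) oV.
apply: transf_ext => // z Vz; apply/esym; exact: (jacobian_jac tot_map_smooth Vz).
Qed.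

End FlatMaps.

(** With a single chart the only transition is the identity, so arbitrary components satisfy the
    law. *)
Lemma flat_bcoef_law (U : set 'rV[R]_m) (oU : open U) (L : coefs R m m) :
  maps_base (E1 := flat oU) (E2 := flat oU) setT (g := id) (fun _ v => v)
    (fun=> L) (fun=> L).
Proof.
rewrite (_ : (fun (x : U) v => v) = fun x v => v *m 1%:M); last first.
  by apply/funext => x; apply/funext => v; rewrite mulmx1.
apply: (@flat_maps_base U U oU oU id (fun=> 1%:M)) => //.
- by move=> l; exact: smooth_coord.
- apply: (transf_ext (A := fun=> 1%:M)) (iffRL (transf_id _ _ _) _) => //.
  by move=> x _; rewrite jac_id.
Qed.

Lemma flat_lcoef_law (U : set 'rV[R]_m) (oU : open U) (K : coefs R m n) :
  maps_bundle (E1 := flat oU) (E2 := flat oU) setT (g := id) (fun _ v => v)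
    (fun=> K) (fun=> K).
Proof.
rewrite (_ : (fun (x : U) v => v) = fun x v => v *m 1%:M); last first.
  by apply/funext => x; apply/funext => v; rewrite mulmx1.
apply: (@flat_maps_bundle U U oU oU id (fun=> 1%:M)) => //.
- by move=> l; exact: smooth_coord.
- exact/transf_id.
Qed.

Definition smooth_coefs d k (U : set 'rV[R]_d) (G : coefs R d k) :=
  forall j i l, smooth_on U (fun x => G x j i l).

(** Closed transparently, so that the components of the connection compute to [L]. *)
Definition flat_base (U : set 'rV[R]_m) (oU : open U) (L : coefs R m m)
  (sL : smooth_coefs U L) : base_conn (flat oU).
Proof.
apply: (@BaseConn R m n (flat oU) (fun=> L)); last exact: flat_bcoef_law.
by move=> c *; rewrite flat_img; exact: sL.
Defined.

Definition flat_lin (U : set 'rV[R]_m) (oU : open U) (K : coefs R m n)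
  (sK : smooth_coefs U K) : lin_conn (flat oU).
Proof.
apply: (@LinConn R m n (flat oU) (fun=> K)); last exact: flat_lcoef_law.
by move=> c *; rewrite flat_img; exact: sK.
Defined.

End Flat.

(** * Reduction of a bundle chart to a trivial bundle *)

Section ChartReduction.
Variables (R : realType) (m n : nat) (Dt : conn_rule R m n).
Hypothesis Dt_natural : natural Dt.

Lemma img_open (E : vbundle R m n) (c : chart E) : open (img c).
Proof.
apply/(crd_homeo (vb_axioms E)) => //; exact: (dom_open (vb_axioms E)).
Qed.

Lemma lcoef_smooth_coefs (E : vbundle R m n) (c : chart E) (K : lin_conn E) :
  smooth_coefs (img c) (K c).
Proof. by move=> *; exact: lcoef_smooth. Qed.

Lemma bcoef_smooth_coefs (E : vbundle R m n) (c : chart E) (L : base_conn E) :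
  smooth_coefs (img c) (L c).
Proof. by move=> *; exact: bcoef_smooth. Qed.

(** The inverse of a bundle chart is a local isomorphism from the trivial bundle over the image of
    the chart. It pulls the connections back to their own components, and naturality does the same
    for [Dt]. *)
Lemma chart_reduction (E : vbundle R m n) (c : chart E) (L : base_conn E) (K : lin_conn E)
    z B A C : img c (lsubmx z) ->
  Dt L K c z B A C =
  Dt (flat_base n (@img_open E c) (@bcoef_smooth_coefs E c L))
     (flat_lin (@img_open E c) (@lcoef_smooth_coefs E c K)) tt z B A C.
Proof.
move=> Uz; have vbE := vb_axioms E.
set oU := @img_open E c.
have /choice[g gP] (x : img c) : exists p, dom E c p /\ crd E c p = set_val x.
  by have [p dp e] := set_valP x; exists p.
have gdom x : dom E c (g x) by have [] := gP x.
have gcrd x : crd E c (g x) = set_val x by have [] := gP x.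
have hP x : {h : 'rV[R]_n -> fiber E (g x) |
    cancel (triv E c (g x)) h /\ cancel h (triv E c (g x))}.
  by apply: cid; have [h] := triv_bij vbE (gdom x); exists h.
pose G x := sval (hP x).
have GK1 x v : G x (triv E c (g x) v) = v by have [h1 _] := svalP (hP x); exact: h1.
have GK2 x v : triv E c (g x) (G x v) = v by have [_ h2] := svalP (hP x); exact: h2.
have gE p (dp : dom E c p) : exists x, g x = p.
  have Up : img c (crd E c p) by exists p.
  exists (SigSub (mem_set Up)); apply: (crd_inj vbE (c := c)); [exact/mem_set..|].
  by rewrite gcrd.
pose F := flat n oU.
(* Seen in a chart [c2], the inverse of [c] is the transition from [c] to [c2]. Smoothness and the
   laws of [L] and [K] thus reduce to those for the identity of [E]. *)
have exprE c2 f A' : coord_expr (E1 := F) (E2 := E) setT G tt c2 f A' <->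
    coord_expr (E1 := E) (E2 := E) setT (g := id) (fun _ v => v) c c2 f A'.
  split=> H.
    move=> p [_ dp dp2]; have [x xp] := gE p dp.
    move: dp2; rewrite -xp => dp2; have [Hf HA] := H x (And3 I I dp2).
    rewrite gcrd; split => // v; have := HA (triv E c (g x) v).
    by rewrite GK1.
  move=> x [_ _ dx]; have [Hf HA] := H (g x) (And3 I (gdom x) dx).
  rewrite gcrd in Hf HA; split => // v; have := HA (G x v).
  by rewrite GK2.
have ovE c2 : crd F tt @` overlap (E1 := F) (E2 := E) setT g tt c2 =
    crd E c @` overlap (E1 := E) (E2 := E) setT id c c2.
  apply/seteqP; split=> [_ [x [_ _ dx] <-]|_ [p [_ dp dp2] <-]].
    by exists (g x) => //; exact: gcrd.
  by have [x xp] := gE p dp; exists x; [rewrite /overlap /= xp | rewrite -xp gcrd].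
have iso : local_iso (E1 := F) (E2 := E) setT G.
  split.
  - exact: openT.
  - move=> W oW; rewrite setTI.
    exists (crd E c @` (W `&` dom E c)).
      apply/(crd_homeo vbE); first by move=> ? [].
      by apply: openI => //; exact: (dom_open vbE).
    apply/seteqP; split=> [x [p [Wp dp] px]|x Wx].
      have [y yp] := gE p dp; suff -> : x = y by rewrite /preimage /= yp.
      by apply: val_inj; rewrite -[val x]px -yp gcrd.
    by exists (g x); [split => //; exact: gdom | exact: gcrd].
  - by move=> x y _ _ xy; apply: val_inj; rewrite -[val x]gcrd xy gcrd.
  - move=> [] c2; rewrite ovE; have [f [A' [H1 H2 H3 H4]]] := transitions vbE c c2.
    by exists f, A'; split => //; exact/exprE.
have mb : maps_base (E1 := F) (E2 := E) setT G (flat_base n oU (@bcoef_smooth_coefs E c L)) L.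
  by move=> [] c2 f A' /exprE fA; rewrite ovE; exact: (@bcoef_law R m n E L c c2 f A' fA).
have mk : maps_bundle (E1 := F) (E2 := E) setT G (flat_lin oU (@lcoef_smooth_coefs E c K)) K.
  by move=> [] c2 f A' /exprE fA; rewrite ovE; exact: (@lcoef_law R m n E K c c2 f A' fA).
(* In the chart [c] itself the expression is the identity, and the transformation law becomes
   equality of components. *)
have fA : coord_expr (E1 := F) (E2 := E) setT G tt c id (fun=> 1%:M).
  by apply/exprE => p _; split => // v; rewrite mulmx1.
have := Dt_natural iso mb mk fA; rewrite ovE.
rewrite (_ : _ @` _ = img c); last first.
  by apply/seteqP; split=> [_ [p [_ dp _] <-]|_ [p dp <-]]; exists p.
rewrite (_ : tot_map id (fun=> 1%:M) = id); last first.
  by apply/funext => w; rewrite /tot_map mulmx1 hsubmxK.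
move=> /(transforms_ext (f' := id) (A' := fun=> 1%:M) (open_lsubmx (n := n) oU)) H.
have sid (l : 'I_(m + n)) : smooth_on (over (img c)) (fun x : 'rV[R]_(m + n) => x 0 l).
  exact: smooth_coord.
apply/esym; apply: (iffLR (transforms_id _ _ _) (H sid _ _)) => //.
by move=> x Ux; rewrite (jacobian_jac (U := over (img c)) sid Ux) jac_id.
Qed.

End ChartReduction.

(** * The transformation law on the total space *)

Section TotalLaw.
Variables (R : realType) (m n : nat).
Implicit Types (h : 'rV[R]_m -> R) (z : 'rV[R]_(m + n)).

Lemma partial_lsub_l h z s : differentiable h (lsubmx z) ->
  partial (lshift n s) (fun w : 'rV[R]_(m + n) => h (lsubmx w)) z = partial s h (lsubmx z).
Proof.
move=> dh; have dl q (w : 'rV[R]_(m + n)) : differentiable (fun w : 'rV[R]_(m + n) => lsubmx w 0 q : R) w.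
  by under eq_fun do rewrite mxE; exact: diffable_coord.
rewrite (partial_comp _ (fun q => dl q z) dh).
rewrite -[RHS](sum_delta (fun k => partial k h (lsubmx z))); apply: eq_bigr => k _; congr (_ * _).
under eq_fun do rewrite mxE.
by rewrite partial_coord (inj_eq (@lshift_inj _ _)).
Qed.

Lemma partial_lsub_r h z k : differentiable h (lsubmx z) ->
  partial (rshift m k) (fun w : 'rV[R]_(m + n) => h (lsubmx w)) z = 0.
Proof.
move=> dh; have dl q (w : 'rV[R]_(m + n)) : differentiable (fun w : 'rV[R]_(m + n) => lsubmx w 0 q : R) w.
  by under eq_fun do rewrite mxE; exact: diffable_coord.
rewrite (partial_comp _ (fun q => dl q z) dh) big1 // => j _.
under eq_fun do rewrite mxE.
by rewrite partial_coord eq_rlshift mulr0.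
Qed.

Lemma diffable_lsub h z : differentiable h (lsubmx z) ->
  differentiable (fun w : 'rV[R]_(m + n) => h (lsubmx w) : R) z.
Proof.
move=> dh; apply: diffable_comp => // k.
by under eq_fun do rewrite mxE; exact: diffable_coord.
Qed.

Lemma diffable_rsub z j : differentiable (fun w : 'rV[R]_(m + n) => rsubmx w 0 j : R) z.
Proof. by under eq_fun do rewrite mxE; exact: diffable_coord. Qed.

Lemma partial_rsub_l z s j :
  partial (lshift n s) (fun w : 'rV[R]_(m + n) => rsubmx w 0 j) z = 0.
Proof. by under eq_fun do rewrite mxE; rewrite partial_coord eq_lrshift. Qed.

Lemma partial_rsub_r z k j :
  partial (rshift m k) (fun w : 'rV[R]_(m + n) => rsubmx w 0 j) z = (k == j)%:R.
Proof.
by under eq_fun do rewrite mxE; rewrite partial_coord (inj_eq (@rshift_inj _ _)).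
Qed.

Lemma partial_fib_l (F : 'I_n -> 'rV[R]_m -> R) z s :
  (forall j, differentiable (F j) (lsubmx z)) ->
  partial (lshift n s) (fun w : 'rV[R]_(m + n) => \sum_j rsubmx w 0 j * F j (lsubmx w)) z =
  \sum_j rsubmx z 0 j * partial s (F j) (lsubmx z).
Proof.
move=> dF; rewrite partial_sum => [|j _]; last first.
  by apply: diffableM; [exact: diffable_rsub | exact: diffable_lsub].
apply: eq_bigr => j _; rewrite partialM; [|exact: diffable_rsub | exact: diffable_lsub].
by rewrite partial_rsub_l mul0r add0r partial_lsub_l.
Qed.

Lemma partial_fib_r (F : 'I_n -> 'rV[R]_m -> R) z k :
  (forall j, differentiable (F j) (lsubmx z)) ->
  partial (rshift m k) (fun w : 'rV[R]_(m + n) => \sum_j rsubmx w 0 j * F j (lsubmx w)) z =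
  F k (lsubmx z).
Proof.
move=> dF; rewrite partial_sum => [|j _]; last first.
  by apply: diffableM; [exact: diffable_rsub | exact: diffable_lsub].
rewrite -[RHS](sum_delta (fun j => F j (lsubmx z))); apply: eq_bigr => j _.
rewrite partialM; [|exact: diffable_rsub | exact: diffable_lsub].
by rewrite partial_rsub_r partial_lsub_r // mulr0 addr0 mulrC.
Qed.

Variables (V : set 'rV[R]_m) (f : 'rV[R]_m -> 'rV[R]_m) (A : 'rV[R]_m -> 'M[R]_n).
Hypothesis oV : open V.
Hypothesis sf : forall l, smooth_on V (fun x => f x 0 l).
Hypothesis sA : forall i j, smooth_on V (fun x => A x i j).

Definition tot_jac z : 'M[R]_(m + n) :=
  block_mx (jac f (lsubmx z))
    (\matrix_(l, i) \sum_j rsubmx z 0 j * partial l (fun x => A x j i) (lsubmx z))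
    0 (A (lsubmx z)).

Lemma tot_jac_ul z l l' : tot_jac z (lshift n l) (lshift n l') =
  partial l (fun y => f y 0 l') (lsubmx z).
Proof. by rewrite /tot_jac block_mxEul mxE. Qed.

Lemma tot_jac_ur z l i : tot_jac z (lshift n l) (rshift m i) =
  \sum_j rsubmx z 0 j * partial l (fun x => A x j i) (lsubmx z).
Proof. by rewrite /tot_jac block_mxEur mxE. Qed.

Lemma tot_jac_dl z j l : tot_jac z (rshift m j) (lshift n l) = 0.
Proof. by rewrite /tot_jac block_mxEdl mxE. Qed.

Lemma tot_jac_dr z j i : tot_jac z (rshift m j) (rshift m i) = A (lsubmx z) j i.
Proof. by rewrite /tot_jac block_mxEdr. Qed.

(** Second derivatives of [tot_map], the inhomogeneous term of the law. The remaining combinations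
    vanish because the base part ignores [y] and the fibre part is linear in [y]. *)
Definition tot_hess z (B A' C : 'I_(m + n)) : R :=
  match fintype.split B, fintype.split A', fintype.split C with
  | inl l, inl l', inl s => partial s (partial l (fun x => f x 0 l')) (lsubmx z)
  | inl l, inr i, inl s =>
      \sum_j rsubmx z 0 j * partial s (partial l (fun x => A x j i)) (lsubmx z)
  | inl l, inr i, inr k => partial l (fun x => A x k i) (lsubmx z)
  | inr j, inr i, inl s => partial s (fun x => A x j i) (lsubmx z)
  | _, _, _ => 0
  end.

Lemma tot_jacE z : V (lsubmx z) -> jac (tot_map f A) z = tot_jac z.
Proof.
move=> Vz; apply/matrixP => B C; rewrite [LHS]mxE -(splitK B) -(splitK C).
case: (fintype.split B) => [l|j]; case: (fintype.split C) => [l'|i] /=;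
  rewrite ?[in LHS]/tot_map /tot_jac ?block_mxEul ?block_mxEur ?block_mxEdl ?block_mxEdr.
- under eq_fun do rewrite row_mxEl.
  rewrite (partial_lsub_l (h := fun x => f x 0 l')); last exact: (smooth_diff (sf l') Vz).
  by rewrite mxE.
- under eq_fun do rewrite row_mxEr mxE.
  rewrite (partial_fib_l (F := fun j x => A x j i)); first by rewrite mxE.
  by move=> j; exact: (smooth_diff (sA j i) Vz).
- under eq_fun do rewrite row_mxEl.
  rewrite (partial_lsub_r (h := fun x => f x 0 l')); last exact: (smooth_diff (sf l') Vz).
  by rewrite mxE.
- under eq_fun do rewrite row_mxEr mxE.
  rewrite (partial_fib_r (F := fun j x => A x j i)) //.
  by move=> k; exact: (smooth_diff (sA k i) Vz).
Qed.

Lemma tot_hessE z B A' C : V (lsubmx z) ->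
  partial C (fun w => jac (tot_map f A) w B A') z = tot_hess z B A' C.
Proof.
move=> Vz; rewrite (@eq_on_partial _ _ (over V) _ (fun w => tot_jac w B A')) //; first last.
- by move=> w Vw; rewrite tot_jacE.
- exact: open_lsubmx.
rewrite /tot_hess -{1}(splitK B) -{1}(splitK A') -{1}(splitK C).
case: (fintype.split B) => [l|j]; case: (fintype.split A') => [l'|i].
- rewrite (_ : (fun w => _) = fun w => partial l (fun y => f y 0 l') (lsubmx w)); last first.
    by apply/funext => w; exact: tot_jac_ul.
  have df := smooth_diff (smooth_partial l (sf l')) Vz.
  by case: (fintype.split C) => [s|k]; [exact: partial_lsub_l | exact: partial_lsub_r].
- rewrite (_ : (fun w => _) = fun w => \sum_j rsubmx w 0 j *
      (fun j x => partial l (fun x => A x j i) x) j (lsubmx w)); last first.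
    by apply/funext => w; exact: tot_jac_ur.
  have df j := smooth_diff (smooth_partial l (sA j i)) Vz.
  case: (fintype.split C) => [s|k].
    exact: (partial_fib_l (F := fun j => partial l (fun x => A x j i)) _ df).
  exact: (partial_fib_r (F := fun j => partial l (fun x => A x j i)) _ df).
- rewrite (_ : (fun w => _) = fun=> 0); last by apply/funext => w; exact: tot_jac_dl.
  by case: (fintype.split C) => [s|k]; exact: partial_cst.
- rewrite (_ : (fun w => _) = fun w => (fun x => A x j i) (lsubmx w)); last first.
    by apply/funext => w; exact: tot_jac_dr.
  have df := smooth_diff (sA j i) Vz.
  case: (fintype.split C) => [s|k]; first exact: (partial_lsub_l _ df).
  exact: (partial_lsub_r _ df).
Qed.

Lemma tot_law (D1 D2 : coefs R (m + n) (m + n)) :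
  transf (over (n := n) V) (tot_map f A) (jac (tot_map f A)) (jac (tot_map f A)) D1 D2 ->
  forall z, V (lsubmx z) -> forall B A' C,
  \sum_A0 D1 z B A0 C * tot_jac z A0 A' =
  \sum_B' \sum_C' D2 (tot_map f A z) B' A' C' * tot_jac z B B' * tot_jac z C C'
    - tot_hess z B A' C.
Proof. by move=> H z Vz B A' C; have := H z Vz B A' C; rewrite tot_jacE // tot_hessE. Qed.

End TotalLaw.

(** * Naturality and homotheties *)

Section LinearMaps.
Variables (R : realType) (m n : nat) (Dt : conn_rule R m n).
Hypothesis Dt_natural : natural Dt.

Lemma flat_naturality (U V : set 'rV[R]_m) (oU : open U) (oV : open V)
    (f : 'rV[R]_m -> 'rV[R]_m) (A : 'rV[R]_m -> 'M[R]_n)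
    (L1 : base_conn (flat n oV)) (K1 : lin_conn (flat n oV))
    (L2 : base_conn (flat n oU)) (K2 : lin_conn (flat n oU)) :
  (forall l, smooth_on V (fun x => f x 0 l)) ->
  (forall i j, smooth_on V (fun x => A x i j)) ->
  (forall x, V x -> U (f x)) -> {in V &, injective f} ->
  (forall x, V x -> jac f x \in unitmx /\ A x \in unitmx) ->
  transf V f (jac f) (jac f) (L1 tt) (L2 tt) ->
  transf V f (jac f) A (K1 tt) (K2 tt) ->
  forall z, V (lsubmx z) -> forall B A' C,
  \sum_A0 Dt L1 K1 tt z B A0 C * tot_jac f A z A0 A' =
  \sum_B' \sum_C' Dt L2 K2 tt (tot_map f A z) B' A' C' * tot_jac f A z B B' * tot_jac f A z C C'
    - tot_hess f A z B A' C.
Proof.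
move=> sf sA VU fi uu HL HK.
pose g (x : V) : U := SigSub (mem_set (VU _ (set_valP x))).
have gf (x : V) : set_val (g x) = f (set_val x) by [].
exact: (tot_law oV sf sA (flat_natural sf gf sA uu fi Dt_natural HL HK)).
Qed.

Lemma lin_smooth (V : set 'rV[R]_m) (M : 'M[R]_m) l : smooth_on V (fun x => (x *m M) 0 l).
Proof.
suff H : smooth_on [set: 'rV[R]_m] (fun x => (x *m M) 0 l) by exact: smooth_subset H.
under eq_fun do rewrite mxE.
apply: smooth_sum => [|k]; first exact: openT.
by apply: smooth_mul; [exact: openT | exact: smooth_coord | exact: smooth_cst].
Qed.

Lemma jac_lin (M : 'M[R]_m) x : jac (fun x => x *m M) x = M.
Proof.
apply/matrixP => l k; rewrite mxE.
under eq_fun do rewrite mxE.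
rewrite partial_sum => [|j _]; last by apply: diffableM; [exact: diffable_coord | exact: diffable_cst].
rewrite -[RHS](sum_delta (fun j => M j k)); apply: eq_bigr => j _.
rewrite partialM; [|exact: diffable_coord | exact: diffable_cst].
by rewrite partial_cst partial_coord mulr0 addr0 mulrC.
Qed.

(** Equivariance under constant matrices in multiplied-out form, so that no inverse matrix has to be
    handled. *)
Definition related d k (M : 'M[R]_d) (N : 'M[R]_k) (G1 G2 : 'I_k -> 'I_k -> 'I_d -> R) :=
  forall j i' l, \sum_i G1 j i l * N i i' = \sum_j' \sum_l' G2 j' i' l' * N j j' * M l l'.

Lemma lin_transf k (V : set 'rV[R]_m) (M : 'M[R]_m) (N : 'M[R]_k) A (G1 G2 : coefs R m k) :
  (forall x, A x = N) ->
  (forall x, V x -> related M N (G1 x) (G2 (x *m M))) ->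
  transf V (fun x => x *m M) (jac (fun x => x *m M)) A G1 G2.
Proof.
move=> AN H x Vx j i' l; rewrite jac_lin AN H //.
under [in partial l _ x]eq_fun do rewrite AN.
by rewrite partial_cst subr0.
Qed.

(** Linear changes have no second derivatives, so under them the components of [Dt] transform as a
    tensor. *)
Lemma linear_naturality (U V : set 'rV[R]_m) (oU : open U) (oV : open V)
    (M : 'M[R]_m) (N : 'M[R]_n)
    (L1 : base_conn (flat n oV)) (K1 : lin_conn (flat n oV))
    (L2 : base_conn (flat n oU)) (K2 : lin_conn (flat n oU)) :
  M \in unitmx -> N \in unitmx -> (forall x, V x -> U (x *m M)) ->
  (forall x, V x -> related M M (L1 tt x) (L2 tt (x *m M))) ->
  (forall x, V x -> related M N (K1 tt x) (K2 tt (x *m M))) ->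
  forall x y, V x ->
  related (block_mx M 0 0 N) (block_mx M 0 0 N) (Dt L1 K1 tt (row_mx x y))
    (Dt L2 K2 tt (row_mx (x *m M) (y *m N))).
Proof.
move=> uM uN VU HL HK x y Vx B A' C.
have Vz : V (lsubmx (row_mx x y)) by rewrite row_mxKl.
have f_inj : {in V &, injective (fun x => x *m M)}.
  by move=> x1 x2 _ _ /(can_inj (mulmxK uM)).
have uu w : V w -> jac (fun x => x *m M) w \in unitmx /\ (fun=> N) w \in unitmx.
  by move=> _; rewrite jac_lin.
have := flat_naturality (lin_smooth M) (fun i j => @smooth_cst _ _ V (N i j)) VU f_inj uu
  (lin_transf (jac_lin M) HL) (lin_transf (fun=> erefl) HK) Vz B A' C.
have -> : tot_jac (fun x => x *m M) (fun=> N) (row_mx x y) = block_mx M 0 0 N.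
  rewrite /tot_jac jac_lin; congr (block_mx _ _ _ _).
  by apply/matrixP => l i; rewrite !mxE big1 // => j _; rewrite partial_cst mulr0.
have -> : tot_hess (fun x => x *m M) (fun=> N) (row_mx x y) B A' C = 0.
  have pl l l' : partial l (fun w : 'rV[R]_m => (w *m M) 0 l') = fun=> M l l'.
    by apply/funext => w; have := jac_lin M w => /matrixP/(_ l l'); rewrite mxE.
  rewrite /tot_hess; case: (fintype.split B) => [l|j]; case: (fintype.split A') => [l'|i];
    case: (fintype.split C) => [s|k]; rewrite ?pl ?partial_cst //.
  rewrite big1 // => j _; rewrite (_ : partial l _ = fun=> 0) ?partial_cst ?mulr0 //.
  by apply/funext => w; exact: partial_cst.
by rewrite subr0 /tot_map row_mxKl row_mxKr.
Qed.

Lemma related1 d k (G1 G2 : 'I_k -> 'I_k -> 'I_d -> R) :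
  related 1%:M 1%:M G1 G2 <-> (forall j i l, G1 j i l = G2 j i l).
Proof.
have E j i' l : (\sum_i G1 j i l * (1%:M : 'M[R]_k) i i' =
    \sum_j' \sum_l' G2 j' i' l' * (1%:M : 'M[R]_k) j j' * (1%:M : 'M[R]_d) l l')
    <-> G1 j i' l = G2 j i' l.
  have -> : \sum_i G1 j i l * (1%:M : 'M[R]_k) i i' = G1 j i' l.
    by under eq_bigr do rewrite mxE; rewrite sum_delta'.
  suff -> : \sum_j' \sum_l' G2 j' i' l' * (1%:M : 'M[R]_k) j j' * (1%:M : 'M[R]_d) l l'
    = G2 j i' l by [].
  under eq_bigr => j' _.
    under eq_bigr do rewrite mxE [(1%:M : 'M[R]_d) _ _]mxE.
    rewrite sum_delta.
    over.
  by rewrite sum_delta.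
by split=> H j i l; apply/E; exact: H.
Qed.

Lemma related_diag d k (M : 'rV[R]_d) (N : 'rV[R]_k) (G1 G2 : 'I_k -> 'I_k -> 'I_d -> R) :
  related (diag_mx M) (diag_mx N) G1 G2 <->
  (forall j i l, G1 j i l * N 0 i = G2 j i l * N 0 j * M 0 l).
Proof.
have E j i' l : (\sum_i G1 j i l * diag_mx N i i' =
    \sum_j' \sum_l' G2 j' i' l' * diag_mx N j j' * diag_mx M l l')
    <-> G1 j i' l * N 0 i' = G2 j i' l * N 0 j * M 0 l.
  have -> : \sum_i G1 j i l * diag_mx N i i' = G1 j i' l * N 0 i'.
    rewrite (bigD1 i') //= big1 ?addr0 => [|i ii]; first by rewrite mxE eqxx.
    by rewrite mxE (negbTE ii) mulr0.
  suff -> : \sum_j' \sum_l' G2 j' i' l' * diag_mx N j j' * diag_mx M l l'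
    = G2 j i' l * N 0 j * M 0 l by [].
  rewrite (bigD1 j) //= [X in _ + X]big1 ?addr0 => [|j' jj]; last first.
    by rewrite big1 // => l' _; rewrite mxE eq_sym (negbTE jj) mulr0 mul0r.
  rewrite (bigD1 l) //= big1 ?addr0 => [|l' ll]; last first.
    by rewrite [diag_mx M _ _]mxE eq_sym (negbTE ll) mulr0.
  by rewrite !mxE !eqxx.
by split=> H j i l; apply/E; exact: H.
Qed.

(** Locality of the rule: naturality is applied to the inclusion of [V] in [U]. *)
Lemma flat_restrict (U V : set 'rV[R]_m) (oU : open U) (oV : open V)
    (L1 : base_conn (flat n oV)) (K1 : lin_conn (flat n oV))
    (L2 : base_conn (flat n oU)) (K2 : lin_conn (flat n oU)) :
  V `<=` U ->
  (forall x, V x -> forall j i l, L1 tt x j i l = L2 tt x j i l) ->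
  (forall x, V x -> forall j i l, K1 tt x j i l = K2 tt x j i l) ->
  forall z B A C, V (lsubmx z) -> Dt L1 K1 tt z B A C = Dt L2 K2 tt z B A C.
Proof.
move=> VU HL HK z B A C Vz.
have := linear_naturality (L1 := L1) (K1 := K1) (L2 := L2) (K2 := K2)
  (unitmx1 R m) (unitmx1 R n) _ _ _ (rsubmx z) Vz.
rewrite -scalar_mx_block !mulmx1 hsubmxK => H; apply: (iffLR (related1 _ _) (H _ _ _)).
- by move=> x Vx; rewrite mulmx1; exact: VU.
- by move=> x Vx; rewrite mulmx1; apply/related1; exact: HL.
- by move=> x Vx; rewrite mulmx1; apply/related1; exact: HK.
Qed.

(** Factor by which the homothety with ratio [c] in the base and [t] in the fibre scales the
    direction [B]. *)
Definition blk (c t : R) (B : 'I_(m + n)) : R := if fintype.split B is inl _ then c else t.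

Lemma scaling_naturality (U V : set 'rV[R]_m) (oU : open U) (oV : open V) (c t : R)
    (L1 : base_conn (flat n oV)) (K1 : lin_conn (flat n oV))
    (L2 : base_conn (flat n oU)) (K2 : lin_conn (flat n oU)) :
  c != 0 -> t != 0 -> (forall x, V x -> U (c *: x)) ->
  (forall x, V x -> forall j i l, L1 tt x j i l = c * L2 tt (c *: x) j i l) ->
  (forall x, V x -> forall j i l, K1 tt x j i l = c * K2 tt (c *: x) j i l) ->
  forall x y, V x -> forall B A C,
  Dt L1 K1 tt (row_mx x y) B A C * blk c t A =
  Dt L2 K2 tt (row_mx (c *: x) (t *: y)) B A C * blk c t B * blk c t C.
Proof.
move=> c0 t0 VU HL HK x y Vx B A C.
have uC k (a : R) : a != 0 -> (a%:M : 'M[R]_k) \in unitmx.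
  by move=> a0; rewrite unitmxE det_scalar unitfE expf_neq0.
have := linear_naturality (L1 := L1) (K1 := K1) (L2 := L2) (K2 := K2)
  (uC m c c0) (uC n t t0) _ _ _ y Vx.
rewrite -!(diag_const_mx _ c) -!(diag_const_mx _ t) -diag_mx_row.
set D := row_mx _ _.
have DE i : D 0 i = blk c t i.
  by rewrite !mxE /blk; case: (fintype.split i) => ?; rewrite mxE.
rewrite !mul_mx_diag => H.
have sc k (v : 'rV[R]_k) a : \matrix_(i, j) (v i j * (const_mx a : 'rV[R]_k) 0 j) = a *: v.
  by apply/matrixP => i j; rewrite !mxE mulrC.
rewrite !sc in H.
have {}H := iffLR (related_diag _ _ _ _) (H _ _ _) B A C.
rewrite !DE in H; apply: H.
- by move=> w Vw; rewrite mul_mx_diag sc; exact: VU.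
- move=> w Vw; apply/related_diag => j i l.
  by rewrite mul_mx_diag sc !mxE HL //; ring.
- move=> w Vw; apply/related_diag => j i l.
  by rewrite mul_mx_diag sc !mxE HK //; ring.
Qed.

End LinearMaps.

(** * Functions homogeneous along a weighted curve *)

Section Weighted.
Variable R : realType.

(** Homogeneity is asked only for ratios of absolute value below one, since the base domains are
    preserved by contractions only. *)
Definition unit_itv : set 'rV[R]_1 := [set t | `|t 0 0| < 1].

Lemma open_unit_itv : open unit_itv.
Proof.
rewrite (_ : unit_itv = ball (0 : 'rV[R]_1) 1); first exact: ball_open.
apply/seteqP; split=> t; rewrite /unit_itv /ball /= /mx_ball.
  by move=> t1; split => // i j; rewrite !ord1 mxE /ball /= sub0r normrN.
by case=> _ /(_ 0 0); rewrite mxE /ball /= sub0r normrN.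
Qed.

Lemma unit_itv0 : unit_itv 0.
Proof. by rewrite /unit_itv /= mxE normr0. Qed.

(** If [p] and [q] differed at 0, they would by continuity differ on a whole neighbourhood, which
    contains nonzero points of the interval. *)
Lemma agree_on_unit_itv (p q : 'rV[R]_1 -> R) :
  differentiable p 0 -> differentiable q 0 ->
  (forall t, unit_itv t -> t 0 0 != 0 -> p t = q t) ->
  forall t, unit_itv t -> p t = q t.
Proof.
move=> dp dq pq t t1; have [t0|] := eqVneq (t 0 0) 0; last exact: pq.
have {t0} -> : t = 0 by apply/rowP => i; rewrite ord1 mxE.
apply/eqP/negPn/negP => h0; rewrite -subr_eq0 in h0.
have ch : {for 0, continuous (fun t => p t - q t)}.
  by apply: differentiable_continuous; apply: diffableD => //; exact: diffableN.
have : \forall t \near (0 : 'rV[R]_1), p t - q t != 0.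
  exact: (cvgr_neq0 _ ch h0).
move=> /nbhs_ballP[_/posnumP[e] eP].
(* A nonzero point lying both in the neighbourhood of radius [e] and in the unit interval. *)
pose a := Num.min (e%:num / 2) (2^-1 : R).
have a0 : 0 < a by rewrite lt_min divr_gt0 //= invr_gt0.
have ae : a < e%:num by rewrite gt_min ltr_pdivrMr // ltr_pMr // ltr1n.
have a1 : a < 1 by rewrite gt_min orbC invf_lt1 // ltr1n.
have := eP (const_mx a); rewrite /ball /= => /(_ _)/negP; apply.
  by split => // i j; rewrite !mxE /ball /= sub0r normrN gtr0_norm.
by rewrite pq ?subrr // /unit_itv /= mxE ?gtr0_norm // gt_eqF.
Qed.

Variables (N : nat) (w : 'I_N -> nat) (J : 'I_N -> R).

(* Smoothness at t = 0 turns homogeneity of degree e along t |-> (t^(w k) J_k) into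
   polynomial dependence on the coordinates J_k of weight at most e. *)
Definition wcurve (t : 'rV[R]_1) : 'rV[R]_N := \row_k (t 0 0 ^+ w k * J k).

Lemma smooth_exp e : smooth_on setT (fun t : 'rV[R]_1 => t 0 0 ^+ e).
Proof.
have oT := @openT 'rV[R]_1.
elim: e => [|e IH]; first exact: smooth_cst.
by under eq_fun do rewrite exprS; apply: smooth_mul => //; exact: smooth_coord.
Qed.

Lemma partial_exp e t :
  partial 0 (fun t : 'rV[R]_1 => t 0 0 ^+ e) t = e%:R * t 0 0 ^+ e.-1.
Proof.
elim: e => [|e IH].
  by rewrite mul0r; under eq_fun do rewrite expr0; exact: partial_cst.
under eq_fun do rewrite exprS.
rewrite partialM; [|exact: diffable_coord|exact: (smooth_diff (smooth_exp e))].
rewrite IH partial_coord eqxx mul1r /=; case: e IH => [|e] _.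
  by rewrite mul0r mulr0 addr0 mulr1.
by rewrite /= -[e.+2%:R]natr1 exprS; ring.
Qed.

Lemma smooth_wcurve k : smooth_on setT (fun t => wcurve t 0 k).
Proof.
under eq_fun do rewrite mxE.
by apply: smooth_mul; [exact: openT | exact: smooth_exp | exact: smooth_cst].
Qed.

Lemma partial_wcurve k t :
  partial 0 (fun t => wcurve t 0 k) t = (w k)%:R * t 0 0 ^+ (w k).-1 * J k.
Proof.
under eq_fun do rewrite mxE.
rewrite partialM; [|exact: (smooth_diff (smooth_exp _))|exact: diffable_cst].
by rewrite partial_cst partial_exp mulr0 addr0.
Qed.

Variables (W : set 'rV[R]_N) (G : 'rV[R]_N -> R) (X : R).
Hypothesis sG : smooth_on W G.
Hypothesis Wc : forall t, W (wcurve t).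

Lemma smooth_along H : smooth_on W H -> smooth_on setT (fun t => H (wcurve t)).
Proof. by move=> sH; apply: (smooth_comp _ sH) => // [|k]; [exact: openT|exact: smooth_wcurve]. Qed.

Lemma partial_along H t : smooth_on W H ->
  partial 0 (fun t => H (wcurve t)) t =
  \sum_k partial k H (wcurve t) * ((w k)%:R * t 0 0 ^+ (w k).-1 * J k).
Proof.
move=> sH; rewrite partial_comp.
- by apply: eq_bigr => k _; rewrite partial_wcurve.
- by move=> k; exact: (smooth_diff (smooth_wcurve k)).
- exact: (smooth_diff sH (Wc t)).
Qed.

Lemma agree_along (q : 'rV[R]_1 -> R) : smooth_on setT q ->
  (forall t, unit_itv t -> t 0 0 != 0 -> G (wcurve t) = q t) ->
  forall t, unit_itv t -> G (wcurve t) = q t.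
Proof.
move=> sq; apply: agree_on_unit_itv; last exact: (smooth_diff sq).
exact: (smooth_diff (smooth_along sG)).
Qed.

Lemma weight0 :
  (forall t, unit_itv t -> t 0 0 != 0 -> G (wcurve t) = X) -> X = G (wcurve 0).
Proof. by move=> /(agree_along (@smooth_cst _ _ _ X))/(_ _ unit_itv0) ->. Qed.

(** By continuity the identity survives at [t = 0], where its left side vanishes. *)
Lemma weight_neg e :
  (forall t, unit_itv t -> t 0 0 != 0 -> t 0 0 ^+ e.+1 * G (wcurve t) = X) -> X = 0.
Proof.
move=> H; have s1 : smooth_on setT (fun t => t 0 0 ^+ e.+1 * G (wcurve t)).
  by apply: smooth_mul; [exact: openT|exact: smooth_exp|exact: smooth_along].
have := agree_on_unit_itv (smooth_diff s1 _) (diffable_cst X 0) H unit_itv0.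
by move=> /(_ I) <-; rewrite mxE expr0n mul0r.
Qed.

Lemma wfactor1 k : (k%:R * 0 ^+ k.-1 : R) = (k == 1)%:R.
Proof. by case: k => [|[|k]]; rewrite ?mul0r ?mulr1 // exprS mul0r mulr0. Qed.

(** First derivative at [t = 0]: the derivative of [t ^ w] at 0 selects the coordinates of weight
    one. *)
Lemma weight1 :
  (forall t, unit_itv t -> t 0 0 != 0 -> G (wcurve t) = t 0 0 * X) ->
  X = \sum_k partial k G (wcurve 0) * ((w k == 1)%:R * J k).
Proof.
move=> H; have sq : smooth_on setT (fun t : 'rV[R]_1 => t 0 0 * X).
  by apply: smooth_mul; [exact: openT|exact: smooth_coord|exact: smooth_cst].
have := eq_on_partial 0 open_unit_itv unit_itv0 (agree_along sq H).
rewrite partial_along // partialM; [|exact: diffable_coord|exact: diffable_cst].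
rewrite partial_coord eqxx mul1r partial_cst mulr0 addr0 => <-.
by apply: eq_bigr => k _; rewrite mxE wfactor1.
Qed.

(** Second derivative at [t = 0]: it selects pairs of coordinates of weight one and single
    coordinates of weight two. The second derivative of [t ^ 2] is 2, which halves the quadratic
    part and cancels in the linear one. *)
Lemma weight2 :
  (forall t, unit_itv t -> t 0 0 != 0 -> G (wcurve t) = t 0 0 ^+ 2 * X) ->
  X = 2^-1 * (\sum_k \sum_k' partial k' (partial k G) (wcurve 0) *
        ((w k' == 1)%:R * J k') * ((w k == 1)%:R * J k))
    + \sum_k partial k G (wcurve 0) * ((w k == 2)%:R * J k).
Proof.
move=> H; have sq : smooth_on setT (fun t : 'rV[R]_1 => t 0 0 ^+ 2 * X).
  by apply: smooth_mul; [exact: openT|exact: smooth_exp|exact: smooth_cst].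
have H1 := agree_along sq H.
have H2 t : unit_itv t ->
    \sum_k partial k G (wcurve t) * ((w k)%:R * t 0 0 ^+ (w k).-1 * J k) = 2 * t 0 0 * X.
  move=> ut; rewrite -partial_along // (eq_on_partial 0 open_unit_itv ut H1).
  rewrite partialM; [|exact: (smooth_diff (smooth_exp 2))|exact: diffable_cst].
  by rewrite partial_exp partial_cst mulr0 addr0 expr1.
have := eq_on_partial 0 open_unit_itv unit_itv0 H2.
have de e t : differentiable (fun t : 'rV[R]_1 => t 0 0 ^+ e : R) t.
  exact: (smooth_diff (smooth_exp e)).
have dG k t : differentiable (fun t => partial k G (wcurve t) : R) t.
  exact: (smooth_diff (smooth_along (smooth_partial k sG))).
have dm k t : differentiable (fun t : 'rV[R]_1 => (w k)%:R * t 0 0 ^+ (w k).-1 * J k : R) t.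
  by apply: diffableM; [apply: diffableM => //|]; exact: diffable_cst.
rewrite partial_sum => [|k _]; last by apply: diffableM; auto.
have -> : partial 0 (fun t : 'rV[R]_1 => 2 * t 0 0 * X) 0 = 2 * X.
  rewrite partialM; [|by apply: diffableM; [exact: diffable_cst|exact: diffable_coord]|exact: diffable_cst].
  by rewrite partial_cst mulr0 addr0 partialZ ?partial_coord ?mulr1 //; exact: diffable_coord.
move=> E; apply: (mulfI (x := 2)); first by rewrite pnatr_eq0.
rewrite -E mulrDr mulrA divff ?pnatr_eq0 // mul1r mulr_sumr -big_split /=.
apply: eq_bigr => k _; rewrite partialM; [|exact: dG|exact: dm].
rewrite partial_along; last exact: smooth_partial.
congr (_ + _).
  rewrite mulr_suml; apply: eq_bigr => k' _; rewrite mxE !wfactor1; ring.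
rewrite partialM; [|by apply: diffableM; [exact: diffable_cst|exact: de]|exact: diffable_cst].
rewrite partial_cst mulr0 addr0 partialZ // partial_exp mxE.
case: (w k) => [|[|[|e]]]; rewrite /= ?expr0 ?exprS; ring.
Qed.

End Weighted.

Section Regroup.
Variables (R : realType) (I V : finType) (pr : I -> option V) (e : I -> R) (u : V -> R).
Hypothesis prS : forall k v, pr k = Some v -> e k = u v.
Hypothesis prN : forall k, pr k = None -> e k = 0.

(** [pr] sends the jet coordinates of the selected weight to an index set independent of the orders
    [s] and [r]. An index that [pr] misses, as happens in order zero, gets coefficient zero. *)
Lemma lin_regroup (c : I -> R) :
  \sum_k c k * e k = \sum_v (\sum_(k | pr k == Some v) c k) * u v.
Proof.
rewrite (bigID (fun k => isSome (pr k))) /= [X in _ + X]big1 ?addr0; last first.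
  by move=> k; case E: (pr k) => [v|] // _; rewrite prN ?mulr0.
under [RHS]eq_bigr do rewrite mulr_suml.
rewrite (exchange_big_dep (fun k => isSome (pr k))) /=; last by move=> v k _ /eqP ->.
apply: eq_bigr => k; case E: (pr k) => [v|] // _.
rewrite (big_pred1 v); first by rewrite (prS E).
by move=> v'; rewrite /= eq_sym.
Qed.

Lemma bilin_regroup (c : I -> I -> R) :
  \sum_k \sum_k' c k k' * e k' * e k =
  \sum_v \sum_v' (\sum_(k | pr k == Some v) \sum_(k' | pr k' == Some v') c k k') * u v' * u v.
Proof.
under eq_bigr do rewrite -mulr_suml lin_regroup.
rewrite lin_regroup; apply: eq_bigr => v _; rewrite -mulr_suml; congr (_ * _).
by rewrite exchange_big; apply: eq_bigr => v' _; rewrite mulr_suml.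
Qed.

End Regroup.

Lemma blk_neq0 (R : realType) m n (c t : R) (B : 'I_(m + n)) : c != 0 -> t != 0 -> blk c t B != 0.
Proof. by move=> c0 t0; rewrite /blk; case: fintype.split. Qed.

(** * Degrees of the components under homotheties *)

Section Homothety.
Variables (R : realType) (m n s r : nat) (Dt : conn_rule R m n).
Hypothesis Dt_natural : natural Dt.
Hypothesis Dt_order : of_order s r Dt.

Local Notation idx := (jet_index m n s r).

Lemma flat_order (U : set 'rV[R]_m) (oU : open U) (B A C : 'I_(m + n)) :
  exists2 F : 'rV[R]_#|idx| -> R, smooth_on [set w | U (jet_base w)] F &
    forall (L : base_conn (flat n oU)) (K : lin_conn (flat n oU)) z, U (lsubmx z) ->
      Dt L K tt z B A C = F (jets s r (L tt) (K tt) z).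
Proof.
have [F sF FE] := @Dt_order (flat n oU) tt B A C.
by rewrite flat_img in sF FE; exists F => // L K z Uz; apply: FE.
Qed.

Section FibreScaling.
Variables (U : set 'rV[R]_m) (oU : open U).
Variables (L : base_conn (flat n oU)) (K : lin_conn (flat n oU)).
Variables (x : 'rV[R]_m) (y : 'rV[R]_n).
Hypothesis Ux : U x.

Definition fib_weight (k : 'I_#|idx|) : nat :=
  if enum_val k is inl (inl (inr _)) then 1 else 0.

Lemma jets_fib t :
  jets s r (L tt) (K tt) (row_mx x (t *: y)) =
  wcurve fib_weight (fun k => jets s r (L tt) (K tt) (row_mx x y) 0 k) (const_mx t).
Proof.
apply/rowP => k; rewrite !mxE /fib_weight.
case: (enum_val k) => [[[la|i]|[[[l mu] la] nu]]|[[[l j] i] la]] /=;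
  rewrite ?row_mxKl ?row_mxKr ?expr0 ?mul1r ?expr1 //.
by rewrite mxE.
Qed.

Lemma jet_base_fib t :
  jet_base (wcurve fib_weight (fun k => jets s r (L tt) (K tt) (row_mx x y) 0 k) t) = x.
Proof. by apply/rowP => la; rewrite !mxE /fib_weight enum_rankK /= row_mxKl mul1r. Qed.

Lemma fib_scaling t B A C : t != 0 ->
  Dt L K tt (row_mx x y) B A C * blk 1 t A =
  Dt L K tt (row_mx x (t *: y)) B A C * blk 1 t B * blk 1 t C.
Proof.
move=> t0; rewrite -[X in row_mx X (t *: y)]scale1r.
by apply: (scaling_naturality Dt_natural) => // [w Uw|w _ j i l|w _ j i l]; rewrite ?oner_neq0 ?scale1r ?mul1r.
Qed.

(** The hypothesis says that the component has negative degree under fibre homotheties. *)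
Lemma fib_vanish e B A C :
  (forall t : R, t ^+ e.+1 * blk 1 t A = blk 1 t B * blk 1 t C) ->
  Dt L K tt (row_mx x y) B A C = 0.
Proof.
move=> wt; have [F sF FE] := flat_order oU B A C.
apply: (@weight_neg _ _ fib_weight (fun k => jets s r (L tt) (K tt) (row_mx x y) 0 k) _ F _ sF _ e).
  by move=> t; rewrite /= jet_base_fib.
move=> t _ t0; rewrite [t](_ : _ = const_mx (t 0 0)); last first.
  by apply/rowP => i; rewrite ord1 mxE.
rewrite -jets_fib -FE ?row_mxKl // mxE.
apply: (mulIf (blk_neq0 A (oner_neq0 _) t0)); rewrite fib_scaling // -mulrA -wt; ring.
Qed.

Lemma fib_invariant B A C :
  (forall t : R, blk 1 t A = blk 1 t B * blk 1 t C) ->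
  Dt L K tt (row_mx x y) B A C = Dt L K tt (row_mx x 0) B A C.
Proof.
move=> wt; have [F sF FE] := flat_order oU B A C.
rewrite (@weight0 _ _ fib_weight (fun k => jets s r (L tt) (K tt) (row_mx x y) 0 k) _ F (Dt L K tt (row_mx x y) B A C) sF).
- rewrite (_ : 0 = const_mx 0); last by apply/rowP => i; rewrite !mxE.
  by rewrite -jets_fib scale0r -FE ?row_mxKl.
- by move=> t; rewrite /= jet_base_fib.
- move=> t _ t0; rewrite [t](_ : _ = const_mx (t 0 0)); last first.
    by apply/rowP => i; rewrite ord1 mxE.
  rewrite -jets_fib -FE ?row_mxKl //.
  by apply: (mulIf (blk_neq0 A (oner_neq0 _) t0)); rewrite fib_scaling // -mulrA -wt.
Qed.

(** Degree one in [y]. [F] is kept as a parameter because its derivatives along the fibre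
    coordinates are the smooth functions to which base homotheties are applied next. *)
Lemma fib_linear F B A C :
  smooth_on [set w : 'rV[R]_#|idx| | U (jet_base w)] F ->
  (forall (L : base_conn (flat n oU)) (K : lin_conn (flat n oU)) z, U (lsubmx z) ->
      Dt L K tt z B A C = F (jets s r (L tt) (K tt) z)) ->
  (forall t : R, blk 1 t A = t * blk 1 t B * blk 1 t C) ->
  Dt L K tt (row_mx x y) B A C =
  \sum_p y 0 p * partial (enum_rank (inl (inl (inr p)) : idx)) F
     (jets s r (L tt) (K tt) (row_mx x 0)).
Proof.
move=> sF FE wt.
rewrite (@weight1 _ _ fib_weight (fun k => jets s r (L tt) (K tt) (row_mx x y) 0 k) _ F (Dt L K tt (row_mx x y) B A C) sF).
- have -> : wcurve fib_weight (fun k => jets s r (L tt) (K tt) (row_mx x y) 0 k) 0 =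
      jets s r (L tt) (K tt) (row_mx x 0).
    rewrite (_ : 0 = const_mx 0); last by apply/rowP => i; rewrite !mxE.
    by rewrite -jets_fib scale0r.
  pose pr (k : 'I_#|idx|) := if enum_val k is inl (inl (inr i)) then Some i else None.
  rewrite (@lin_regroup _ _ _ pr _ (fun p => y 0 p)).
  + apply: eq_bigr => p _; rewrite mulrC; congr (_ * _).
    rewrite (big_pred1 (enum_rank (inl (inl (inr p)) : idx))) // => k /=.
    rewrite -(inj_eq enum_val_inj) enum_rankK /pr.
    by case: (enum_val k) => [[[la|i]|[[[l mu] la] nu]]|[[[l j] i] la]] //=.
  + move=> k v; rewrite /pr /fib_weight !mxE.
    by case: (enum_val k) => [[[la|i]|[[[l mu] la] nu]]|[[[l j] i] la]] //= [<-]; rewrite row_mxKr mul1r.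
  + move=> k; rewrite /pr /fib_weight.
    by case: (enum_val k) => [[[la|i]|[[[l mu] la] nu]]|[[[l j] i] la]] //= _; rewrite mul0r.
- by move=> t; rewrite /= jet_base_fib.
- move=> t _ t0; rewrite [t](_ : _ = const_mx (t 0 0)); last first.
    by apply/rowP => i; rewrite ord1 mxE.
  rewrite -jets_fib -FE ?row_mxKl // mxE.
  apply: (mulIf (blk_neq0 A (oner_neq0 _) t0)); rewrite -[RHS]mulrA [X in _ = t 0 0 * X]fib_scaling // wt; ring.
Qed.

End FibreScaling.

Lemma smooth_partials d (U : set 'rV[R]_d) h l : smooth_on U h -> smooth_on U (partials l h).
Proof. by move=> sh; elim: l => //= i l; exact: smooth_partial. Qed.

Definition index0 : finType := ('I_m * 'I_m * 'I_m + 'I_n * 'I_n * 'I_m)%type.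
Definition index1 : finType :=
  ('I_m * 'I_m * 'I_m * 'I_m + 'I_n * 'I_n * 'I_m * 'I_m)%type.

Definition jet0 (L : coefs R m m) (K : coefs R m n) (v : index0) : R :=
  match v with
  | inl (a, b, c) => L 0 a b c
  | inr (a, b, c) => K 0 a b c
  end.

Definition jet1 (L : coefs R m m) (K : coefs R m n) (v : index1) : R :=
  match v with
  | inl (a, b, c, si) => partial si (fun x => L x a b c) 0
  | inr (a, b, c, si) => partial si (fun x => K x a b c) 0
  end.

Section BaseScaling.
Variables (V : set 'rV[R]_m) (oV : open V).
Hypothesis V0 : V 0.
Hypothesis Vc : forall (c : R) x, `|c| <= 1 -> V x -> V (c *: x).

Lemma smooth_scaled (c : R) h : `|c| <= 1 -> smooth_on V h ->
  smooth_on V (fun x => c * h (c *: x)).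
Proof.
move=> c1 sh; apply: smooth_mul => //; first exact: smooth_cst.
apply: (smooth_comp oV sh) => [x|k]; first exact: Vc.
under eq_fun do rewrite mxE.
by apply: smooth_mul => //; [exact: smooth_cst | exact: smooth_coord].
Qed.

Lemma partials_scaled (c : R) h l x : `|c| <= 1 -> smooth_on V h -> V x ->
  partials l (fun x => c * h (c *: x)) x = c ^+ (size l).+1 * partials l h (c *: x).
Proof.
move=> c1 sh; elim: l x => [|i l IH] x Vx; first by rewrite expr1.
rewrite /= (eq_on_partial i oV Vx IH).
have sl := smooth_partials l sh.
have dc k w : differentiable (fun y : 'rV[R]_m => (c *: y) 0 k : R) w.
  under eq_fun do rewrite mxE.
  by apply: diffableM; [exact: diffable_cst | exact: diffable_coord].
have dl : differentiable (fun y => partials l h (c *: y) : R) x.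
  by apply: diffable_comp => //; exact: (smooth_diff sl (Vc c1 Vx)).
rewrite partialZ // partial_comp //; last exact: (smooth_diff sl (Vc c1 Vx)).
have dck k : partial i (fun y : 'rV[R]_m => (c *: y) 0 k) x = c * (i == k)%:R.
  under eq_fun do rewrite mxE.
  by rewrite partialZ ?partial_coord //; exact: diffable_coord.
under eq_bigr do rewrite dck mulrA.
by rewrite sum_delta [c ^+ (size l).+2]exprS; ring.
Qed.

Variables (L : base_conn (flat n oV)) (K : lin_conn (flat n oV)).

Lemma flat_base_smooth : smooth_coefs V (L tt).
Proof. by move=> j i l; have := @bcoef_smooth _ _ _ _ L tt j i l; rewrite flat_img. Qed.

Lemma flat_lin_smooth : smooth_coefs V (K tt).
Proof. by move=> j i l; have := @lcoef_smooth _ _ _ _ K tt j i l; rewrite flat_img. Qed.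

(** Pullback along [x |-> c x], defined on all of [V] because contractions preserve [V]. *)
Definition scaled_base c (c1 : `|c| <= 1) : base_conn (flat n oV) :=
  flat_base n oV (fun j i l => smooth_scaled c1 (flat_base_smooth j i l)).

Definition scaled_lin c (c1 : `|c| <= 1) : lin_conn (flat n oV) :=
  flat_lin oV (fun j i l => smooth_scaled c1 (flat_lin_smooth j i l)).

(** One factor [c] comes from the lower base index of the component, and one more from each
    differentiation. *)
Definition base_weight (k : 'I_#|idx|) : nat :=
  match enum_val k with
  | inl (inl _) => 0
  | inl (inr (l, _, _, _)) => (size l).+1
  | inr (l, _, _, _) => (size l).+1
  end.

Lemma jets_scaled c (c1 : `|c| <= 1) :
  jets s r (scaled_base c1 tt) (scaled_lin c1 tt) (row_mx 0 0) =
  wcurve base_weight (fun k => jets s r (L tt) (K tt) (row_mx 0 0) 0 k) (const_mx c).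
Proof.
apply/rowP => k; rewrite !mxE /base_weight.
case: (enum_val k) => [[[la|i]|[[[l mu] la] nu]]|[[[l j] i] la]] /=;
  rewrite ?row_mxKl ?row_mxKr ?expr0 ?mul1r //.
- by rewrite (partials_scaled l c1 (flat_base_smooth mu la nu) V0) scaler0.
- by rewrite (partials_scaled l c1 (flat_lin_smooth j i la) V0) scaler0.
Qed.

Lemma jet_base_scaled t :
  jet_base (wcurve base_weight (fun k => jets s r (L tt) (K tt) (row_mx 0 0) 0 k) t) = 0.
Proof.
by apply/rowP => la; rewrite !mxE /base_weight enum_rankK /= row_mxKl mxE mulr0.
Qed.

Lemma wcurve_scaled0 :
  wcurve base_weight (fun k => jets s r (L tt) (K tt) (row_mx 0 0) 0 k) 0 = 0.
Proof.
apply/rowP => k; rewrite !mxE /base_weight.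
case: (enum_val k) => [[[la|i]|[[[l mu] la] nu]]|[[[l j] i] la]] /=;
  rewrite ?row_mxKl ?row_mxKr ?mxE ?mulr0 // expr0n ?mul0r //.
Qed.

Lemma base_scaling c (c1 : `|c| <= 1) y B A C : c != 0 ->
  Dt (scaled_base c1) (scaled_lin c1) tt (row_mx 0 y) B A C * blk c 1 A =
  Dt L K tt (row_mx 0 y) B A C * blk c 1 B * blk c 1 C.
Proof.
move=> c0.
have := scaling_naturality Dt_natural (L1 := scaled_base c1) (K1 := scaled_lin c1)
  (L2 := L) (K2 := K) c0 (oner_neq0 _) (fun x => Vc c1) (fun _ _ _ _ _ => erefl)
  (fun _ _ _ _ _ => erefl) y V0 B A C.
by rewrite scale1r scaler0.
Qed.

Definition proj0 (k : 'I_#|idx|) : option index0 :=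
  match enum_val k with
  | inl (inr (l, a, b, c)) => if size l is 0 then Some (inl (a, b, c)) else None
  | inr (l, a, b, c) => if size l is 0 then Some (inr (a, b, c)) else None
  | _ => None
  end.

Definition proj1 (k : 'I_#|idx|) : option index1 :=
  match enum_val k with
  | inl (inr (l, a, b, c)) => if bseqval l is [:: i] then Some (inl (a, b, c, i)) else None
  | inr (l, a, b, c) => if bseqval l is [:: i] then Some (inr (a, b, c, i)) else None
  | _ => None
  end.

Local Notation J := (fun k => jets s r (L tt) (K tt) (row_mx 0 0) 0 k).

Lemma proj0S k v : proj0 k = Some v ->
  (base_weight k == 1)%:R * J k = jet0 (L tt) (K tt) v.
Proof.
rewrite /proj0 /base_weight mxE.
case: (enum_val k) => [[[la|i]|[[[l mu] la] nu]]|[[[l j] i] la]] //=;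
  by case: l => -[|? ?] ? //= [<-]; rewrite mul1r row_mxKl.
Qed.

Lemma proj0N k : proj0 k = None -> (base_weight k == 1)%:R * J k = 0.
Proof.
rewrite /proj0 /base_weight mxE.
case: (enum_val k) => [[[la|i]|[[[l mu] la] nu]]|[[[l j] i] la]] //=; rewrite ?mul0r //;
  by case: l => -[|? ?] ? //= _; rewrite mul0r.
Qed.

Lemma proj1S k v : proj1 k = Some v ->
  (base_weight k == 2)%:R * J k = jet1 (L tt) (K tt) v.
Proof.
rewrite /proj1 /base_weight mxE.
case: (enum_val k) => [[[la|i]|[[[l mu] la] nu]]|[[[l j] i] la]] //=;
  by case: l => -[|? [|? ?]] ? //= [<-]; rewrite mul1r row_mxKl.
Qed.

Lemma proj1N k : proj1 k = None -> (base_weight k == 2)%:R * J k = 0.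
Proof.
rewrite /proj1 /base_weight mxE.
case: (enum_val k) => [[[la|i]|[[[l mu] la] nu]]|[[[l j] i] la]] //=; rewrite ?mul0r //;
  by case: l => -[|? [|? ?]] ? //= _; rewrite mul0r.
Qed.

End BaseScaling.

Section Degrees.
Variables (V : set 'rV[R]_m) (oV : open V).
Hypothesis V0 : V 0.
Hypothesis Vc : forall (c : R) x, `|c| <= 1 -> V x -> V (c *: x).
Variables (B A C : 'I_(m + n)).

(** Fibre degree zero removes [y]; base weight one then leaves a linear function of the values. The
    coefficients are chosen before the connections, as Taylor coefficients of [F] at the zero
    jet. *)
Lemma degree1 :
  (forall t : R, blk 1 t A = blk 1 t B * blk 1 t C) ->
  (forall c : R, c * blk c 1 A = blk c 1 B * blk c 1 C) ->
  exists al : index0 -> R, forall (L : base_conn (flat n oV)) (K : lin_conn (flat n oV)) y,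
    Dt L K tt (row_mx 0 y) B A C = \sum_v al v * jet0 (L tt) (K tt) v.
Proof.
move=> h1 h2; have [F sF FE] := flat_order oV B A C.
exists (fun v => \sum_(k | proj0 k == Some v) partial k F 0) => L K y.
rewrite fib_invariant //.
rewrite (@weight1 _ _ base_weight (fun k => jets s r (L tt) (K tt) (row_mx 0 0) 0 k) _ F
  (Dt L K tt (row_mx 0 0) B A C) sF).
- by rewrite wcurve_scaled0; exact: (lin_regroup (proj0S L K) (proj0N L K)).
- by move=> t; rewrite /= jet_base_scaled.
- move=> t ut t0; have c1 : `|t 0 0| <= 1 by exact: ltW.
  rewrite [t](_ : _ = const_mx (t 0 0)); last by apply/rowP => i; rewrite ord1 mxE.
  rewrite -(jets_scaled V0 Vc L K c1) -FE ?row_mxKl // mxE.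
  apply: (mulIf (blk_neq0 A t0 (oner_neq0 _))); rewrite base_scaling // -mulrA -h2; ring.
Qed.

(** Fibre degree one gives linearity in [y]; base weight two then admits a product of two values or
    a single first derivative. *)
Lemma degree2 :
  (forall t : R, blk 1 t A = t * blk 1 t B * blk 1 t C) ->
  (forall c : R, c ^+ 2 * blk c 1 A = blk c 1 B * blk c 1 C) ->
  exists (be : 'I_n -> index0 -> index0 -> R) (ga : 'I_n -> index1 -> R),
  forall (L : base_conn (flat n oV)) (K : lin_conn (flat n oV)) y,
    Dt L K tt (row_mx 0 y) B A C = \sum_p y 0 p *
      (\sum_v \sum_v' be p v v' * jet0 (L tt) (K tt) v' * jet0 (L tt) (K tt) v
       + \sum_v ga p v * jet1 (L tt) (K tt) v).
Proof.
move=> h1 h2; have [F sF FE] := flat_order oV B A C.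
pose q p := enum_rank (inl (inl (inr p)) : idx).
pose G p := partial (q p) F.
exists (fun p v v' => 2^-1 * \sum_(k | proj0 k == Some v) \sum_(k' | proj0 k' == Some v')
           partial k' (partial k (G p)) 0).
exists (fun p v => \sum_(k | proj1 k == Some v) partial k (G p) 0) => L K y.
rewrite (fib_linear L K y V0 sF FE) //; apply: eq_bigr => p _; congr (_ * _).
rewrite -/(q p) -/(G p); have sG : smooth_on _ (G p) := smooth_partial (q p) sF.
rewrite (@weight2 _ _ base_weight (fun k => jets s r (L tt) (K tt) (row_mx 0 0) 0 k) _ (G p)
  (G p (jets s r (L tt) (K tt) (row_mx 0 0))) sG).
- rewrite wcurve_scaled0; congr (_ + _).
    rewrite (bilin_regroup (proj0S L K) (proj0N L K)).
    rewrite mulr_sumr; apply: eq_bigr => v _.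
    by rewrite mulr_sumr; apply: eq_bigr => v' _; rewrite !mulrA.
  exact: (lin_regroup (proj1S L K) (proj1N L K)).
- by move=> t; rewrite /= jet_base_scaled.
- move=> t ut t0; have c1 : `|t 0 0| <= 1 by exact: ltW.
  rewrite [t](_ : _ = const_mx (t 0 0)); last by apply/rowP => i; rewrite ord1 mxE.
  rewrite -(jets_scaled V0 Vc L K c1) mxE.
  (* At a basis vector of the fibre the component of [Dt] is exactly the coefficient [G p], which
     therefore inherits the homogeneity of [Dt]. *)
  have key (L' : base_conn (flat n oV)) (K' : lin_conn (flat n oV)) :
      Dt L' K' tt (row_mx 0 (delta_mx 0 p)) B A C = G p (jets s r (L' tt) (K' tt) (row_mx 0 0)).
    rewrite (fib_linear L' K' (delta_mx 0 p) V0 sF FE) // (bigD1 p) //= mxE !eqxx mul1r.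
    by rewrite big1 ?addr0 // => p' pp; rewrite mxE eqxx (negbTE pp) mul0r.
  rewrite -!key //.
  apply: (mulIf (blk_neq0 A t0 (oner_neq0 _))); rewrite base_scaling // -mulrA -h2; ring.
Qed.

End Degrees.

End Homothety.

(** * Invariant tensors *)

Section InvariantTensors.
Variables (R : realType) (d k : nat).

Local Notation I := {ffun 'I_k -> 'I_d}.
Implicit Types (i j l : I) (s : 'S_k) (F G H : I -> I -> R).

(** Operators on the [k]-th tensor power are represented by kernels on multi-indices; this is their
    composition. *)
Definition tprod F G : I -> I -> R := fun i j => \sum_l F i l * G l j.
Definition tcomm F G := forall i j, tprod F G i j = tprod G F i j.

Definition pcomp i s : I := [ffun a => i (s a)].
Definition tperm_mx s : I -> I -> R := fun i j => (j == pcomp i s)%:R.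
Definition tpow (g : 'M[R]_d) : I -> I -> R := fun i j => \prod_a g (i a) (j a).
(** Complete polarization of [tpow]: the symmetrized tensor product of [k] matrices. *)
Definition tsym (g : 'I_k -> 'M[R]_d) : I -> I -> R :=
  fun i j => \sum_(s : 'S_k) \prod_a g (s a) (i a) (j a).

Lemma poly_zero (p : {poly R}) : (forall t, p.[t] = 0) -> p = 0.
Proof.
move=> p0; apply: (@roots_geq_poly_eq0 _ p [seq x%:R | x <- iota 0 (size p)]).
- by apply/allP => x _; rewrite rootE p0.
- rewrite map_inj_uniq ?iota_uniq // => x y /eqP; rewrite eqr_nat => /eqP //.
- by rewrite size_map size_iota.
Qed.

(** Density of the invertible matrices, in polynomial form. The defect of commutation at [g + t] is
    a polynomial in [t] which vanishes wherever the determinant of [g + t] does not. That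
    determinant is monic in [t], hence nonzero, so the defect is zero, in particular at [t = 0]. *)
Lemma tpow_comm_all F : (forall g, g \in unitmx -> tcomm F (tpow g)) ->
  forall g, tcomm F (tpow g).
Proof.
move=> cF g i j; apply/eqP; rewrite -subr_eq0; apply/eqP.
pose gp : 'M[{poly R}]_d := char_poly_mx (- g).
have gpE t a b : (gp a b).[t] = (g + t%:M) a b.
  by rewrite !mxE hornerD hornerN hornerMn hornerX hornerC opprK addrC.
pose tp i j : {poly R} := \prod_a gp (i a) (j a).
have tpE t i' j' : (tp i' j').[t] = tpow (g + t%:M) i' j'.
  by rewrite horner_prod; apply: eq_bigr => a _; rewrite gpE.
pose p := \sum_l (F i l)%:P * tp l j - \sum_l tp i l * (F l j)%:P.
have pE t : p.[t] = tprod F (tpow (g + t%:M)) i j - tprod (tpow (g + t%:M)) F i j.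
  rewrite hornerD hornerN !horner_sum; congr (_ - _); apply: eq_bigr => l _;
    by rewrite hornerM hornerC tpE.
have detE t : (\det gp).[t] = \det (g + t%:M).
  rewrite horner_sum; apply: eq_bigr => s _; rewrite hornerM horner_prod.
  congr (_ * _); last by apply: eq_bigr => a _; rewrite gpE.
  by case: (odd_perm s); rewrite ?expr1 ?expr0 ?hornerN hornerC.
have det0 : \det gp != 0 by exact/monic_neq0/char_poly_monic.
have : p * \det gp = 0.
  apply: poly_zero => t; rewrite hornerM pE detE.
  have [->|u] := eqVneq (\det (g + t%:M)) 0; first by rewrite mulr0.
  by rewrite cF ?subrr ?mul0r // unitmxE unitfE.
move/eqP; rewrite mulf_eq0 (negbTE det0) orbF => /eqP p0.
by have := pE 0; rewrite p0 horner0 raddf0 addr0 => <-.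
Qed.

(** Inclusion-exclusion: once the tensor powers are expanded over maps [p] of the slots, the signed
    sum over [A] keeps only the surjective ones, that is the permutations. *)
Lemma polarization (g : 'I_k -> 'M[R]_d) i j :
  tsym g i j = \sum_(A : {ffun 'I_k -> bool})
    (\prod_l (if A l then 1 else -1)) * tpow (\sum_(l | A l) g l) i j.
Proof.
have E (A : {ffun 'I_k -> bool}) : tpow (\sum_(l | A l) g l) i j =
    \sum_(p : {ffun 'I_k -> 'I_k}) (\prod_a (A (p a))%:R) * \prod_a g (p a) (i a) (j a).
  rewrite /tpow; under eq_bigr do rewrite summxE big_mkcond /=.
  rewrite bigA_distr_bigA /=; apply: eq_bigr => p _; rewrite -big_split /=.
  by apply: eq_bigr => a _; case: (A (p a)); rewrite ?mul1r ?mul0r.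
under [RHS]eq_bigr do rewrite E mulr_sumr.
rewrite exchange_big /=.
under [RHS]eq_bigr => p _ do under eq_bigr do rewrite mulrA.
under [RHS]eq_bigr => p _ do rewrite -mulr_suml.
have S (p : {ffun 'I_k -> 'I_k}) : \sum_(A : {ffun 'I_k -> bool})
    ((\prod_l (if A l then 1 else -1)) * \prod_a (A (p a))%:R) = (injectiveb p)%:R :> R.
  (* The sum factors over [l]. An index in the image of [p] must be selected by [A], while the two
     choices for an index outside the image cancel. *)
  pose h (l : 'I_k) (b : bool) : R := if b then 1 else - (l \notin codom p)%:R.
  transitivity (\sum_(A : {ffun 'I_k -> bool}) \prod_l h l (A l)).
    apply: eq_bigr => A _; have [|] := boolP [forall a, A (p a)].
      move=> /forallP Ap; rewrite [X in _ * X]big1 ?mulr1 => [|a _]; last by rewrite Ap.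
      apply: eq_bigr => l _; rewrite /h; case El: (A l) => //.
      case: (boolP (l \in codom p)) => [/codomP[a la]|_]; last by [].
      by have := Ap a; rewrite -la El.
    rewrite negb_forall => /existsP[a /negbTE Apa].
    rewrite [X in _ * X](bigD1 a) //= Apa mul0r mulr0 (bigD1 (p a)) //= /h Apa codom_f.
    by rewrite oppr0 mul0r.
  rewrite -bigA_distr_bigA /=; case: (boolP (injectiveb p)) => [/injectiveP ip|nip].
    apply: big1 => l _; rewrite big_bool /h /=.
    suff -> : l \in codom p by rewrite oppr0 addr0.
    by apply: (inj_card_onto ip).
  have [l lp] : exists l : 'I_k, l \notin codom p.
    apply/existsP; rewrite -negb_forall; apply: contra nip => /forallP ap.
    rewrite /injectiveb /dinjectiveb; apply/card_uniqP; rewrite size_map -cardE.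
    by apply: eq_card => l; rewrite ap.
  rewrite (bigD1 l) //= big_bool /h /= lp subrr mul0r //.
under [RHS]eq_bigr do rewrite S.
rewrite (bigID (fun p : {ffun 'I_k -> 'I_k} => injectiveb p)) /= [X in _ + X]big1 ?addr0; last first.
  by move=> p /negbTE ->; rewrite mul0r.
under [RHS]eq_bigr => p ip do rewrite ip mul1r.
rewrite [RHS](reindex (@pval _)) /=; last first.
  pose in_Sn := insubd (1%g : 'S_k).
  by exists in_Sn => /= f Uf; first apply: val_inj; apply: insubdK.
apply: eq_big => [s|s _]; first by have := valP s.
by apply: eq_bigr => a _; rewrite pvalE.
Qed.

Lemma tprod_suml (J : finType) (c : J -> R) (Fs : J -> I -> I -> R) G i j :
  tprod (fun i j => \sum_x c x * Fs x i j) G i j = \sum_x c x * tprod (Fs x) G i j.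
Proof.
rewrite /tprod; under eq_bigr do rewrite mulr_suml.
rewrite exchange_big; apply: eq_bigr => x _; rewrite mulr_sumr.
by apply: eq_bigr => l _; rewrite mulrA.
Qed.

Lemma tprod_sumr (J : finType) (c : J -> R) (Fs : J -> I -> I -> R) G i j :
  tprod G (fun i j => \sum_x c x * Fs x i j) i j = \sum_x c x * tprod G (Fs x) i j.
Proof.
rewrite /tprod; under eq_bigr do rewrite mulr_sumr.
rewrite exchange_big; apply: eq_bigr => x _; rewrite mulr_sumr.
by apply: eq_bigr => l _; rewrite mulrCA.
Qed.

Lemma tcomm_sum (J : finType) (c : J -> R) (Gs : J -> I -> I -> R) F G :
  (forall i j, G i j = \sum_x c x * Gs x i j) ->
  (forall x, tcomm F (Gs x)) -> tcomm F G.
Proof.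
move=> GE cF i j.
have -> : G = fun i j => \sum_x c x * Gs x i j by apply/funext => ?; apply/funext => ?.
by rewrite tprod_sumr tprod_suml; apply: eq_bigr => x _; rewrite cF.
Qed.

(** Averaging over the permutations writes [M] as a combination of polarized products of matrix
    units, and these commute with [F] by [polarization]. *)
Lemma tcomm_symmetric F (M : I -> I -> R) :
  (forall g, g \in unitmx -> tcomm F (tpow g)) ->
  (forall s i j, M (pcomp i s) (pcomp j s) = M i j) -> tcomm F M.
Proof.
move=> /tpow_comm_all cF Msym.
have csym g : tcomm F (tsym g).
  exact: (tcomm_sum (polarization g) (fun A => cF _)).
pose E (pq : I * I) : I -> I -> R := tsym (fun a => delta_mx (pq.1 a) (pq.2 a)).
apply: (@tcomm_sum (I * I)%type (fun pq => (k`!)%:R^-1 * M pq.1 pq.2) E) => [i j|pq]; last exact: csym.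
have EE p q : E (p, q) i j = \sum_(s : 'S_k) ((p == pcomp i s) && (q == pcomp j s))%:R.
  rewrite /E /tsym /= (reindex_inj invg_inj) /=; apply: eq_bigr => s _.
  rewrite (reindex_inj (@perm_inj _ s)) /=.
  have -> : ((p == pcomp i s) && (q == pcomp j s)) =
      [forall a, (p a == i (s a)) && (q a == j (s a))].
    apply/andP/forallP => [[/eqP-> /eqP->] a|H]; first by rewrite !ffunE !eqxx.
    by split; apply/eqP/ffunP => a; rewrite ffunE; have /andP[/eqP ? /eqP ?] := H a.
  case: forallP => H.
    by apply: big1 => a _; rewrite permK mxE ![i _ == _]eq_sym ![j _ == _]eq_sym H.
  have /existsP[a Ha] : [exists a, ~~ ((p a == i (s a)) && (q a == j (s a)))].
    by rewrite -negb_forall; apply/negP => /forallP.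
  rewrite (bigD1 a) //= permK mxE [i _ == _]eq_sym [j _ == _]eq_sym (negbTE Ha).
  by rewrite mul0r.
have -> : \sum_x k`!%:R^-1 * M x.1 x.2 * E x i j =
    k`!%:R^-1 * \sum_(s : 'S_k) \sum_x ((x.1 == pcomp i s) && (x.2 == pcomp j s))%:R * M x.1 x.2.
  rewrite exchange_big mulr_sumr; apply: eq_bigr => -[p q] _ /=.
  rewrite EE -mulrA; congr (_ * _); rewrite mulr_sumr.
  by apply: eq_bigr => s _; rewrite mulrC.
have S s : \sum_(x : I * I) ((x.1 == pcomp i s) && (x.2 == pcomp j s))%:R * M x.1 x.2 = M i j.
  rewrite (bigD1 (pcomp i s, pcomp j s)) //= !eqxx mul1r Msym big1 ?addr0 // => -[p q].
  by rewrite xpair_eqE => /negbTE /= ->; rewrite mul0r.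
under eq_bigr do rewrite S.
by rewrite sumr_const card_Sn -[M i j *+ _]mulr_natl mulrA mulVf ?mul1r.
Qed.

Let N := #|I|.

(** The kernel as a square matrix, which gives access to spans, projections and coordinates. *)
Definition tmx F : 'M[R]_N := \matrix_(a, b) F (enum_val a) (enum_val b).

Lemma sum_enum_val (f : I -> R) : \sum_(a < N) f (enum_val a) = \sum_i f i.
Proof. by rewrite -(big_enum_val (A := I)); exact: eq_bigl. Qed.

Lemma tmx_mul F G : tmx F *m tmx G = tmx (tprod F G).
Proof.
apply/matrixP => a b; rewrite !mxE /tprod -sum_enum_val.
by apply: eq_bigr => l _; rewrite !mxE.
Qed.

Lemma pcomp_mul i s u : pcomp (pcomp i s) u = pcomp i (u * s).
Proof. by apply/ffunP => a; rewrite !ffunE permM. Qed.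

Lemma pcomp1 i : pcomp i 1 = i.
Proof. by apply/ffunP => a; rewrite ffunE perm1. Qed.

Lemma tperm_mull s F i j : tprod (tperm_mx s) F i j = F (pcomp i s) j.
Proof.
rewrite /tprod (bigD1 (pcomp i s)) //= /tperm_mx eqxx mul1r big1 ?addr0 // => l /negbTE ->.
by rewrite mul0r.
Qed.

Lemma tperm_mulr s F i j : tprod F (tperm_mx s) i (pcomp j s) = F i j.
Proof.
rewrite /tprod (bigD1 j) //= /tperm_mx eqxx mulr1 big1 ?addr0 // => l lj.
rewrite (_ : (_ == _) = false) ?mulr0 //; apply/eqP => e; move/eqP: lj; apply.
by rewrite -[l]pcomp1 -[j]pcomp1 -(mulVg s) -!pcomp_mul e.
Qed.

Let rho (s : 'S_k) := tmx (tperm_mx s).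

Lemma rho_mul s u : rho s *m rho u = rho (u * s)%g.
Proof.
rewrite tmx_mul; apply/matrixP => a b; rewrite !mxE tperm_mull /tperm_mx pcomp_mul //.
Qed.

Lemma rho1 : rho 1%g = 1%:M.
Proof. by apply/matrixP => a b; rewrite !mxE /tperm_mx pcomp1 (inj_eq enum_val_inj) eq_sym. Qed.

Let Xs := [tuple rho (enum_val a) | a < #|{: 'S_k}|].
Let A := <<Xs>>%VS.

Lemma rho_in s : rho s \in A.
Proof.
by apply: memv_span; apply/mapP; exists (enum_rank s); rewrite ?mem_enum ?enum_rankK.
Qed.

Lemma rho_stable s X : X \in A -> rho s *m X \in A.
Proof.
move=> /coord_span ->; rewrite mulmx_sumr; apply: memv_suml => a _.
rewrite -scalemxAr memvZ // (nth_map (enum_rank 1%g)) ?size_enum_ord //.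
by rewrite rho_mul rho_in.
Qed.

(** Maschke averaging of a linear projection onto the span [A], over left multiplication by
    permutations. *)
Let P (X : 'M[R]_N) := (k`!)%:R^-1 *: \sum_(s : 'S_k) rho s^-1 *m projv A (rho s *m X).

Lemma P_in X : P X \in A.
Proof. by rewrite memvZ // memv_suml // => s _; rewrite rho_stable // memv_proj. Qed.

Lemma P_equiv s X : P (rho s *m X) = rho s *m P X.
Proof.
rewrite /P -scalemxAr mulmx_sumr; congr (_ *: _).
rewrite [RHS](reindex_inj (mulgI s)) /=; apply: eq_bigr => u _.
by rewrite mulmxA rho_mul mulmxA rho_mul invMg mulgKV.
Qed.

Lemma P_one : P 1%:M = 1%:M.
Proof.
rewrite /P (eq_bigr (fun=> 1%:M)) => [|s _]; last first.
  by rewrite mulmx1 projv_id ?rho_in // rho_mul mulgV rho1.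
by rewrite sumr_const card_Sn -[1%:M *+ _]scaler_nat scalerA mulVf ?scale1r.
Qed.

Lemma P_sum (J : finType) (c : J -> R) (Ys : J -> 'M[R]_N) :
  P (\sum_x c x *: Ys x) = \sum_x c x *: P (Ys x).
Proof.
rewrite /P; under [RHS]eq_bigr do rewrite scalerA mulrC -scalerA.
rewrite -scaler_sumr; congr (_ *: _).
under [RHS]eq_bigr do rewrite scaler_sumr.
rewrite exchange_big; apply: eq_bigr => s _ /=.
rewrite mulmx_sumr linear_sum mulmx_sumr; apply: eq_bigr => x _.
by rewrite -scalemxAr linearZ -scalemxAr.
Qed.

Lemma commutant_in_span F :
  (forall g, g \in unitmx -> tcomm F (tpow g)) -> tmx F \in A.
Proof.
move=> cF; suff <- : P (tmx F) = tmx F by exact: P_in.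
(* The part of [P] going from column [a] to column [b], seen as an operator on tensors. It commutes
   with the permutations because [P] does. *)
pose M a b : I -> I -> R := fun i j => P (delta_mx (enum_rank j) a) (enum_rank i) b.
have ME a b (i j : 'I_N) : tmx (M a b) i j = P (delta_mx j a) i b.
  by rewrite mxE /M !enum_valK.
have mulE (X Y : 'M[R]_N) (i j : 'I_N) : (X *m Y) i j = \sum_l X i l * Y l j by rewrite mxE.
have rM s a b : rho s *m tmx (M a b) = tmx (M a b) *m rho s.
  apply/matrixP => i j; rewrite !mulE.
  transitivity (P (rho s *m delta_mx j a) i b).
    by rewrite P_equiv mulE; apply: eq_bigr => l _; rewrite ME.
  have -> : rho s *m delta_mx j a = \sum_l rho s l j *: delta_mx l a.
    apply/matrixP => p q; rewrite summxE mulE (bigD1 j) //= big1 ?addr0; last first.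
      by move=> l lj; rewrite [delta_mx _ _ _ _]mxE (negbTE lj) mulr0.
    rewrite [RHS](bigD1 p) //= big1 ?addr0; last first.
      by move=> l lp; rewrite mxE [delta_mx _ _ _ _]mxE eq_sym (negbTE lp) mulr0.
    by rewrite [RHS]mxE ![delta_mx _ _ _ _]mxE !eqxx.
  rewrite P_sum summxE; apply: eq_bigr => l _.
  by rewrite [LHS]mxE ME mulrC.
have cM a b : tmx F *m tmx (M a b) = tmx (M a b) *m tmx F.
  rewrite !tmx_mul; apply/matrixP => i j; rewrite [LHS]mxE [RHS]mxE.
  apply: (tcomm_symmetric cF) => s p q.
  have := rM s a b; rewrite /rho !tmx_mul => /matrixP/(_ (enum_rank p) (enum_rank (pcomp q s))).
  by rewrite [LHS]mxE [RHS]mxE !enum_rankK tperm_mull tperm_mulr.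
have PE X (i b : 'I_N) : P X i b = \sum_a (tmx (M a b) *m X) i a.
  rewrite {1}(matrix_sum_delta X) pair_bigA /=.
  rewrite (P_sum (fun x : 'I_N * 'I_N => X x.1 x.2)) summxE -(pair_bigA _ (fun j a : 'I_N => (X j a *: P (delta_mx j a)) i b)) /=.
  rewrite exchange_big; apply: eq_bigr => a _; rewrite mulE; apply: eq_bigr => j _.
  by rewrite ME [LHS]mxE mulrC.
(* [P] acts through the operators [M a b], so commuting [F] past them turns [P(F)] into [F P(1)],
   which is [F]. *)
apply/matrixP => i b; rewrite PE; under eq_bigr do rewrite -cM.
transitivity ((tmx F *m P 1%:M) i b); last by rewrite P_one mulmx1.
rewrite mulE; under [RHS]eq_bigr do rewrite PE mulr_sumr.
rewrite exchange_big; apply: eq_bigr => a _; rewrite mulE; apply: eq_bigr => l _.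
by rewrite mulmx1.
Qed.

(* Schur-Weyl duality: the equivariant [F] commutes with every operator commuting
   with the permutations, in particular with the columns of an equivariant
   projection [P] of the matrix algebra onto the span of the permutations, so that
   [F = F P(1) = P(F)] lies in that span. The coefficients are returned by linear
   functionals so that further equivariance in parameters is inherited by them. *)
Lemma invariant_tensor : exists w : 'S_k -> I -> I -> R, forall F,
  (forall g, g \in unitmx -> tcomm F (tpow g)) ->
  forall i j, F i j = \sum_(s : 'S_k) (\sum_p \sum_q w s p q * F p q) * tperm_mx s i j.
Proof.
exists (fun s p q => coord Xs (enum_rank s) (delta_mx (enum_rank p) (enum_rank q))).
move=> F /commutant_in_span/coord_span E i j.
have := congr1 (fun X : 'M[R]_N => X (enum_rank i) (enum_rank j)) E.
rewrite mxE !enum_rankK => ->; rewrite summxE.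
rewrite [RHS](big_enum_val (A := {: 'S_k})).
apply: eq_bigr => a _; rewrite mxE (nth_map (enum_rank 1%g)) ?size_enum_ord //.
rewrite nth_ord_enum mxE !enum_rankK; congr (_ * _).
rewrite {1}(matrix_sum_delta (tmx F)) linear_sum -sum_enum_val; apply: eq_bigr => p _.
rewrite linear_sum -sum_enum_val; apply: eq_bigr => q _.
by rewrite linearZ /= mxE enum_valK !enum_valK mulrC.
Qed.

End InvariantTensors.

(** * Explicit multi-indices and permutations of small order *)

Section Cons.
Variables (T : finType) (k : nat).

Definition fc (x : T) (l : {ffun 'I_k -> T}) : {ffun 'I_k.+1 -> T} :=
  [ffun a => if unlift ord0 a is Some b then l b else x].

Lemma fc0 x l : fc x l ord0 = x.
Proof. by rewrite ffunE unlift_none. Qed.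

Lemma fcS x l a : fc x l (lift ord0 a) = l a.
Proof. by rewrite ffunE liftK. Qed.

Lemma fc_eta (l : {ffun 'I_k.+1 -> T}) : l = fc (l ord0) [ffun a : 'I_k => l (lift ord0 a)].
Proof.
by apply/ffunP => a; case: (unliftP ord0 a) => [b ->|->]; rewrite ?fcS ?fc0 ?ffunE.
Qed.

Lemma sum_fc (R : nmodType) (G : {ffun 'I_k.+1 -> T} -> R) :
  \sum_l G l = \sum_x \sum_l G (fc x l).
Proof.
rewrite pair_bigA /= (reindex (fun p : T * {ffun 'I_k -> T} => fc p.1 p.2)) //.
exists (fun l : {ffun 'I_k.+1 -> T} => (l ord0, [ffun a : 'I_k => l (lift ord0 a)])) => [[x l] _|l _] /=.
  by rewrite fc0; congr (_, _); apply/ffunP => a; rewrite ffunE fcS.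
by rewrite -fc_eta.
Qed.

End Cons.

Definition fnil (T : finType) : {ffun 'I_0 -> T} :=
  finfun (fun a : 'I_0 => match notF (ltn_ord a) with end).

Lemma sum_fnil (T : finType) (R : nmodType) (G : {ffun 'I_0 -> T} -> R) :
  \sum_l G l = G (fnil T).
Proof. by rewrite (big_pred1 (fnil T)) // => l; apply/esym/eqP/ffunP => -[]. Qed.

Section Explicit.
Variables (R : realType).

Lemma tperm_mxE d k (s : 'S_k) (i j : {ffun 'I_k -> 'I_d}) :
  tperm_mx R s i j = \prod_a (j a == i (s a))%:R.
Proof.
rewrite /tperm_mx; case: eqP => [->|ne].
  by rewrite big1 // => a _; rewrite ffunE eqxx.
have /existsP[a ha] : [exists a, j a != i (s a)].
  rewrite -negb_forall; apply/negP => /forallP H; apply: ne.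
  by apply/ffunP => a; rewrite ffunE; apply/eqP.
by rewrite (bigD1 a) //= (negbTE ha) mul0r.
Qed.

(** Duality is used for the base indices first. The coefficients obtained are linear functionals of
    [F], hence still invariant under fibre changes, and duality applies to them again. *)
Lemma invariant_tensor2 (m n k l : nat)
    (F : {ffun 'I_k -> 'I_m} -> {ffun 'I_l -> 'I_n} ->
         {ffun 'I_k -> 'I_m} -> {ffun 'I_l -> 'I_n} -> R) :
  (forall M : 'M[R]_m, M \in unitmx ->
     forall p q, tcomm (fun i j => F i p j q) (tpow M)) ->
  (forall N : 'M[R]_n, N \in unitmx ->
     forall i j, tcomm (fun p q => F i p j q) (tpow N)) ->
  exists c : 'S_k -> 'S_l -> R, forall i p j q,
    F i p j q = \sum_s \sum_t c s t * tperm_mx R s i j * tperm_mx R t p q.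
Proof.
move=> HM HN; have [w wE] := invariant_tensor R m k; have [v vE] := invariant_tensor R n l.
exists (fun s t => \sum_p' \sum_q' v t p' q' * (\sum_i' \sum_j' w s i' j' * F i' p' j' q')).
move=> i p j q; rewrite (wE (fun i j => F i p j q)) => [|g ug]; last exact: HM.
apply: eq_bigr => s _; pose H p q := \sum_i' \sum_j' w s i' j' * F i' p j' q.
rewrite -/(H p q) (vE H); first by rewrite mulr_suml; apply: eq_bigr => t _; rewrite mulrAC.
move=> N uN p' q'; rewrite /tprod /H.
under eq_bigr do rewrite mulr_suml.
rewrite exchange_big /=; under [RHS]eq_bigr do rewrite mulr_sumr.
rewrite [RHS]exchange_big /=; apply: eq_bigr => i' _.
under eq_bigr do rewrite mulr_suml.
rewrite exchange_big /=; under [RHS]eq_bigr do rewrite mulr_sumr.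
rewrite [RHS]exchange_big /=; apply: eq_bigr => j' _.
under eq_bigr do rewrite -mulrA.
rewrite -mulr_sumr; under [RHS]eq_bigr do rewrite mulrCA.
by rewrite -mulr_sumr; congr (_ * _); exact: (HN N uN i' j' p' q').
Qed.

Lemma tpow_fc d k (g : 'M[R]_d) x y (i j : {ffun 'I_k -> 'I_d}) :
  tpow g (fc x i) (fc y j) = g x y * tpow g i j.
Proof.
rewrite /tpow big_ord_recl !fc0; congr (_ * _); apply: eq_bigr => a _.
by rewrite !fcS.
Qed.

Lemma tpow_fnil d (g : 'M[R]_d) (i j : {ffun 'I_0 -> 'I_d}) : tpow g i j = 1.
Proof. by rewrite /tpow big_ord0. Qed.

End Explicit.

Local Notation o0 := ord0.
Local Notation o1 := (lift ord0 ord0).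
Local Notation o2 := (lift ord0 (lift ord0 ord0)).
Local Notation o3 := (lift ord0 (lift ord0 (lift ord0 ord0))).

Section Tuples.
Variables (T : finType).
Implicit Types x y z t : T.

Definition mk1 x : {ffun 'I_1 -> T} := fc x (fnil T).
Definition mk2 x y : {ffun 'I_2 -> T} := fc x (mk1 y).
Definition mk3 x y z : {ffun 'I_3 -> T} := fc x (mk2 y z).
Definition mk4 x y z t : {ffun 'I_4 -> T} := fc x (mk3 y z t).

Lemma mk1P (i : {ffun 'I_1 -> T}) : exists x, i = mk1 x.
Proof.
by exists (i ord0); rewrite [LHS]fc_eta; congr fc; apply/ffunP => -[].
Qed.

Lemma mk2P (i : {ffun 'I_2 -> T}) : exists x y, i = mk2 x y.
Proof.
have [y E] := mk1P [ffun a : 'I_1 => i (lift ord0 a)].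
by exists (i ord0), y; rewrite [LHS]fc_eta E.
Qed.

Lemma mk3P (i : {ffun 'I_3 -> T}) : exists x y z, i = mk3 x y z.
Proof.
have [y [z E]] := mk2P [ffun a : 'I_2 => i (lift ord0 a)].
by exists (i ord0), y, z; rewrite [LHS]fc_eta E.
Qed.

Lemma mk4P (i : {ffun 'I_4 -> T}) : exists x y z t, i = mk4 x y z t.
Proof.
have [y [z [t E]]] := mk3P [ffun a : 'I_3 => i (lift ord0 a)].
by exists (i ord0), y, z, t; rewrite [LHS]fc_eta E.
Qed.

Variable R : nmodType.

Lemma sum_mk1 (G : {ffun 'I_1 -> T} -> R) : \sum_l G l = \sum_x G (mk1 x).
Proof. by rewrite sum_fc; apply: eq_bigr => x _; rewrite sum_fnil. Qed.

Lemma sum_mk2 (G : {ffun 'I_2 -> T} -> R) : \sum_l G l = \sum_x \sum_y G (mk2 x y).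
Proof. by rewrite sum_fc; apply: eq_bigr => x _; rewrite sum_mk1. Qed.

Lemma sum_mk3 (G : {ffun 'I_3 -> T} -> R) :
  \sum_l G l = \sum_x \sum_y \sum_z G (mk3 x y z).
Proof. by rewrite sum_fc; apply: eq_bigr => x _; rewrite sum_mk2. Qed.

Lemma sum_mk4 (G : {ffun 'I_4 -> T} -> R) :
  \sum_l G l = \sum_x \sum_y \sum_z \sum_t G (mk4 x y z t).
Proof. by rewrite sum_fc; apply: eq_bigr => x _; rewrite sum_mk3. Qed.

End Tuples.

Definition mkE := (fc0, fcS).

Section Commutation.
Variables (R : realType) (d : nat) (g : 'M[R]_d).

Lemma tpow1 x y : tpow g (mk1 x) (mk1 y) = g x y.
Proof. by rewrite tpow_fc tpow_fnil mulr1. Qed.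

Lemma tpow2 x1 x2 y1 y2 : tpow g (mk2 x1 x2) (mk2 y1 y2) = g x1 y1 * g x2 y2.
Proof. by rewrite tpow_fc tpow1. Qed.

Lemma tpow3 x1 x2 x3 y1 y2 y3 :
  tpow g (mk3 x1 x2 x3) (mk3 y1 y2 y3) = g x1 y1 * (g x2 y2 * g x3 y3).
Proof. by rewrite tpow_fc tpow2. Qed.

Lemma tpow4 x1 x2 x3 x4 y1 y2 y3 y4 :
  tpow g (mk4 x1 x2 x3 x4) (mk4 y1 y2 y3 y4) = g x1 y1 * (g x2 y2 * (g x3 y3 * g x4 y4)).
Proof. by rewrite tpow_fc tpow3. Qed.

Lemma tcomm1 F : (forall x y,
  \sum_z F (mk1 x) (mk1 z) * g z y = \sum_z g x z * F (mk1 z) (mk1 y)) ->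
  tcomm F (tpow g).
Proof.
move=> H i j; have [x ->] := mk1P i; have [y ->] := mk1P j.
rewrite /tprod !sum_mk1; under eq_bigr do rewrite tpow1.
by under [RHS]eq_bigr do rewrite tpow1.
Qed.

Lemma tcomm2 F : (forall x1 x2 y1 y2,
  \sum_z1 \sum_z2 F (mk2 x1 x2) (mk2 z1 z2) * (g z1 y1 * g z2 y2) =
  \sum_z1 \sum_z2 g x1 z1 * g x2 z2 * F (mk2 z1 z2) (mk2 y1 y2)) ->
  tcomm F (tpow g).
Proof.
move=> H i j; have [x1 [x2 ->]] := mk2P i; have [y1 [y2 ->]] := mk2P j.
rewrite /tprod !sum_mk2; under eq_bigr do under eq_bigr do rewrite tpow2.
by under [RHS]eq_bigr do under eq_bigr do rewrite tpow2.
Qed.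

Lemma tcomm3 F : (forall x1 x2 x3 y1 y2 y3,
  \sum_z1 \sum_z2 \sum_z3 F (mk3 x1 x2 x3) (mk3 z1 z2 z3) * (g z1 y1 * (g z2 y2 * g z3 y3)) =
  \sum_z1 \sum_z2 \sum_z3 g x1 z1 * (g x2 z2 * g x3 z3) * F (mk3 z1 z2 z3) (mk3 y1 y2 y3)) ->
  tcomm F (tpow g).
Proof.
move=> H i j; have [x1 [x2 [x3 ->]]] := mk3P i; have [y1 [y2 [y3 ->]]] := mk3P j.
rewrite /tprod !sum_mk3; under eq_bigr do under eq_bigr do under eq_bigr do rewrite tpow3.
by under [RHS]eq_bigr do under eq_bigr do under eq_bigr do rewrite tpow3.
Qed.

Lemma tcomm4 F : (forall x1 x2 x3 x4 y1 y2 y3 y4,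
  \sum_z1 \sum_z2 \sum_z3 \sum_z4 F (mk4 x1 x2 x3 x4) (mk4 z1 z2 z3 z4) *
     (g z1 y1 * (g z2 y2 * (g z3 y3 * g z4 y4))) =
  \sum_z1 \sum_z2 \sum_z3 \sum_z4 g x1 z1 * (g x2 z2 * (g x3 z3 * g x4 z4)) *
     F (mk4 z1 z2 z3 z4) (mk4 y1 y2 y3 y4)) ->
  tcomm F (tpow g).
Proof.
move=> H i j; have [x1 [x2 [x3 [x4 ->]]]] := mk4P i.
have [y1 [y2 [y3 [y4 ->]]]] := mk4P j.
rewrite /tprod !sum_mk4.
under eq_bigr do under eq_bigr do under eq_bigr do under eq_bigr do rewrite tpow4.
by under [RHS]eq_bigr do under eq_bigr do under eq_bigr do under eq_bigr do rewrite tpow4.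
Qed.

End Commutation.

Section Permutations.

Lemma ord2_in (a : 'I_2) : a \in [:: o0; o1].
Proof. by case: a => -[|[|]]. Qed.

Lemma ord3_in (a : 'I_3) : a \in [:: o0; o1; o2].
Proof. by case: a => -[|[|[|]]]. Qed.

Lemma ord4_in (a : 'I_4) : a \in [:: o0; o1; o2; o3].
Proof. by case: a => -[|[|[|[|]]]]. Qed.

Lemma perm2_ind (Q : 'I_2 -> 'I_2 -> Prop) : Q o0 o1 -> Q o1 o0 ->
  forall s : 'S_2, Q (s o0) (s o1).
Proof.
move=> q1 q2 s; have : s o0 != s o1 by rewrite (inj_eq perm_inj).
have := ord2_in (s o0); have := ord2_in (s o1); rewrite !inE.
by move=> /orP[] /eqP -> /orP[] /eqP ->.
Qed.

Lemma perm3_ind (Q : 'I_3 -> 'I_3 -> 'I_3 -> Prop) :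
  Q o0 o1 o2 -> Q o0 o2 o1 -> Q o1 o0 o2 -> Q o1 o2 o0 -> Q o2 o0 o1 -> Q o2 o1 o0 ->
  forall s : 'S_3, Q (s o0) (s o1) (s o2).
Proof.
move=> q1 q2 q3 q4 q5 q6 s; have : uniq [:: s o0; s o1; s o2].
  by rewrite /= !inE !(inj_eq perm_inj).
have := ord3_in (s o0); have := ord3_in (s o1); have := ord3_in (s o2).
by rewrite !inE => /or3P[] /eqP -> /or3P[] /eqP -> /or3P[] /eqP ->.
Qed.

(** The enumeration of the 24 cases is left to the user of the principle, in the form of distinct
    values. *)
Lemma perm4_ind (Q : 'I_4 -> 'I_4 -> 'I_4 -> 'I_4 -> Prop) :
  (forall a b c e, uniq [:: a; b; c; e] -> Q a b c e) ->
  forall s : 'S_4, Q (s o0) (s o1) (s o2) (s o3).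
Proof. by move=> H s; apply: H; rewrite /= !inE !(inj_eq perm_inj). Qed.

Lemma perm1_id (s : 'S_1) : s = 1%g.
Proof. by apply/permP => a; rewrite !ord1. Qed.

End Permutations.

Section PermMatrices.
Variables (R : realType) (d : nat).
Implicit Types (x y : 'I_d).

Lemma tperm_mx1 (s : 'S_1) x y : tperm_mx R s (mk1 x) (mk1 y) = (y == x)%:R.
Proof. by rewrite tperm_mxE big_ord_recl big_ord0 mulr1 [s _]ord1 !mkE. Qed.

Lemma tperm_mx2 (s : 'S_2) i y1 y2 :
  tperm_mx R s i (mk2 y1 y2) = (y1 == i (s o0))%:R * (y2 == i (s o1))%:R.
Proof. by rewrite tperm_mxE !big_ord_recl big_ord0 mulr1 !mkE. Qed.

Lemma tperm_mx3 (s : 'S_3) i y1 y2 y3 :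
  tperm_mx R s i (mk3 y1 y2 y3) =
  (y1 == i (s o0))%:R * ((y2 == i (s o1))%:R * (y3 == i (s o2))%:R).
Proof. by rewrite tperm_mxE !big_ord_recl big_ord0 mulr1 !mkE. Qed.

Lemma tperm_mx4 (s : 'S_4) i y1 y2 y3 y4 :
  tperm_mx R s i (mk4 y1 y2 y3 y4) =
  (y1 == i (s o0))%:R * ((y2 == i (s o1))%:R * ((y3 == i (s o2))%:R * (y4 == i (s o3))%:R)).
Proof. by rewrite tperm_mxE !big_ord_recl big_ord0 mulr1 !mkE. Qed.

End PermMatrices.

(** * Dependence on 1-jets *)

Section Affine.
Variables (R : realType) (m n s r : nat) (Dt : conn_rule R m n).
Hypothesis Dt_natural : natural Dt.
Hypothesis Dt_order : of_order s r Dt.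

(** Components on the whole space with a prescribed 1-jet at 0; a linear change of coordinates keeps
    this form. *)
Definition aff d k (l0 : 'I_k -> 'I_k -> 'I_d -> R)
    (l1 : 'I_k -> 'I_k -> 'I_d -> 'I_d -> R) : coefs R d k :=
  fun x j i l => l0 j i l + \sum_si x 0 si * l1 j i l si.

Lemma aff_smooth d k l0 l1 : smooth_coefs setT (@aff d k l0 l1).
Proof.
move=> j i l; have oT := @openT 'rV[R]_d.
apply: smooth_add => //; first exact: smooth_cst.
apply: smooth_sum => // si; apply: smooth_mul => //; [exact: smooth_coord | exact: smooth_cst].
Qed.

Lemma partial_aff d k l0 l1 x j i l si :
  partial si (fun x => @aff d k l0 l1 x j i l) x = l1 j i l si.
Proof.
have dm q : differentiable (fun x : 'rV[R]_d => x 0 q * l1 j i l q : R) x.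
  by apply: diffableM; [exact: diffable_coord | exact: diffable_cst].
rewrite partialD; [|exact: diffable_cst|exact: diffable_sum].
rewrite partial_cst add0r partial_sum //.
rewrite -[RHS](sum_delta (fun q => l1 j i l q)); apply: eq_bigr => q _.
rewrite partialM; [|exact: diffable_coord|exact: diffable_cst].
by rewrite partial_cst partial_coord mulr0 addr0 mulrC.
Qed.

Lemma aff_at0 d k l0 l1 j i l : @aff d k l0 l1 0 j i l = l0 j i l.
Proof. by rewrite /aff big1 ?addr0 // => q _; rewrite mxE mul0r. Qed.

Lemma split_l (i : 'I_m) : fintype.split (lshift n i) = inl i :> 'I_m + 'I_n.
Proof. exact: (unsplitK (inl i : 'I_m + 'I_n)). Qed.

Lemma split_r (i : 'I_n) : fintype.split (rshift m i) = inr i :> 'I_m + 'I_n.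
Proof. exact: (unsplitK (inr i : 'I_m + 'I_n)). Qed.

Lemma blk_l (c t : R) (i : 'I_m) : blk c t (lshift n i) = c.
Proof. by rewrite /blk split_l. Qed.

Lemma blk_r (c t : R) (i : 'I_n) : blk c t (rshift m i) = t.
Proof. by rewrite /blk split_r. Qed.

Section Vanishing.
Variables (U : set 'rV[R]_m) (oU : open U) (x : 'rV[R]_m).
Hypothesis Ux : U x.
Variables (L : base_conn (flat n oU)) (K : lin_conn (flat n oU)) (y : 'rV[R]_n).
Implicit Types (mu la nu : 'I_m) (i j k : 'I_n).

(* The letters l (base) and r (fibre) of a suffix give the kinds of the indices
   B, A, C of the component D_B^A_C. *)
Lemma vanish_llr mu la k :
  Dt L K tt (row_mx x y) (lshift n mu) (lshift n la) (rshift m k) = 0.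
Proof. by apply: (@fib_vanish _ _ _ _ _ _ _ _ _ _ _ _ _ _ _ 0) => // t; rewrite ?blk_l ?blk_r expr1; ring. Qed.

Lemma vanish_rll j la nu :
  Dt L K tt (row_mx x y) (rshift m j) (lshift n la) (lshift n nu) = 0.
Proof. by apply: (@fib_vanish _ _ _ _ _ _ _ _ _ _ _ _ _ _ _ 0) => // t; rewrite ?blk_l ?blk_r expr1; ring. Qed.

Lemma vanish_rlr j la k :
  Dt L K tt (row_mx x y) (rshift m j) (lshift n la) (rshift m k) = 0.
Proof. by apply: (@fib_vanish _ _ _ _ _ _ _ _ _ _ _ _ _ _ _ 1) => // t; rewrite ?blk_l ?blk_r; ring. Qed.

Lemma vanish_rrr j i k :
  Dt L K tt (row_mx x y) (rshift m j) (rshift m i) (rshift m k) = 0.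
Proof. by apply: (@fib_vanish _ _ _ _ _ _ _ _ _ _ _ _ _ _ _ 0) => // t; rewrite ?blk_l ?blk_r expr1; ring. Qed.

End Vanishing.

Section Star.
Variables (V : set 'rV[R]_m) (oV : open V).
Hypothesis V0 : V 0.
Hypothesis Vc : forall (c : R) x, `|c| <= 1 -> V x -> V (c *: x).
Implicit Types (mu la nu : 'I_m) (i j k : 'I_n).

Lemma degree_lll mu la nu :
  exists al : index0 m n -> R, forall (L : base_conn (flat n oV)) (K : lin_conn (flat n oV)) y,
    Dt L K tt (row_mx 0 y) (lshift n mu) (lshift n la) (lshift n nu) =
    \sum_v al v * jet0 (L tt) (K tt) v.
Proof. by apply: degree1 => // t; rewrite ?blk_l ?mulr1. Qed.

Lemma degree_lrr mu i k :
  exists al : index0 m n -> R, forall (L : base_conn (flat n oV)) (K : lin_conn (flat n oV)) y,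
    Dt L K tt (row_mx 0 y) (lshift n mu) (rshift m i) (rshift m k) =
    \sum_v al v * jet0 (L tt) (K tt) v.
Proof. by apply: degree1 => // t; rewrite ?blk_l ?blk_r ?mulr1 ?mul1r. Qed.

Lemma degree_rrl j i nu :
  exists al : index0 m n -> R, forall (L : base_conn (flat n oV)) (K : lin_conn (flat n oV)) y,
    Dt L K tt (row_mx 0 y) (rshift m j) (rshift m i) (lshift n nu) =
    \sum_v al v * jet0 (L tt) (K tt) v.
Proof. by apply: degree1 => // t; rewrite ?blk_l ?blk_r ?mulr1 ?mul1r. Qed.

Lemma degree_lrl mu i nu :
  exists (be : 'I_n -> index0 m n -> index0 m n -> R) (ga : 'I_n -> index1 m n -> R),
  forall (L : base_conn (flat n oV)) (K : lin_conn (flat n oV)) y,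
    Dt L K tt (row_mx 0 y) (lshift n mu) (rshift m i) (lshift n nu) = \sum_p y 0 p *
      (\sum_v \sum_v' be p v v' * jet0 (L tt) (K tt) v' * jet0 (L tt) (K tt) v
       + \sum_v ga p v * jet1 (L tt) (K tt) v).
Proof. by apply: degree2 => // t; rewrite ?blk_l ?blk_r ?mulr1. Qed.

Lemma star_jets (L L' : base_conn (flat n oV)) (K K' : lin_conn (flat n oV)) y B A C :
  (forall v, jet0 (L tt) (K tt) v = jet0 (L' tt) (K' tt) v) ->
  (forall v, jet1 (L tt) (K tt) v = jet1 (L' tt) (K' tt) v) ->
  Dt L K tt (row_mx 0 y) B A C = Dt L' K' tt (row_mx 0 y) B A C.
Proof.
move=> e0 e1; rewrite -(splitK B) -(splitK A) -(splitK C).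
case: (fintype.split B) => [mu|j]; case: (fintype.split A) => [la|i];
  case: (fintype.split C) => [nu|k] /=.
- have [al H] := degree_lll mu la nu.
  by rewrite !H; apply: eq_bigr => v _; rewrite e0.
- by rewrite !vanish_llr.
- have [be [ga H]] := degree_lrl mu i nu.
  rewrite !H; apply: eq_bigr => p _; congr (_ * (_ + _)).
    by apply: eq_bigr => v _; apply: eq_bigr => v' _; rewrite !e0.
  by apply: eq_bigr => v _; rewrite e1.
- have [al H] := degree_lrr mu i k.
  by rewrite !H; apply: eq_bigr => v _; rewrite e0.
- by rewrite !vanish_rll.
- by rewrite !vanish_rlr.
- have [al H] := degree_rrl j i nu.
  by rewrite !H; apply: eq_bigr => v _; rewrite e0.
- by rewrite !vanish_rrr.
Qed.

End Star.

Lemma star_nbhs (V : set 'rV[R]_m) : open V -> V 0 ->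
  exists W : set 'rV[R]_m, [/\ open W, W 0, W `<=` V &
    forall (c : R) x, `|c| <= 1 -> W x -> W (c *: x)].
Proof.
move=> oV V0; have /nbhs_ballP[e /= e0 eV] := open_nbhs_nbhs (conj oV V0).
exists (ball (0 : 'rV[R]_m) e); split => //; [exact: ball_open | exact: ballxx |].
move=> c x; rewrite -!ball_normE /= !sub0r !normrN normrZ => c1; apply: le_lt_trans.
by rewrite -[leRHS]mul1r ler_wpM2r.
Qed.

Let oT := @openT 'rV[R]_m.

(* By [first_order], these values on connections with affine components determine
   the rule at the origin of any chart. *)
Definition D0 l0 l1 k0 k1 :=
  Dt (flat_base n oT (aff_smooth l0 l1)) (flat_lin oT (aff_smooth k0 k1)) tt.

Lemma first_order (V : set 'rV[R]_m) (oV : open V)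
    (L : base_conn (flat n oV)) (K : lin_conn (flat n oV)) y B A C : V 0 ->
  Dt L K tt (row_mx 0 y) B A C =
  D0 (L tt 0) (fun a b c si => partial si (fun x => L tt x a b c) 0)
     (K tt 0) (fun a b c si => partial si (fun x => K tt x a b c) 0) (row_mx 0 y) B A C.
Proof.
move=> V0; have [W [oW W0 WV Wc]] := star_nbhs oV V0.
have lw : smooth_coefs W (L tt).
  by move=> a b c; exact: (smooth_subset WV (flat_base_smooth L a b c)).
have kw : smooth_coefs W (K tt).
  by move=> a b c; exact: (smooth_subset WV (flat_lin_smooth K a b c)).
have aw k l0 l1 : smooth_coefs W (@aff m k l0 l1).
  by move=> a b c; exact: (smooth_subset (@subsetT _ W) (aff_smooth l0 l1 a b c)).
(* Locality is used twice: to shrink to the star-shaped [W], where the weights apply, and to pass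
   from [W] to the whole space for the affine connections. *)
rewrite -(flat_restrict Dt_natural (L1 := flat_base n oW lw) (K1 := flat_lin oW kw) WV) ?row_mxKl //.
set l0 := L tt 0; set l1 := fun a b => _; set k0 := K tt 0; set k1 := fun a b => _.
rewrite /D0 -(flat_restrict Dt_natural (L1 := flat_base n oW (aw m l0 l1))
  (K1 := flat_lin oW (aw n k0 k1)) (@subsetT _ _)) ?row_mxKl //.
by apply: (star_jets W0 Wc) => [[[[a b] c]|[[a b] c]]|[[[[a b] c] si]|[[[a b] c] si]]] /=;
  rewrite ?aff_at0 ?partial_aff.
Qed.

Definition related_deriv d k (M : 'M[R]_d) (N : 'M[R]_k)
    (G1 G2 : 'I_k -> 'I_k -> 'I_d -> 'I_d -> R) :=
  forall si, related M N (fun j i l => G1 j i l si)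
    (fun j i l => \sum_t G2 j i l t * M si t).

Lemma related_aff d k (M : 'M[R]_d) (N : 'M[R]_k) l0 l1 l0' l1' x :
  related M N l0 l0' -> related_deriv M N l1 l1' ->
  related M N (aff l0 l1 x) (aff l0' l1' (x *m M)).
Proof.
move=> H0 H1 j i' l; rewrite /aff.
under eq_bigr do rewrite mulrDl.
rewrite big_split /= H0.
under [RHS]eq_bigr => j' _ do under eq_bigr => l' _ do rewrite !mulrDl.
under [RHS]eq_bigr => j' _ do rewrite big_split /=.
rewrite big_split /=; congr (_ + _).
under eq_bigr do rewrite mulr_suml.
rewrite exchange_big /=.
transitivity (\sum_si x 0 si * (\sum_j' \sum_l' (\sum_t l1' j' i' l' t * M si t) * N j j' * M l l')).
  apply: eq_bigr => si _; rewrite -(H1 si j i' l) mulr_sumr.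
  by apply: eq_bigr => i _; rewrite mulrA.
under [LHS]eq_bigr => si _ do rewrite mulr_sumr.
rewrite exchange_big /=; apply: eq_bigr => j' _.
under [LHS]eq_bigr => si _ do rewrite mulr_sumr.
rewrite exchange_big /=; apply: eq_bigr => l' _.
rewrite !mulr_suml.
under [LHS]eq_bigr => si _ do rewrite !mulr_suml mulr_sumr.
rewrite exchange_big /=; apply: eq_bigr => t _.
rewrite mxE !mulr_suml; apply: eq_bigr => si _; ring.
Qed.

Section Block.
Variables (M : 'M[R]_m) (N : 'M[R]_n).
Let T := block_mx M 0 0 N : 'M[R]_(m + n).

Lemma sum_block_cl F la : \sum_A F A * T A (lshift n la) = \sum_x F (lshift n x) * M x la.
Proof.
rewrite big_split_ord /= [X in _ + X]big1 ?addr0 => [|i _].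
  by apply: eq_bigr => x _; rewrite block_mxEul.
by rewrite block_mxEdl mxE mulr0.
Qed.

Lemma sum_block_cr F i : \sum_A F A * T A (rshift m i) = \sum_x F (rshift m x) * N x i.
Proof.
rewrite big_split_ord /= [X in X + _]big1 ?add0r => [|x _].
  by apply: eq_bigr => x _; rewrite block_mxEdr.
by rewrite block_mxEur mxE mulr0.
Qed.

Lemma sum_block_rl F la : \sum_A F A * T (lshift n la) A = \sum_x F (lshift n x) * M la x.
Proof.
rewrite big_split_ord /= [X in _ + X]big1 ?addr0 => [|i _].
  by apply: eq_bigr => x _; rewrite block_mxEul.
by rewrite block_mxEur mxE mulr0.
Qed.

Lemma sum_block_rr F i : \sum_A F A * T (rshift m i) A = \sum_x F (rshift m x) * N i x.
Proof.
rewrite big_split_ord /= [X in X + _]big1 ?add0r => [|x _].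
  by apply: eq_bigr => x _; rewrite block_mxEdr.
by rewrite block_mxEdl mxE mulr0.
Qed.

Lemma sum_block2 (I1 I2 : finType) (f1 : I1 -> 'I_(m + n)) (f2 : I2 -> 'I_(m + n)) M1 M2 B C :
  (forall F, \sum_A F A * T B A = \sum_x F (f1 x) * M1 x) ->
  (forall F, \sum_A F A * T C A = \sum_x F (f2 x) * M2 x) ->
  forall G : 'I_(m + n) -> 'I_(m + n) -> R,
  \sum_B' \sum_C' G B' C' * T B B' * T C C' = \sum_x \sum_y G (f1 x) (f2 y) * M1 x * M2 y.
Proof.
move=> hB hC G.
transitivity (\sum_B' (\sum_y G B' (f2 y) * M2 y) * T B B').
  apply: eq_bigr => B' _; rewrite (hC (fun C' => G B' C' * T B B')) mulr_suml.
  by apply: eq_bigr => y _; ring.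
rewrite (hB (fun B' => \sum_y G B' (f2 y) * M2 y)); apply: eq_bigr => x _.
by rewrite mulr_suml; apply: eq_bigr => y _; ring.
Qed.

End Block.

Section Equivariance.
Variables (M : 'M[R]_m) (N : 'M[R]_n) (uM : M \in unitmx) (uN : N \in unitmx).
Variables (l0 l0' : 'I_m -> 'I_m -> 'I_m -> R) (l1 l1' : 'I_m -> 'I_m -> 'I_m -> 'I_m -> R).
Variables (k0 k0' : 'I_n -> 'I_n -> 'I_m -> R) (k1 k1' : 'I_n -> 'I_n -> 'I_m -> 'I_m -> R).
Hypothesis rl0 : related M M l0 l0'.
Hypothesis rl1 : related_deriv M M l1 l1'.
Hypothesis rk0 : related M N k0 k0'.
Hypothesis rk1 : related_deriv M N k1 k1'.

Lemma D0_related y :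
  related (block_mx M 0 0 N) (block_mx M 0 0 N)
    (D0 l0 l1 k0 k1 (row_mx 0 y)) (D0 l0' l1' k0' k1' (row_mx 0 (y *m N))).
Proof.
rewrite -[X in row_mx X (y *m N)](mul0mx 1 M).
by apply: (linear_naturality Dt_natural) => // x _; exact: related_aff.
Qed.

Lemma equiv_lll y mu la nu :
  \sum_x D0 l0 l1 k0 k1 (row_mx 0 y) (lshift n mu) (lshift n x) (lshift n nu) * M x la =
  \sum_a \sum_b D0 l0' l1' k0' k1' (row_mx 0 (y *m N)) (lshift n a) (lshift n la) (lshift n b)
     * M mu a * M nu b.
Proof.
have := D0_related y (lshift n mu) (lshift n la) (lshift n nu).
rewrite sum_block_cl => ->.
by apply: (sum_block2 (M1 := M mu) (M2 := M nu)) => F; exact: sum_block_rl.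
Qed.

Lemma equiv_lrr y mu i k :
  \sum_x D0 l0 l1 k0 k1 (row_mx 0 y) (lshift n mu) (rshift m x) (rshift m k) * N x i =
  \sum_a \sum_b D0 l0' l1' k0' k1' (row_mx 0 (y *m N)) (lshift n a) (rshift m i) (rshift m b)
     * M mu a * N k b.
Proof.
have := D0_related y (lshift n mu) (rshift m i) (rshift m k).
rewrite sum_block_cr => ->.
by apply: (sum_block2 (M1 := M mu) (M2 := N k)) => F; [exact: sum_block_rl | exact: sum_block_rr].
Qed.

Lemma equiv_rrl y j i nu :
  \sum_x D0 l0 l1 k0 k1 (row_mx 0 y) (rshift m j) (rshift m x) (lshift n nu) * N x i =
  \sum_a \sum_b D0 l0' l1' k0' k1' (row_mx 0 (y *m N)) (rshift m a) (rshift m i) (lshift n b)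
     * N j a * M nu b.
Proof.
have := D0_related y (rshift m j) (rshift m i) (lshift n nu).
rewrite sum_block_cr => ->.
by apply: (sum_block2 (M1 := N j) (M2 := M nu)) => F; [exact: sum_block_rr | exact: sum_block_rl].
Qed.

Lemma equiv_lrl y mu i nu :
  \sum_x D0 l0 l1 k0 k1 (row_mx 0 y) (lshift n mu) (rshift m x) (lshift n nu) * N x i =
  \sum_a \sum_b D0 l0' l1' k0' k1' (row_mx 0 (y *m N)) (lshift n a) (rshift m i) (lshift n b)
     * M mu a * M nu b.
Proof.
have := D0_related y (lshift n mu) (rshift m i) (lshift n nu).
rewrite sum_block_cr => ->.
by apply: (sum_block2 (M1 := M mu) (M2 := M nu)) => F; exact: sum_block_rl.
Qed.

End Equivariance.

End Affine.

(** * Values at the origin of normal coordinates *)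

Section Bases.
Variables (R : realType) (d k : nat) (M : 'M[R]_d) (N : 'M[R]_k).

(* A related pair of elementary tensors which does not involve the inverses of
   [M] and [N]. *)
Definition push_basis (a b : 'I_k) (c : 'I_d) (x y : 'I_k) (z : 'I_d) : R :=
  (a == x)%:R * N b y * (c == z)%:R.
Definition pull_basis (a b : 'I_k) (c : 'I_d) (x y : 'I_k) (z : 'I_d) : R :=
  N x a * (b == y)%:R * M z c.

Lemma related_basis a b c : related M N (pull_basis a b c) (push_basis a b c).
Proof.
move=> j i' l; rewrite /pull_basis /push_basis.
transitivity (N j a * N b i' * M l c).
  rewrite -(sum_delta (fun i => N j a * N i i' * M l c)).
  by apply: eq_bigr => i _; ring.
rewrite -(sum_delta (fun j' => N j j' * N b i' * M l c)); apply: eq_bigr => j' _.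
rewrite -(sum_delta (fun l' => N j j' * N b i' * M l l')) mulr_suml.
by apply: eq_bigr => l' _; ring.
Qed.

Lemma related_deriv_basis a b c e :
  related_deriv M N (fun x y z t => pull_basis a b c x y z * M t e)
    (fun x y z t => push_basis a b c x y z * (e == t)%:R).
Proof.
move=> si j i' l.
have -> : \sum_i pull_basis a b c j i l * M si e * N i i' =
    (\sum_i pull_basis a b c j i l * N i i') * M si e.
  by rewrite mulr_suml; apply: eq_bigr => i _; ring.
rewrite related_basis mulr_suml; apply: eq_bigr => j' _.
rewrite mulr_suml; apply: eq_bigr => l' _.
rewrite -(sum_delta (fun t => M si t)) mulr_sumr !mulr_suml.
by apply: eq_bigr => t _; ring.
Qed.

Lemma related_refl (G : 'I_k -> 'I_k -> 'I_d -> R) : related 1%:M 1%:M G G.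
Proof. exact/related1. Qed.

Lemma related_zero : related M N (fun _ _ _ => 0) (fun _ _ _ => 0).
Proof.
move=> j i' l; rewrite [LHS]big1 => [|i _]; last by rewrite mul0r.
by rewrite [RHS]big1 // => j' _; rewrite big1 // => l' _; rewrite !mul0r.
Qed.

Lemma related_deriv_zero : related_deriv M N (fun _ _ _ _ => 0) (fun _ _ _ _ => 0).
Proof.
move=> si j i' l; rewrite [LHS]big1 => [|i _]; last by rewrite mul0r.
rewrite [RHS]big1 // => j' _; rewrite big1 // => l' _.
by rewrite big1 ?mul0r // => t _; rewrite mul0r.
Qed.

Lemma sum_push (al : 'I_k -> 'I_k -> 'I_d -> R) a b c :
  \sum_x \sum_y \sum_z al x y z * push_basis a b c x y z = \sum_y al a y c * N b y.
Proof.
rewrite -(sum_delta (fun x => \sum_y al x y c * N b y)); apply: eq_bigr => x _.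
rewrite mulr_suml; apply: eq_bigr => y _.
rewrite -(sum_delta (fun z => al x y z * N b y)) mulr_suml; apply: eq_bigr => z _.
by rewrite /push_basis; ring.
Qed.

Lemma sum_pull (al : 'I_k -> 'I_k -> 'I_d -> R) a b c :
  \sum_x \sum_y \sum_z al x y z * pull_basis a b c x y z =
  \sum_x \sum_z al x b z * (N x a * M z c).
Proof.
apply: eq_bigr => x _; rewrite -(sum_delta (fun y => \sum_z al x y z * (N x a * M z c))).
apply: eq_bigr => y _; rewrite mulr_suml; apply: eq_bigr => z _.
by rewrite /pull_basis; ring.
Qed.

Lemma sum_push1 (al : 'I_k -> 'I_k -> 'I_d -> 'I_d -> R) a b c e :
  \sum_x \sum_y \sum_z \sum_t al x y z t * (push_basis a b c x y z * (e == t)%:R) =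
  \sum_y al a y c e * N b y.
Proof.
rewrite -(sum_push (fun x y z => al x y z e)).
apply: eq_bigr => x _; apply: eq_bigr => y _; apply: eq_bigr => z _.
rewrite -(sum_delta (fun t => al x y z t)) mulr_suml; apply: eq_bigr => t _; ring.
Qed.

Lemma sum_pull1 (al : 'I_k -> 'I_k -> 'I_d -> 'I_d -> R) a b c e :
  \sum_x \sum_y \sum_z \sum_t al x y z t * (pull_basis a b c x y z * M t e) =
  \sum_x \sum_z \sum_t al x b z t * (N x a * (M z c * M t e)).
Proof.
transitivity (\sum_x \sum_y \sum_z (\sum_t al x y z t * M t e) * pull_basis a b c x y z).
  apply: eq_bigr => x _; apply: eq_bigr => y _; apply: eq_bigr => z _.
  by rewrite mulr_suml; apply: eq_bigr => t _; ring.
rewrite sum_pull; apply: eq_bigr => x _; apply: eq_bigr => z _.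
by rewrite mulr_suml; apply: eq_bigr => t _; ring.
Qed.

Lemma sum_push_id (al : 'I_k -> 'I_k -> 'I_d -> R) a b c :
  \sum_y al a y c * (1%:M : 'M[R]_k) b y = al a b c.
Proof. by under eq_bigr do rewrite mxE; exact: sum_delta. Qed.

End Bases.

Section Sums.
Variable R : nmodType.

Lemma sum_triple (A B C : finType) (G : A * B * C -> R) :
  \sum_p G p = \sum_x \sum_y \sum_z G (x, y, z).
Proof. by rewrite pair_bigA pair_bigA /=; apply: eq_bigr => -[[x y] z]. Qed.

Lemma sum_quad (A B C D : finType) (G : A * B * C * D -> R) :
  \sum_p G p = \sum_x \sum_y \sum_z \sum_t G (x, y, z, t).
Proof. by rewrite pair_bigA pair_bigA pair_bigA /=; apply: eq_bigr => -[[[x y] z] t]. Qed.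

End Sums.

Section Picks.
Variables (R : realType) (S I : finType).

Lemma pick1 (a0 : I) (G : I -> R) : \sum_a (a == a0)%:R * G a = G a0.
Proof.
rewrite (bigD1 a0) //= eqxx mul1r big1 ?addr0 // => a /negbTE ->.
by rewrite mul0r.
Qed.

Lemma pick2 (c L : S -> R) (A C : S -> I) (G : I -> I -> R) :
  \sum_a \sum_b (\sum_s c s * ((a == A s)%:R * ((b == C s)%:R * L s))) * G a b =
  \sum_s c s * (L s * G (A s) (C s)).
Proof.
under eq_bigr => a _ do under eq_bigr => b _ do rewrite mulr_suml.
under eq_bigr => a _ do rewrite exchange_big /=.
rewrite exchange_big /=; apply: eq_bigr => s _.
rewrite -(pick1 (A s) (fun a => c s * (L s * G a (C s)))); apply: eq_bigr => a _.
rewrite -(pick1 (C s) (fun b => c s * (L s * G a b))) mulr_sumr.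
by apply: eq_bigr => b _; ring.
Qed.

End Picks.

Definition ttr (R : realType) m (T : 'I_m -> 'I_m -> 'I_m -> R) (mu : 'I_m) : R :=
  \sum_rho T rho rho mu.

Definition antisym (R : realType) m (T : 'I_m -> 'I_m -> 'I_m -> R) :=
  forall a b c, T a b c = - T c b a.

Section Contractions.
Variables (R : realType) (m n : nat).

Lemma ttr_swap (T : 'I_m -> 'I_m -> 'I_m -> R) mu : antisym T ->
  \sum_b T mu b b = - ttr T mu.
Proof. by move=> aT; rewrite -sumrN; apply: eq_bigr => b _; rewrite aT. Qed.

(** The two lower slots of [T] and the index [la] are matched with [mu], [nu] and the contracted
    index. Two of the six matchings give [T] up to sign, and the other four give a trace with a free
    index [mu] or [nu]. *)
Lemma lll_permutation (s : 'S_3) : exists x1 x2 x3 : R,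
  forall (T : 'I_m -> 'I_m -> 'I_m -> R), antisym T -> forall mu la nu,
  \sum_b (la == mk3 mu nu b (s o2))%:R * T (mk3 mu nu b (s o0)) b (mk3 mu nu b (s o1)) =
  x1 * T mu la nu + x2 * ((la == mu)%:R * ttr T nu) + x3 * ((la == nu)%:R * ttr T mu).
Proof.
apply: (perm3_ind (Q := fun a b c => exists x1 x2 x3 : R,
  forall (T : 'I_m -> 'I_m -> 'I_m -> R), antisym T -> forall mu la nu,
  \sum_e (la == mk3 mu nu e c)%:R * T (mk3 mu nu e a) e (mk3 mu nu e b) =
  x1 * T mu la nu + x2 * ((la == mu)%:R * ttr T nu) + x3 * ((la == nu)%:R * ttr T mu))).
- exists 1, 0, 0 => T aT mu la nu; under eq_bigr do rewrite !mkE eq_sym.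
  by rewrite pick1; ring.
- exists 0, 0, (-1) => T aT mu la nu; under eq_bigr do rewrite !mkE.
  by rewrite -mulr_sumr ttr_swap //; ring.
- exists (-1), 0, 0 => T aT mu la nu; under eq_bigr do rewrite !mkE eq_sym.
  by rewrite pick1 aT; ring.
- exists 0, (-1), 0 => T aT mu la nu; under eq_bigr do rewrite !mkE.
  by rewrite -mulr_sumr ttr_swap //; ring.
- exists 0, 0, 1 => T aT mu la nu; under eq_bigr do rewrite !mkE.
  by rewrite -mulr_sumr -/(ttr T mu); ring.
- exists 0, 1, 0 => T aT mu la nu; under eq_bigr do rewrite !mkE.
  by rewrite -mulr_sumr -/(ttr T nu); ring.
Qed.

(** Common to [D_mu^i_k] and [D_j^i_nu]: the fibre indices admit the identity only, and the base
    indices admit the trace of [T] only, up to sign. *)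
Lemma mixed_invariant (al : 'I_m -> 'I_n -> 'I_n -> 'I_m -> 'I_m -> 'I_m -> R) :
  (forall M : 'M[R]_m, M \in unitmx -> forall mu k i a b c,
    \sum_x \sum_z al mu k i x b z * (M x a * M z c) =
    \sum_u (\sum_y al u k i a y c * M b y) * M mu u) ->
  (forall N : 'M[R]_n, N \in unitmx -> forall mu k i a b c,
    \sum_x al mu k x a b c * N x i = \sum_q al mu q i a b c * N k q) ->
  exists h : R, forall T, antisym T -> forall mu k i,
    \sum_a \sum_b \sum_c al mu k i a b c * T a b c = h * (ttr T mu * (i == k)%:R).
Proof.
move=> HM HN.
(* The lower indices of the coefficient tensor become rows and its upper indices columns, so that
   invariance reads as commutation with tensor powers. The index [b] counts as lower because it is
   paired with the upper index of the connection. *)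
pose F (i : {ffun 'I_2 -> 'I_m}) (p : {ffun 'I_1 -> 'I_n}) (j : {ffun 'I_2 -> 'I_m})
  (q : {ffun 'I_1 -> 'I_n}) := al (i o0) (p o0) (q o0) (j o0) (i o1) (j o1).
have [c cE] : exists c : 'S_2 -> 'S_1 -> R, forall i p j q,
    F i p j q = \sum_s \sum_t c s t * tperm_mx R s i j * tperm_mx R t p q.
  apply: invariant_tensor2 => [M uM p q|N uN i j].
    apply: tcomm2 => mu b a e; rewrite /F !mkE.
    under eq_bigr do under eq_bigr do rewrite !mkE.
    rewrite HM //; apply: eq_bigr => u _; rewrite mulr_suml; apply: eq_bigr => y _.
    by rewrite !mkE; ring.
  apply: tcomm1 => k i'; rewrite /F !mkE.
  under eq_bigr do rewrite !mkE.
  by rewrite HN //; apply: eq_bigr => q _; rewrite !mkE mulrC.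
have alE mu k i a b e : al mu k i a b e =
    \sum_s c s 1%g * ((a == mk2 mu b (s o0))%:R * ((e == mk2 mu b (s o1))%:R * (i == k)%:R)).
  have -> : al mu k i a b e = F (mk2 mu b) (mk1 k) (mk2 a e) (mk1 i) by rewrite /F !mkE.
  rewrite cE; apply: eq_bigr => s _; rewrite (big_pred1 1%g) => [|t]; last first.
    by rewrite (perm1_id t) /= eqxx.
  by rewrite tperm_mx2 tperm_mx1; ring.
have P (s : 'S_2) : exists h : R, forall T : 'I_m -> 'I_m -> 'I_m -> R, antisym T ->
    forall mu, \sum_b T (mk2 mu b (s o0)) b (mk2 mu b (s o1)) = h * ttr T mu.
  apply: (perm2_ind (Q := fun a b => exists h : R, forall T : 'I_m -> 'I_m -> 'I_m -> R,
    antisym T -> forall mu, \sum_e T (mk2 mu e a) e (mk2 mu e b) = h * ttr T mu)).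
    exists (-1) => T aT mu; under eq_bigr do rewrite !mkE.
    by rewrite ttr_swap // mulN1r.
  exists 1 => T aT mu; under eq_bigr do rewrite !mkE.
  by rewrite mul1r.
have [h hP] := choice P.
exists (\sum_s c s 1%g * h s) => T aT mu k i; rewrite exchange_big /=.
under eq_bigr => b _ do under eq_bigr => a _ do under eq_bigr => e _ do rewrite alE.
under eq_bigr => b _ do rewrite (pick2 (fun s : 'S_2 => c s 1%g)
  (fun=> (i == k)%:R) (fun s : 'S_2 => mk2 mu b (s o0)) (fun s : 'S_2 => mk2 mu b (s o1))
  (fun a e => T a b e)).
rewrite exchange_big mulr_suml; apply: eq_bigr => s _ /=.
rewrite -mulr_sumr -mulr_sumr hP //; ring.
Qed.

End Contractions.

Section Coefficients.
Variables (R : realType) (m n s r : nat) (Dt : conn_rule R m n).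
Hypothesis Dt_natural : natural Dt.
Hypothesis Dt_order : of_order s r Dt.

Local Notation D := (D0 Dt).
Local Notation z3 := (fun _ _ _ => 0).
Local Notation z4 := (fun _ _ _ _ => 0).

(** Only connections with [K = 0] at the origin are considered, as normal coordinates provide; this
    leaves the coefficients of [Lambda]. *)
Let coef1 (B A C : 'I_(m + n)) :
  (exists al : index0 m n -> R, forall (L : base_conn (flat n (@openT 'rV[R]_m))) K y,
    Dt L K tt (row_mx 0 y) B A C = \sum_v al v * jet0 (L tt) (K tt) v) ->
  exists al : 'I_m -> 'I_m -> 'I_m -> R, forall l0 l1 k1 y,
    D l0 l1 z3 k1 (row_mx 0 y) B A C = \sum_a \sum_b \sum_c al a b c * l0 a b c.
Proof.
move=> [al H]; exists (fun a b c => al (inl (a, b, c))) => l0 l1 k1 y.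
rewrite /D0 H big_sumType /= [X in _ + X]big1 ?addr0 => [|[[a b] c] _].
  rewrite sum_triple; apply: eq_bigr => a _; apply: eq_bigr => b _.
  by apply: eq_bigr => c _; rewrite /= aff_at0.
by rewrite /= aff_at0 mulr0.
Qed.

Lemma coef_lll : exists al : 'I_m -> 'I_m -> 'I_m -> 'I_m -> 'I_m -> 'I_m -> R,
  forall mu la nu l0 l1 k1 y,
  D l0 l1 z3 k1 (row_mx 0 y) (lshift n mu) (lshift n la) (lshift n nu) =
  \sum_a \sum_b \sum_c al mu la nu a b c * l0 a b c.
Proof.
have H mu la nu := coef1 (degree_lll Dt_natural Dt_order (@openT _) I (fun _ _ _ _ => I) mu la nu).
have [al alP] := choice (fun p : 'I_m * 'I_m * 'I_m => H p.1.1 p.1.2 p.2).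
by exists (fun mu la nu => al (mu, la, nu)) => mu la nu; exact: (alP (mu, la, nu)).
Qed.

Lemma coef_lrr : exists al : 'I_m -> 'I_n -> 'I_n -> 'I_m -> 'I_m -> 'I_m -> R,
  forall mu k i l0 l1 k1 y,
  D l0 l1 z3 k1 (row_mx 0 y) (lshift n mu) (rshift m i) (rshift m k) =
  \sum_a \sum_b \sum_c al mu k i a b c * l0 a b c.
Proof.
have H mu i k := coef1 (degree_lrr Dt_natural Dt_order (@openT _) I (fun _ _ _ _ => I) mu i k).
have [al alP] := choice (fun p : 'I_m * 'I_n * 'I_n => H p.1.1 p.2 p.1.2).
by exists (fun mu k i => al (mu, k, i)) => mu k i; exact: (alP (mu, k, i)).
Qed.

Lemma coef_rrl : exists al : 'I_m -> 'I_n -> 'I_n -> 'I_m -> 'I_m -> 'I_m -> R,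
  forall nu j i l0 l1 k1 y,
  D l0 l1 z3 k1 (row_mx 0 y) (rshift m j) (rshift m i) (lshift n nu) =
  \sum_a \sum_b \sum_c al nu j i a b c * l0 a b c.
Proof.
have H nu j i := coef1 (degree_rrl Dt_natural Dt_order (@openT _) I (fun _ _ _ _ => I) j i nu).
have [al alP] := choice (fun p : 'I_m * 'I_n * 'I_n => H p.1.1 p.1.2 p.2).
by exists (fun nu j i => al (nu, j, i)) => nu j i; exact: (alP (nu, j, i)).
Qed.

Lemma lll_contraction : exists c : 'S_3 -> R, forall mu la nu l0 l1 k1 y,
  D l0 l1 z3 k1 (row_mx 0 y) (lshift n mu) (lshift n la) (lshift n nu) =
  \sum_s c s * \sum_b (la == mk3 mu nu b (s o2))%:R *
    l0 (mk3 mu nu b (s o0)) b (mk3 mu nu b (s o1)).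
Proof.
have [al alP] := coef_lll.
pose F (i j : {ffun 'I_3 -> 'I_m}) := al (i o0) (j o2) (i o1) (j o0) (i o2) (j o1).
have cF (M : 'M[R]_m) : M \in unitmx -> tcomm F (tpow M).
  move=> uM; apply: tcomm3 => mu nu b a c la; rewrite /F !mkE.
  have := equiv_lll Dt_natural uM (unitmx1 R n) (related_basis M M a b c) (related_deriv_zero M M)
    (related_zero M 1%:M) (related_deriv_zero M 1%:M) 0 mu la nu.
  rewrite mul0mx; under eq_bigr do rewrite alP sum_pull.
  under [X in _ = X -> _]eq_bigr do under eq_bigr do rewrite alP sum_push.
  move=> E.
  transitivity (\sum_x (\sum_x0 \sum_z al mu x nu x0 b z * (M x0 a * M z c)) * M x la).
    under [RHS]eq_bigr do rewrite mulr_suml.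
    rewrite [RHS]exchange_big; apply: eq_bigr => z1 _.
    under [RHS]eq_bigr do rewrite mulr_suml.
    rewrite [RHS]exchange_big; apply: eq_bigr => z2 _.
    by apply: eq_bigr => z3 _; rewrite !mkE; ring.
  rewrite E; apply: eq_bigr => z1 _; apply: eq_bigr => z2 _.
  rewrite !mulr_suml; apply: eq_bigr => y _; rewrite !mkE; ring.
have [w wE] := invariant_tensor R m 3.
pose c s := \sum_p \sum_q w s p q * F p q.
have alE mu la nu a b e : al mu la nu a b e =
    \sum_s c s * ((a == mk3 mu nu b (s o0))%:R * ((e == mk3 mu nu b (s o1))%:R *
       (la == mk3 mu nu b (s o2))%:R)).
  have -> : al mu la nu a b e = F (mk3 mu nu b) (mk3 a e la) by rewrite /F !mkE.
  by rewrite wE //; apply: eq_bigr => s' _; rewrite tperm_mx3.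
exists c => mu la nu l0 l1 k1 y; rewrite alP exchange_big /=.
under [RHS]eq_bigr do rewrite mulr_sumr.
rewrite [RHS]exchange_big /=; apply: eq_bigr => b _.
under eq_bigr => a _ do under eq_bigr => e _ do rewrite alE.
exact: (pick2 c (fun s => (la == mk3 mu nu b (s o2))%:R) (fun s => mk3 mu nu b (s o0))
  (fun s => mk3 mu nu b (s o1)) (fun a e => l0 a b e)).
Qed.

Lemma lll_invariant : exists x1 x2 x3 : R, forall T, antisym T -> forall mu la nu l1 k1 y,
  D T l1 z3 k1 (row_mx 0 y) (lshift n mu) (lshift n la) (lshift n nu) =
  x1 * T mu la nu + x2 * ((la == mu)%:R * ttr T nu) + x3 * ((la == nu)%:R * ttr T mu).
Proof.
have [c cP] := lll_contraction.
have [x1 xP] := choice (lll_permutation R m).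
have [x2 {}xP] := choice xP; have [x3 {}xP] := choice xP.
exists (\sum_s c s * x1 s), (\sum_s c s * x2 s), (\sum_s c s * x3 s) => T aT mu la nu l1 k1 y.
rewrite cP !mulr_suml -!big_split /=; apply: eq_bigr => s' _.
by rewrite xP //; ring.
Qed.

Lemma lrr_invariant : exists h : R, forall T, antisym T -> forall mu k i l1 k1 y,
  D T l1 z3 k1 (row_mx 0 y) (lshift n mu) (rshift m i) (rshift m k) =
  h * (ttr T mu * (i == k)%:R).
Proof.
have [al alP] := coef_lrr.
have [||h hP] := @mixed_invariant R m n al; last first.
- by exists h => T aT mu k i l1 k1 y; rewrite alP hP.
- move=> N uN mu k i a b c.
  have := equiv_lrr Dt_natural (unitmx1 R m) uN (related_refl (push_basis 1%:M a b c))
    (related_deriv_zero 1%:M 1%:M) (related_zero 1%:M N) (related_deriv_zero 1%:M N) 0 mu i k.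
  rewrite mul0mx; under eq_bigr do rewrite alP sum_push sum_push_id.
  move=> ->; rewrite -(sum_delta (fun mu => \sum_q al mu q i a b c * N k q)).
  apply: eq_bigr => u _; rewrite mulr_suml; apply: eq_bigr => q _.
  by rewrite alP sum_push sum_push_id mxE; ring.
- move=> M uM mu k i a b c.
  have := equiv_lrr Dt_natural uM (unitmx1 R n) (related_basis M M a b c)
    (related_deriv_zero M M) (related_zero M 1%:M) (related_deriv_zero M 1%:M) 0 mu i k.
  rewrite mul0mx; under eq_bigr do rewrite alP sum_pull mxE.
  rewrite sum_delta' => ->; apply: eq_bigr => u _.
  rewrite -(sum_delta (fun q => (\sum_y al u q i a y c * M b y) * M mu u)).
  by apply: eq_bigr => q _; rewrite alP sum_push mxE; ring.
Qed.

Lemma rrl_invariant : exists h : R, forall T, antisym T -> forall nu j i l1 k1 y,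
  D T l1 z3 k1 (row_mx 0 y) (rshift m j) (rshift m i) (lshift n nu) =
  h * (ttr T nu * (i == j)%:R).
Proof.
have [al alP] := coef_rrl.
have [||h hP] := @mixed_invariant R m n al; last first.
- by exists h => T aT nu j i l1 k1 y; rewrite alP hP.
- move=> N uN nu j i a b c.
  have := equiv_rrl Dt_natural (unitmx1 R m) uN (related_refl (push_basis 1%:M a b c))
    (related_deriv_zero 1%:M 1%:M) (related_zero 1%:M N) (related_deriv_zero 1%:M N) 0 j i nu.
  rewrite mul0mx; under eq_bigr do rewrite alP sum_push sum_push_id.
  move=> ->; apply: eq_bigr => q _.
  rewrite -(sum_delta (fun nu => al nu q i a b c * N j q)); apply: eq_bigr => u _.
  by rewrite alP sum_push sum_push_id mxE; ring.
- move=> M uM nu j i a b c.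
  have := equiv_rrl Dt_natural uM (unitmx1 R n) (related_basis M M a b c)
    (related_deriv_zero M M) (related_zero M 1%:M) (related_deriv_zero M 1%:M) 0 j i nu.
  rewrite mul0mx; under eq_bigr do rewrite alP sum_pull mxE.
  rewrite sum_delta' => ->; rewrite exchange_big; apply: eq_bigr => u _ /=.
  rewrite -(sum_delta (fun q => (\sum_y al u q i a y c * M b y) * M nu u)).
  by apply: eq_bigr => q _; rewrite alP sum_push mxE; ring.
Qed.

End Coefficients.

Section MorePicks.
Variables (R : realType) (S I : finType).

Lemma pick3 (c : S -> R) (A B C : S -> I) (G : I -> I -> I -> R) :
  \sum_a \sum_b \sum_e (\sum_s c s * ((a == A s)%:R * ((b == B s)%:R * (e == C s)%:R))) * G a b e =
  \sum_s c s * G (A s) (B s) (C s).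
Proof.
transitivity (\sum_a \sum_b (\sum_s c s * ((a == A s)%:R * ((b == B s)%:R * G a b (C s)))) * 1).
  apply: eq_bigr => a _; apply: eq_bigr => b _; rewrite mulr1.
  under eq_bigr do rewrite mulr_suml.
  rewrite exchange_big /=; apply: eq_bigr => s _.
  rewrite -(pick1 (C s) (fun e => c s * ((a == A s)%:R * ((b == B s)%:R * G a b e)))).
  by apply: eq_bigr => e _; ring.
under eq_bigr => a _ do under eq_bigr => b _ do rewrite mulr1.
under eq_bigr => a _ do rewrite exchange_big /=.
rewrite exchange_big /=; apply: eq_bigr => s _.
rewrite -(pick1 (A s) (fun a => c s * G a (B s) (C s))); apply: eq_bigr => a _.
rewrite -(pick1 (B s) (fun b => c s * G a b (C s))) mulr_sumr.
by apply: eq_bigr => b _; ring.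
Qed.

Lemma pick4 (c : S -> R) (A B C E : S -> I) (G : I -> I -> I -> I -> R) :
  \sum_a \sum_b \sum_e \sum_f (\sum_s c s * ((a == A s)%:R * ((b == B s)%:R *
     ((e == C s)%:R * (f == E s)%:R)))) * G a b e f =
  \sum_s c s * G (A s) (B s) (C s) (E s).
Proof.
pose H s a := \sum_b \sum_e \sum_f (\sum_(s' in [:: s]) c s' * ((b == B s')%:R *
     ((e == C s')%:R * (f == E s')%:R))) * G a b e f.
transitivity (\sum_a \sum_s (a == A s)%:R * (\sum_b \sum_e \sum_f
    (c s * ((b == B s)%:R * ((e == C s)%:R * (f == E s)%:R))) * G a b e f)).
  apply: eq_bigr => a _; under [RHS]eq_bigr do rewrite mulr_sumr.
  rewrite [RHS]exchange_big /=; apply: eq_bigr => b _.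
  under [RHS]eq_bigr do rewrite mulr_sumr.
  rewrite [RHS]exchange_big /=; apply: eq_bigr => e _.
  under [RHS]eq_bigr do rewrite mulr_sumr.
  rewrite [RHS]exchange_big /=; apply: eq_bigr => f _.
  by rewrite mulr_suml; apply: eq_bigr => s _; ring.
rewrite exchange_big /=; apply: eq_bigr => s _; rewrite pick1.
rewrite -(pick1 (B s) (fun b => c s * G (A s) b (C s) (E s))); apply: eq_bigr => b _.
rewrite -(pick1 (C s) (fun e => (b == B s)%:R * (c s * G (A s) b e (E s)))).
apply: eq_bigr => e _.
rewrite -(pick1 (E s) (fun f => (b == B s)%:R * (c s * G (A s) b e f))) mulr_sumr.
by apply: eq_bigr => f _; ring.
Qed.

End MorePicks.

(** * Invariants entering the component [D_mu^i_nu] *)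

Section LrlInvariants.
Variables (R : realType) (m n : nat).
Variable ga : 'I_m -> 'I_m -> 'I_n -> 'I_n -> 'I_m -> 'I_m -> 'I_m -> 'I_m -> R.
Hypothesis gaM : forall M : 'M[R]_m, M \in unitmx -> forall mu nu p i a b c e,
  \sum_x \sum_z \sum_t ga mu nu p i x b z t * (M x a * (M z c * M t e)) =
  \sum_u \sum_w (\sum_y ga u w p i a y c e * M b y) * M mu u * M nu w.
Hypothesis gaN : forall N : 'M[R]_n, N \in unitmx -> forall mu nu p i a b c e,
  \sum_x ga mu nu p x a b c e * N x i = \sum_q N p q * ga mu nu q i a b c e.

Lemma ga_contraction : exists c : 'S_3 -> R, forall mu nu p i T,
  \sum_a \sum_b \sum_c \sum_e ga mu nu p i a b c e * T a b c e =
  (i == p)%:R * \sum_s c s * \sum_b T (mk3 mu nu b (s o0)) b (mk3 mu nu b (s o1)) (mk3 mu nu b (s o2)).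
Proof.
pose F (i : {ffun 'I_3 -> 'I_m}) (p : {ffun 'I_1 -> 'I_n}) (j : {ffun 'I_3 -> 'I_m})
  (q : {ffun 'I_1 -> 'I_n}) := ga (i o0) (i o1) (p o0) (q o0) (j o0) (i o2) (j o1) (j o2).
have [c cE] : exists c : 'S_3 -> 'S_1 -> R, forall i p j q,
    F i p j q = \sum_s \sum_t c s t * tperm_mx R s i j * tperm_mx R t p q.
  apply: invariant_tensor2 => [M uM p q|N uN i j].
    apply: tcomm3 => mu nu b a c e; rewrite /F !mkE.
    under eq_bigr do under eq_bigr do under eq_bigr do rewrite !mkE.
    rewrite gaM //; apply: eq_bigr => u _; apply: eq_bigr => w _.
    by rewrite !mulr_suml; apply: eq_bigr => y _; rewrite !mkE; ring.
  apply: tcomm1 => k i'; rewrite /F !mkE.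
  under eq_bigr do rewrite !mkE.
  by rewrite gaN //; apply: eq_bigr => q _; rewrite !mkE.
exists (fun s => c s 1%g) => mu nu p i T.
have gaE a b e f : ga mu nu p i a b e f =
    (i == p)%:R * \sum_s c s 1%g * ((a == mk3 mu nu b (s o0))%:R *
      ((e == mk3 mu nu b (s o1))%:R * (f == mk3 mu nu b (s o2))%:R)).
  have -> : ga mu nu p i a b e f = F (mk3 mu nu b) (mk1 p) (mk3 a e f) (mk1 i) by rewrite /F !mkE.
  rewrite cE mulr_sumr; apply: eq_bigr => s _; rewrite (big_pred1 1%g) => [|t]; last first.
    by rewrite (perm1_id t) /= eqxx.
  by rewrite tperm_mx3 tperm_mx1; ring.
rewrite exchange_big /=; under [X in _ = _ * X]eq_bigr do rewrite mulr_sumr.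
rewrite [X in _ = _ * X]exchange_big mulr_sumr; apply: eq_bigr => b _ /=.
rewrite -(pick3 (fun s : 'S_3 => c s 1%g) (fun s : 'S_3 => mk3 mu nu b (s o0))
  (fun s : 'S_3 => mk3 mu nu b (s o1)) (fun s : 'S_3 => mk3 mu nu b (s o2))
  (fun a e f => T a b e f)).
rewrite mulr_sumr; apply: eq_bigr => a _; rewrite mulr_sumr; apply: eq_bigr => e _.
by rewrite mulr_sumr; apply: eq_bigr => f _; rewrite gaE; ring.
Qed.

(** First derivatives of [Lambda] have no symmetry to exploit, so each of the six permutations keeps
    its own contraction. *)
Lemma ga_invariant : exists q1 q2 q3 q4 q5 q6 : R, forall mu nu p i T,
  \sum_a \sum_b \sum_c \sum_e ga mu nu p i a b c e * T a b c e =
  (i == p)%:R * (q1 * (\sum_b T mu b nu b) + q2 * (\sum_b T mu b b nu) +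
    q3 * (\sum_b T nu b mu b) + q4 * (\sum_b T nu b b mu) +
    q5 * (\sum_b T b b mu nu) + q6 * (\sum_b T b b nu mu)).
Proof.
have [c cP] := ga_contraction.
have P (s : 'S_3) : exists q1 q2 q3 q4 q5 q6 : R, forall mu nu (T : 'I_m -> 'I_m -> 'I_m -> 'I_m -> R),
    \sum_b T (mk3 mu nu b (s o0)) b (mk3 mu nu b (s o1)) (mk3 mu nu b (s o2)) =
    q1 * (\sum_b T mu b nu b) + q2 * (\sum_b T mu b b nu) +
    q3 * (\sum_b T nu b mu b) + q4 * (\sum_b T nu b b mu) +
    q5 * (\sum_b T b b mu nu) + q6 * (\sum_b T b b nu mu).
  apply: (perm3_ind (Q := fun a e f => exists q1 q2 q3 q4 q5 q6 : R,
    forall mu nu (T : 'I_m -> 'I_m -> 'I_m -> 'I_m -> R),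
    \sum_b T (mk3 mu nu b a) b (mk3 mu nu b e) (mk3 mu nu b f) =
    q1 * (\sum_b T mu b nu b) + q2 * (\sum_b T mu b b nu) +
    q3 * (\sum_b T nu b mu b) + q4 * (\sum_b T nu b b mu) +
    q5 * (\sum_b T b b mu nu) + q6 * (\sum_b T b b nu mu))).
  - by exists 1, 0, 0, 0, 0, 0 => mu nu T; under eq_bigr do rewrite !mkE; ring.
  - by exists 0, 1, 0, 0, 0, 0 => mu nu T; under eq_bigr do rewrite !mkE; ring.
  - by exists 0, 0, 1, 0, 0, 0 => mu nu T; under eq_bigr do rewrite !mkE; ring.
  - by exists 0, 0, 0, 1, 0, 0 => mu nu T; under eq_bigr do rewrite !mkE; ring.
  - by exists 0, 0, 0, 0, 1, 0 => mu nu T; under eq_bigr do rewrite !mkE; ring.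
  - by exists 0, 0, 0, 0, 0, 1 => mu nu T; under eq_bigr do rewrite !mkE; ring.
have [q1 P1] := choice P; have [q2 P2] := choice P1; have [q3 P3] := choice P2.
have [q4 P4] := choice P3; have [q5 P5] := choice P4; have [q6 P6] := choice P5.
exists (\sum_s c s * q1 s), (\sum_s c s * q2 s), (\sum_s c s * q3 s),
  (\sum_s c s * q4 s), (\sum_s c s * q5 s), (\sum_s c s * q6 s) => mu nu p i T.
rewrite cP; congr (_ * _); rewrite !mulr_suml -!big_split /=; apply: eq_bigr => s _.
by rewrite P6; ring.
Qed.

End LrlInvariants.

Section KInvariants.
Variables (R : realType) (m n : nat).
Variable ga : 'I_m -> 'I_m -> 'I_n -> 'I_n -> 'I_n -> 'I_n -> 'I_m -> 'I_m -> R.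
Hypothesis gaM : forall M : 'M[R]_m, M \in unitmx -> forall mu nu p i a b c e,
  \sum_z \sum_t ga mu nu p i a b z t * (M z c * M t e) =
  \sum_u \sum_w ga u w p i a b c e * M mu u * M nu w.
Hypothesis gaN : forall N : 'M[R]_n, N \in unitmx -> forall mu nu p i a b c e,
  \sum_x (\sum_z ga mu nu p x z b c e * N z a) * N x i =
  \sum_q N p q * \sum_y ga mu nu q i a y c e * N b y.

(** Two permutations of the base indices times two of the fibre indices; on the fibre side [T] is
    either passed through or traced. *)
Lemma gaK_invariant : exists u1 u2 u3 u4 : R, forall mu nu p i T,
  \sum_a \sum_b \sum_c \sum_e ga mu nu p i a b c e * T a b c e =
  u1 * T p i mu nu + u2 * T p i nu mu +
    (i == p)%:R * (u3 * (\sum_b T b b mu nu) + u4 * (\sum_b T b b nu mu)).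
Proof.
pose F (i : {ffun 'I_2 -> 'I_m}) (p : {ffun 'I_2 -> 'I_n}) (j : {ffun 'I_2 -> 'I_m})
  (q : {ffun 'I_2 -> 'I_n}) := ga (i o0) (i o1) (p o0) (q o1) (q o0) (p o1) (j o0) (j o1).
have [c cE] : exists c : 'S_2 -> 'S_2 -> R, forall i p j q,
    F i p j q = \sum_s \sum_t c s t * tperm_mx R s i j * tperm_mx R t p q.
  apply: invariant_tensor2 => [M uM p q|N uN i j].
    apply: tcomm2 => mu nu a b; rewrite /F !mkE.
    under eq_bigr do under eq_bigr do rewrite !mkE.
    rewrite gaM //; apply: eq_bigr => u _; apply: eq_bigr => w _.
    by rewrite !mkE; ring.
  apply: tcomm2 => p b a i'; rewrite /F !mkE.
  transitivity (\sum_x (\sum_z ga (i o0) (i o1) p x z b (j o0) (j o1) * N z a) * N x i').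
    under [RHS]eq_bigr do rewrite mulr_suml.
    rewrite [RHS]exchange_big; apply: eq_bigr => z _; apply: eq_bigr => x _.
    by rewrite !mkE; ring.
  rewrite gaN //; apply: eq_bigr => q _; rewrite mulr_sumr; apply: eq_bigr => y _.
  by rewrite !mkE; ring.
have P (s t : 'S_2) : exists u1 u2 u3 u4 : R, forall mu nu p i (T : 'I_n -> 'I_n -> 'I_m -> 'I_m -> R),
    \sum_b (i == mk2 p b (t o1))%:R * T (mk2 p b (t o0)) b (mk2 mu nu (s o0)) (mk2 mu nu (s o1)) =
    u1 * T p i mu nu + u2 * T p i nu mu +
    (i == p)%:R * (u3 * (\sum_b T b b mu nu) + u4 * (\sum_b T b b nu mu)).
  move: t; apply: (perm2_ind (Q := fun f g => exists u1 u2 u3 u4 : R,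
    forall mu nu p i (T : 'I_n -> 'I_n -> 'I_m -> 'I_m -> R),
    \sum_b (i == mk2 p b g)%:R * T (mk2 p b f) b (mk2 mu nu (s o0)) (mk2 mu nu (s o1)) =
    u1 * T p i mu nu + u2 * T p i nu mu +
    (i == p)%:R * (u3 * (\sum_b T b b mu nu) + u4 * (\sum_b T b b nu mu)))).
    move: s; apply: (perm2_ind (Q := fun a e => exists u1 u2 u3 u4 : R,
      forall mu nu p i (T : 'I_n -> 'I_n -> 'I_m -> 'I_m -> R),
      \sum_b (i == mk2 p b o1)%:R * T (mk2 p b o0) b (mk2 mu nu a) (mk2 mu nu e) =
      u1 * T p i mu nu + u2 * T p i nu mu +
      (i == p)%:R * (u3 * (\sum_b T b b mu nu) + u4 * (\sum_b T b b nu mu)))).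
      exists 1, 0, 0, 0 => mu nu p i T; under eq_bigr do rewrite !mkE eq_sym.
      by rewrite pick1; ring.
    exists 0, 1, 0, 0 => mu nu p i T; under eq_bigr do rewrite !mkE eq_sym.
    by rewrite pick1; ring.
  move: s; apply: (perm2_ind (Q := fun a e => exists u1 u2 u3 u4 : R,
      forall mu nu p i (T : 'I_n -> 'I_n -> 'I_m -> 'I_m -> R),
      \sum_b (i == mk2 p b o0)%:R * T (mk2 p b o1) b (mk2 mu nu a) (mk2 mu nu e) =
      u1 * T p i mu nu + u2 * T p i nu mu +
      (i == p)%:R * (u3 * (\sum_b T b b mu nu) + u4 * (\sum_b T b b nu mu)))).
    exists 0, 0, 1, 0 => mu nu p i T; under eq_bigr do rewrite !mkE.
    by rewrite -mulr_sumr; ring.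
  exists 0, 0, 0, 1 => mu nu p i T; under eq_bigr do rewrite !mkE.
  by rewrite -mulr_sumr; ring.
have PP (st : 'S_2 * 'S_2) := P st.1 st.2.
have [u1 P1] := choice PP; have [u2 P2] := choice P1; have [u3 P3] := choice P2.
have [u4 P4] := choice P3.
pose cc (st : 'S_2 * 'S_2) := c st.1 st.2.
exists (\sum_st cc st * u1 st), (\sum_st cc st * u2 st), (\sum_st cc st * u3 st),
  (\sum_st cc st * u4 st) => mu nu p i T.
transitivity (\sum_st cc st * \sum_b (i == mk2 p b (st.2 o1))%:R *
    T (mk2 p b (st.2 o0)) b (mk2 mu nu (st.1 o0)) (mk2 mu nu (st.1 o1))); last first.
  rewrite !mulr_suml -!big_split /= mulr_sumr -big_split /=; apply: eq_bigr => st _.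
  by rewrite P4; ring.
rewrite exchange_big /=; under [RHS]eq_bigr do rewrite mulr_sumr.
rewrite [RHS]exchange_big; apply: eq_bigr => b _ /=.
transitivity (\sum_a \sum_x \sum_y (\sum_st (cc st * (i == mk2 p b (st.2 o1))%:R) *
    ((x == mk2 mu nu (st.1 o0))%:R * ((y == mk2 mu nu (st.1 o1))%:R * (a == mk2 p b (st.2 o0))%:R))) *
    T a b x y).
  apply: eq_bigr => a _; apply: eq_bigr => x _; apply: eq_bigr => y _; congr (_ * _).
  have -> : ga mu nu p i a b x y = F (mk2 mu nu) (mk2 p b) (mk2 x y) (mk2 a i) by rewrite /F !mkE.
  rewrite cE pair_bigA; apply: eq_bigr => -[s t] _ /=.
  by rewrite !tperm_mx2 /cc /=; ring.
under [LHS]eq_bigr => a _ do rewrite (pick2 (fun st : 'S_2 * 'S_2 => cc st * (i == mk2 p b (st.2 o1))%:R)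
  (fun st : 'S_2 * 'S_2 => (a == mk2 p b (st.2 o0))%:R) (fun st : 'S_2 * 'S_2 => mk2 mu nu (st.1 o0))
  (fun st : 'S_2 * 'S_2 => mk2 mu nu (st.1 o1)) (fun x y => T a b x y)).
rewrite exchange_big; apply: eq_bigr => st _ /=.
rewrite mulrA -(pick1 (mk2 p b (st.2 o0)) (fun a => cc st * (i == mk2 p b (st.2 o1))%:R *
   T a b (mk2 mu nu (st.1 o0)) (mk2 mu nu (st.1 o1)))).
by apply: eq_bigr => a _; ring.
Qed.

End KInvariants.

Section Quadratic.
Variables (R : realType) (m n : nat).

Lemma sum_symmetrize (I : finType) (F G : I -> I -> R) :
  (forall a b, F a b + F b a = G a b + G b a) ->
  \sum_a \sum_b F a b = \sum_a \sum_b G a b.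
Proof.
move=> H; have S (K : I -> I -> R) : \sum_a \sum_b K a b =
    2^-1 * \sum_a \sum_b (K a b + K b a).
  under [in RHS]eq_bigr do rewrite big_split /=.
  rewrite big_split /= [X in _ + X]exchange_big /= -mulr2n -[X in _ = _ * X]mulr_natl mulrA.
  by rewrite mulVf ?mul1r // pnatr_eq0.
by rewrite S [RHS]S; congr (_ * _); apply: eq_bigr => a _; apply: eq_bigr => b _.
Qed.

Definition quad1 (T : 'I_m -> 'I_m -> 'I_m -> R) mu nu :=
  \sum_rho \sum_si T rho rho mu * T si si nu.
Definition quad2 (T : 'I_m -> 'I_m -> 'I_m -> R) mu nu :=
  \sum_rho \sum_si T si rho mu * T rho si nu.
Definition quad3 (T : 'I_m -> 'I_m -> 'I_m -> R) mu nu :=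
  \sum_rho \sum_si T rho rho si * T mu si nu.

(** Contractions may agree only after renaming the summed indices. Comparing summands symmetrized in
    [b] and [e] reduces the question to a polynomial identity. *)
Lemma quad_symmetrize (F : 'I_m -> 'I_m -> R) x1 x2 x3 T mu nu :
  (forall b e, F b e + F e b =
    x1 * (T b b mu * T e e nu + T e e mu * T b b nu) +
    x2 * (T e b mu * T b e nu + T b e mu * T e b nu) +
    x3 * (T b b e * T mu e nu + T e e b * T mu b nu)) ->
  \sum_b \sum_e F b e = x1 * quad1 T mu nu + x2 * quad2 T mu nu + x3 * quad3 T mu nu.
Proof.
move=> H; rewrite /quad1 /quad2 /quad3 !mulr_sumr -!big_split /=.
under [RHS]eq_bigr => b _ do rewrite !mulr_sumr -!big_split /=.
by apply: sum_symmetrize => b e; rewrite H; ring.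
Qed.

(** Orients the antisymmetric pairs of indices in one way, after which [ring] can compare
    monomials. *)
Local Ltac antisym_normalize aT mu nu b e :=
  rewrite ?(aT nu b mu) ?(aT nu e mu) ?(aT mu b b) ?(aT mu b e) ?(aT mu e b) ?(aT mu e e)
    ?(aT nu b b) ?(aT nu b e) ?(aT nu e b) ?(aT nu e e) ?(aT e b b) ?(aT b e e).

(* Up to sign, every total contraction of T (x) T with two free lower indices is
   one of [quad1], [quad2], [quad3]. *)
Lemma quad_permutation (s : 'S_4) : exists x1 x2 x3 : R,
  forall T : 'I_m -> 'I_m -> 'I_m -> R, antisym T -> forall mu nu,
  \sum_b \sum_e T (mk4 mu nu b e (s o0)) b (mk4 mu nu b e (s o1)) *
                T (mk4 mu nu b e (s o2)) e (mk4 mu nu b e (s o3)) =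
  x1 * quad1 T mu nu + x2 * quad2 T mu nu + x3 * quad3 T mu nu.
Proof.
apply: (perm4_ind (Q := fun f g h k => exists x1 x2 x3 : R,
  forall T : 'I_m -> 'I_m -> 'I_m -> R, antisym T -> forall mu nu,
  \sum_b \sum_e T (mk4 mu nu b e f) b (mk4 mu nu b e g) *
                T (mk4 mu nu b e h) e (mk4 mu nu b e k) =
  x1 * quad1 T mu nu + x2 * quad2 T mu nu + x3 * quad3 T mu nu)) => f g h k.
have := ord4_in f; have := ord4_in g; have := ord4_in h; have := ord4_in k.
rewrite !inE.
move=> /or4P[] /eqP -> /or4P[] /eqP -> /or4P[] /eqP -> /or4P[] /eqP -> //= _.
all: first
  [ exists 1, 0, 0 => T aT mu nu; apply: quad_symmetrize => b e; rewrite !mkE;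
    antisym_normalize aT mu nu b e; ring
  | exists (-1), 0, 0 => T aT mu nu; apply: quad_symmetrize => b e; rewrite !mkE;
    antisym_normalize aT mu nu b e; ring
  | exists 0, 1, 0 => T aT mu nu; apply: quad_symmetrize => b e; rewrite !mkE;
    antisym_normalize aT mu nu b e; ring
  | exists 0, (-1), 0 => T aT mu nu; apply: quad_symmetrize => b e; rewrite !mkE;
    antisym_normalize aT mu nu b e; ring
  | exists 0, 0, 1 => T aT mu nu; apply: quad_symmetrize => b e; rewrite !mkE;
    antisym_normalize aT mu nu b e; ring
  | exists 0, 0, (-1) => T aT mu nu; apply: quad_symmetrize => b e; rewrite !mkE;
    antisym_normalize aT mu nu b e; ring ].
Qed.

Variable f : 'I_m -> 'I_m -> 'I_n -> 'I_n ->
  'I_m -> 'I_m -> 'I_m -> 'I_m -> 'I_m -> 'I_m -> R.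
Hypothesis fM : forall M : 'M[R]_m, M \in unitmx -> forall mu nu p i a b c a' b' c',
  \sum_x \sum_z \sum_x' \sum_z' f mu nu p i x b z x' b' z' *
    (M x a * (M z c * (M x' a' * M z' c'))) =
  \sum_u \sum_w (\sum_y \sum_y' f u w p i a y c a' y' c' * (M b y * M b' y')) * M mu u * M nu w.
Hypothesis fN : forall N : 'M[R]_n, N \in unitmx -> forall mu nu p i a b c a' b' c',
  \sum_x f mu nu p x a b c a' b' c' * N x i = \sum_q N p q * f mu nu q i a b c a' b' c'.

Lemma quad_invariant : exists x1 x2 x3 : R, forall T, antisym T -> forall mu nu p i,
  \sum_a \sum_b \sum_c \sum_a' \sum_b' \sum_c'
    f mu nu p i a b c a' b' c' * (T a b c * T a' b' c') =
  (i == p)%:R * (x1 * quad1 T mu nu + x2 * quad2 T mu nu + x3 * quad3 T mu nu).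
Proof.
pose F (i : {ffun 'I_4 -> 'I_m}) (p : {ffun 'I_1 -> 'I_n}) (j : {ffun 'I_4 -> 'I_m})
  (q : {ffun 'I_1 -> 'I_n}) :=
  f (i o0) (i o1) (p o0) (q o0) (j o0) (i o2) (j o1) (j o2) (i o3) (j o3).
have [c cE] : exists c : 'S_4 -> 'S_1 -> R, forall i p j q,
    F i p j q = \sum_s \sum_t c s t * tperm_mx R s i j * tperm_mx R t p q.
  apply: invariant_tensor2 => [M uM p q|N uN i j].
    apply: tcomm4 => mu nu b b' a e a' e'; rewrite /F !mkE.
    under eq_bigr do under eq_bigr do under eq_bigr do under eq_bigr do rewrite !mkE.
    rewrite fM //; apply: eq_bigr => u _; apply: eq_bigr => w _.
    rewrite !mulr_suml; apply: eq_bigr => y _; rewrite !mulr_suml; apply: eq_bigr => y' _.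
    by rewrite !mkE; ring.
  apply: tcomm1 => k i'; rewrite /F !mkE.
  under eq_bigr do rewrite !mkE.
  by rewrite fN //; apply: eq_bigr => q _; rewrite !mkE.
have [x1 P1] := choice quad_permutation; have [x2 P2] := choice P1.
have [x3 P3] := choice P2.
exists (\sum_s c s 1%g * x1 s), (\sum_s c s 1%g * x2 s), (\sum_s c s 1%g * x3 s) => T aT mu nu p i.
transitivity ((i == p)%:R * \sum_(s : 'S_4) c s 1%g *
    \sum_b \sum_e T (mk4 mu nu b e (s o0)) b (mk4 mu nu b e (s o1)) *
                T (mk4 mu nu b e (s o2)) e (mk4 mu nu b e (s o3))); last first.
  congr (_ * _); rewrite !mulr_suml -!big_split /=; apply: eq_bigr => s _.
  by rewrite P3 //; ring.
have fE a b e a' b' e' : f mu nu p i a b e a' b' e' =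
    (i == p)%:R * \sum_s c s 1%g * ((a == mk4 mu nu b b' (s o0))%:R *
      ((e == mk4 mu nu b b' (s o1))%:R * ((a' == mk4 mu nu b b' (s o2))%:R *
       (e' == mk4 mu nu b b' (s o3))%:R))).
  have -> : f mu nu p i a b e a' b' e' = F (mk4 mu nu b b') (mk1 p) (mk4 a e a' e') (mk1 i).
    by rewrite /F !mkE.
  rewrite cE mulr_sumr; apply: eq_bigr => s _; rewrite (big_pred1 1%g) => [|t]; last first.
    by rewrite (perm1_id t) /= eqxx.
  by rewrite tperm_mx4 tperm_mx1; ring.
rewrite exchange_big /=; under [X in _ = _ * X]eq_bigr do rewrite mulr_sumr.
rewrite [X in _ = _ * X]exchange_big mulr_sumr; apply: eq_bigr => b _ /=.
under [X in _ = _ * X]eq_bigr do rewrite mulr_sumr.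
rewrite [X in _ = _ * X]exchange_big mulr_sumr /=.
transitivity (\sum_b' \sum_a \sum_e \sum_a' \sum_e'
    f mu nu p i a b e a' b' e' * (T a b e * T a' b' e')).
  rewrite [RHS]exchange_big; apply: eq_bigr => a _.
  rewrite [RHS]exchange_big; apply: eq_bigr => e _.
  by rewrite [RHS]exchange_big; apply: eq_bigr.
apply: eq_bigr => b' _.
rewrite -(pick4 (fun s : 'S_4 => c s 1%g) (fun s : 'S_4 => mk4 mu nu b b' (s o0))
  (fun s : 'S_4 => mk4 mu nu b b' (s o1)) (fun s : 'S_4 => mk4 mu nu b b' (s o2))
  (fun s : 'S_4 => mk4 mu nu b b' (s o3)) (fun a e a' e' => T a b e * T a' b' e')).
rewrite mulr_sumr; apply: eq_bigr => a _; rewrite mulr_sumr; apply: eq_bigr => e _.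
rewrite mulr_sumr; apply: eq_bigr => a' _; rewrite mulr_sumr; apply: eq_bigr => e' _.
by rewrite fE; ring.
Qed.

End Quadratic.

Section Bilinear.
Variables (R : realType) (V : finType).

Definition bil (f : V -> V -> R) (l l' : V -> R) := \sum_v (\sum_w f v w * l' w) * l v.

Lemma bil_polar f l l' : (forall v w, f v w = f w v) ->
  bil f (fun v => l v + l' v) (fun v => l v + l' v) =
  bil f l l + bil f l' l' + (bil f l l' + bil f l l').
Proof.
move=> sf; have E : bil f l' l = bil f l l'.
  rewrite /bil; under eq_bigr do rewrite mulr_suml.
  rewrite exchange_big; apply: eq_bigr => v _; rewrite mulr_suml.
  by apply: eq_bigr => w _; rewrite sf; ring.
rewrite -{1}E.
rewrite /bil -!big_split; apply: eq_bigr => v _ /=.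
have -> : \sum_w f v w * (l w + l' w) = \sum_w f v w * l w + \sum_w f v w * l' w.
  by rewrite -big_split; apply: eq_bigr => w _; rewrite mulrDr.
ring.
Qed.

End Bilinear.

Section LrlCoefficients.
Variables (R : realType) (m n s r : nat) (Dt : conn_rule R m n).
Hypothesis Dt_natural : natural Dt.
Hypothesis Dt_order : of_order s r Dt.

Local Notation D := (D0 Dt).
Local Notation z3 := (fun _ _ _ => 0).
Local Notation z4 := (fun _ _ _ _ => 0).
Local Notation V := ('I_m * 'I_m * 'I_m)%type.

Local Arguments jet0 : simpl never.

Lemma related_add (M : 'M[R]_m) P Q P' Q' : related M M P Q -> related M M P' Q' ->
  related M M (fun a b c => P a b c + P' a b c) (fun a b c => Q a b c + Q' a b c).
Proof.
move=> rP rQ j i' l; under eq_bigr do rewrite mulrDl.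
rewrite big_split /= rP rQ -big_split; apply: eq_bigr => j' _ /=.
by rewrite -big_split; apply: eq_bigr => l' _ /=; ring.
Qed.

Definition ev (l : 'I_m -> 'I_m -> 'I_m -> R) (v : V) := l v.1.1 v.1.2 v.2.

Lemma coef_lrl : exists (f : 'I_m -> 'I_m -> 'I_n -> 'I_n -> V -> V -> R)
    (g1 : 'I_m -> 'I_m -> 'I_n -> 'I_n -> 'I_m -> 'I_m -> 'I_m -> 'I_m -> R)
    (g2 : 'I_m -> 'I_m -> 'I_n -> 'I_n -> 'I_n -> 'I_n -> 'I_m -> 'I_m -> R),
  (forall mu nu p i v w, f mu nu p i v w = f mu nu p i w v) /\
  forall mu i nu l0 l1 k1 y,
  D l0 l1 z3 k1 (row_mx 0 y) (lshift n mu) (rshift m i) (lshift n nu) =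
  \sum_p y 0 p * (bil (f mu nu p i) (ev l0) (ev l0) +
    \sum_a \sum_b \sum_c \sum_e g1 mu nu p i a b c e * l1 a b c e +
    \sum_a \sum_b \sum_c \sum_e g2 mu nu p i a b c e * k1 a b c e).
Proof.
have H (t : 'I_m * 'I_n * 'I_m) :=
  degree_lrl Dt_natural Dt_order (@openT _) I (fun _ _ _ _ => I) t.1.1 t.1.2 t.2.
have [be {}H] := choice H; have [ga {}H] := choice H.
(* Only the symmetric part of the quadratic coefficients is determined by the rule, and polarization
   needs this symmetry. *)
exists (fun mu nu p i v w => 2^-1 * (be (mu, i, nu) p (inl v) (inl w) + be (mu, i, nu) p (inl w) (inl v))).
exists (fun mu nu p i a b c e => ga (mu, i, nu) p (inl (a, b, c, e))).
exists (fun mu nu p i a b c e => ga (mu, i, nu) p (inr (a, b, c, e))).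
split=> [mu nu p i v w|mu i nu l0 l1 k1 y]; first by rewrite addrC.
rewrite /D0 (H (mu, i, nu)) /=; apply: eq_bigr => p _; congr (_ * _); rewrite -addrA.
congr (_ + _); last first.
  rewrite big_sumType /= !sum_quad; congr (_ + _); apply: eq_bigr => a _; apply: eq_bigr => b _;
    by apply: eq_bigr => c _; apply: eq_bigr => e _; rewrite partial_aff.
have evE v : jet0 (aff l0 l1) (aff z3 k1) (inl v) = ev l0 v.
  by case: v => -[a b] c; exact: aff_at0.
have ev0 v : jet0 (aff l0 l1) (aff z3 k1) (inr v) = 0.
  by case: v => -[a b] c; exact: aff_at0.
rewrite big_sumType /= [X in _ + X]big1 ?addr0 => [|w _]; last first.
  by rewrite big1 // => v _; rewrite ev0 mulr0.
transitivity (\sum_v \sum_w be (mu, i, nu) p (inl v) (inl w) * ev l0 w * ev l0 v).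
  apply: eq_bigr => v _; rewrite big_sumType /= [X in _ + X]big1 ?addr0 => [|w _]; last first.
    by rewrite ev0 mulr0 mul0r.
  by apply: eq_bigr => w _; rewrite !evE.
rewrite /bil; under [RHS]eq_bigr do rewrite mulr_suml.
by apply: sum_symmetrize => v w; field.
Qed.

Section Laws.
Variables (f : 'I_m -> 'I_m -> 'I_n -> 'I_n -> V -> V -> R).
Variables (g1 : 'I_m -> 'I_m -> 'I_n -> 'I_n -> 'I_m -> 'I_m -> 'I_m -> 'I_m -> R).
Variables (g2 : 'I_m -> 'I_m -> 'I_n -> 'I_n -> 'I_n -> 'I_n -> 'I_m -> 'I_m -> R).
Let S1 mu nu p i l1 := \sum_a \sum_b \sum_c \sum_e g1 mu nu p i a b c e * l1 a b c e.
Let S2 mu nu p i k1 := \sum_a \sum_b \sum_c \sum_e g2 mu nu p i a b c e * k1 a b c e.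
Hypothesis f_sym : forall mu nu p i v w, f mu nu p i v w = f mu nu p i w v.
Hypothesis DE : forall mu i nu l0 l1 k1 y,
  D l0 l1 z3 k1 (row_mx 0 y) (lshift n mu) (rshift m i) (lshift n nu) =
  \sum_p y 0 p * (bil (f mu nu p i) (ev l0) (ev l0) + S1 mu nu p i l1 + S2 mu nu p i k1).

Let G mu nu p i l0 l1 k1 := bil (f mu nu p i) (ev l0) (ev l0) + S1 mu nu p i l1 + S2 mu nu p i k1.

(** The basis vectors of the fibre isolate the coefficient of each [y^p]. *)
Let DG mu i nu l0 l1 k1 p :
  D l0 l1 z3 k1 (row_mx 0 (delta_mx 0 p)) (lshift n mu) (rshift m i) (lshift n nu) =
  G mu nu p i l0 l1 k1.
Proof.
rewrite DE -(sum_delta (fun p => G mu nu p i l0 l1 k1)); apply: eq_bigr => q _.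
by rewrite mxE eqxx mulrC eq_sym.
Qed.

Let lawM (M : 'M[R]_m) l0 l0' l1 l1' k1 k1' : M \in unitmx ->
  related M M l0 l0' -> related_deriv M M l1 l1' -> related_deriv M (1%:M : 'M[R]_n) k1 k1' ->
  forall mu nu p i, G mu nu p i l0 l1 k1 =
    \sum_u \sum_w G u w p i l0' l1' k1' * M mu u * M nu w.
Proof.
move=> uM r0 r1 rk mu nu p i.
have := equiv_lrl Dt_natural uM (unitmx1 R n) r0 r1 (related_zero M 1%:M) rk
  (delta_mx 0 p) mu i nu.
rewrite mulmx1; under eq_bigr do rewrite DG mxE.
rewrite sum_delta' => ->; apply: eq_bigr => u _; apply: eq_bigr => w _.
by rewrite DG.
Qed.

Let lawN (N : 'M[R]_n) l0 l1 k1 k1' : N \in unitmx ->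
  related_deriv (1%:M : 'M[R]_m) N k1 k1' ->
  forall mu nu p i, \sum_x G mu nu p x l0 l1 k1 * N x i =
    \sum_q N p q * G mu nu q i l0 l1 k1'.
Proof.
move=> uN rk mu nu p i.
have rl1 : related_deriv (1%:M : 'M[R]_m) 1%:M l1 l1.
  move=> si; apply/related1 => a b c; under eq_bigr do rewrite mxE.
  by rewrite sum_delta.
have := equiv_lrl Dt_natural (unitmx1 R m) uN (related_refl l0) rl1 (related_zero 1%:M N) rk
  (delta_mx 0 p) mu i nu.
under eq_bigr do rewrite DG.
move=> ->; rewrite -rowE.
rewrite -(sum_delta (fun u => \sum_q N p q * G u nu q i l0 l1 k1')); apply: eq_bigr => u _.
rewrite -(sum_delta (fun w => (\sum_q N p q * G u w q i l0 l1 k1') * (mu == u)%:R)).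
apply: eq_bigr => w _; rewrite !mxE DE; congr (_ * _ * _).
by apply: eq_bigr => q _; rewrite mxE.
Qed.

(** Zero derivatives isolate the quadratic part. Below, zero values together with one vanishing
    family of derivatives isolate each of the two linear parts, so the equivariance of [G] passes to
    all three. *)
Let zG mu nu p i l0 : G mu nu p i l0 z4 z4 = bil (f mu nu p i) (ev l0) (ev l0).
Proof.
by rewrite /G /S1 /S2 [X in _ + X + _]big1 ?[X in _ + X]big1 ?addr0 // => a _;
  rewrite big1 // => b _; rewrite big1 // => c _; rewrite big1 // => e _; rewrite mulr0.
Qed.

Let zbil (h : V -> V -> R) : bil h (ev z3) (ev z3) = 0.
Proof. by rewrite /bil big1 // => v _; rewrite mulr0. Qed.

Let zG1 mu nu p i l1 : G mu nu p i z3 l1 z4 = S1 mu nu p i l1.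
Proof.
rewrite /G zbil add0r /S2 [X in _ + X]big1 ?addr0 // => a _.
by rewrite big1 // => b _; rewrite big1 // => c _; rewrite big1 // => e _; rewrite mulr0.
Qed.

Let zG2 mu nu p i k1 : G mu nu p i z3 z4 k1 = S2 mu nu p i k1.
Proof.
rewrite /G zbil add0r /S1 [X in X + _]big1 ?add0r // => a _.
by rewrite big1 // => b _; rewrite big1 // => c _; rewrite big1 // => e _; rewrite mulr0.
Qed.

Let two_inj (x y : R) : x + x = y + y -> x = y.
Proof. by lra. Qed.

(** Equivariance is known on the diagonal only. Applying it to a sum and cancelling the diagonal
    terms yields it for the symmetric bilinear form, which can be tested on pairs of basis
    tensors. *)
Let polarM (M : 'M[R]_m) P P' Q Q' : M \in unitmx -> related M M P Q -> related M M P' Q' ->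
  forall mu nu p i, bil (f mu nu p i) (ev P) (ev P') =
    \sum_u \sum_w bil (f u w p i) (ev Q) (ev Q') * M mu u * M nu w.
Proof.
move=> uM rP rP' mu nu p i.
have L X Y : related M M X Y -> bil (f mu nu p i) (ev X) (ev X) =
    \sum_u \sum_w bil (f u w p i) (ev Y) (ev Y) * M mu u * M nu w.
  move=> rX; rewrite -!zG (lawM uM rX (related_deriv_zero M M) (related_deriv_zero M 1%:M)).
  by apply: eq_bigr => u _; apply: eq_bigr => w _; rewrite zG.
have := L _ _ (related_add rP rP').
rewrite [LHS](bil_polar (ev P) (ev P') (f_sym mu nu p i)) (L _ _ rP) (L _ _ rP').
under [RHS]eq_bigr do under eq_bigr do
  rewrite [X in X * _ * _](bil_polar (ev Q) (ev Q') (f_sym _ _ _ _)) !mulrDl.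
under [RHS]eq_bigr do rewrite !big_split /=.
by rewrite !big_split /= => /addrI E; apply: two_inj.
Qed.

Let polarN (N : 'M[R]_n) P P' : N \in unitmx ->
  forall mu nu p i, \sum_x bil (f mu nu p x) (ev P) (ev P') * N x i =
    \sum_q N p q * bil (f mu nu q i) (ev P) (ev P').
Proof.
move=> uN mu nu p i.
have L X : \sum_x bil (f mu nu p x) (ev X) (ev X) * N x i =
    \sum_q N p q * bil (f mu nu q i) (ev X) (ev X).
  have := lawN X z4 uN (related_deriv_zero 1%:M N) mu nu p i.
  by under eq_bigr do rewrite zG; under [in RHS]eq_bigr do rewrite zG.
have := L (fun a b c => P a b c + P' a b c).
under eq_bigr do rewrite [X in X * _](bil_polar (ev P) (ev P') (f_sym _ _ _ _)) !mulrDl.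
under [X in _ = X -> _]eq_bigr do
  rewrite [X in _ * X](bil_polar (ev P) (ev P') (f_sym _ _ _ _)) !mulrDr.
rewrite !big_split /= !L => /addrI E; exact: two_inj.
Qed.

Let bil_triple (h : V -> V -> R) l l' : bil h (ev l) (ev l') =
  \sum_a \sum_b \sum_c (\sum_a' \sum_b' \sum_c' h (a, b, c) (a', b', c') * l' a' b' c') * l a b c.
Proof.
rewrite /bil sum_triple; apply: eq_bigr => a _; apply: eq_bigr => b _; apply: eq_bigr => c _.
by rewrite sum_triple.
Qed.

Let bil_basis (h : V -> V -> R) a b c a' b' c' :
  bil h (ev (push_basis 1%:M a b c)) (ev (push_basis 1%:M a' b' c')) = h (a, b, c) (a', b', c').
Proof.
rewrite bil_triple.
rewrite (sum_push _ (fun a b c => \sum_x \sum_y \sum_z h (a, b, c) (x, y, z) * _ x y z)).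
rewrite (sum_push_id (fun a b c => \sum_x \sum_y \sum_z h (a, b, c) (x, y, z) * _ x y z)).
rewrite (sum_push _ (fun x y z => h (a, b, c) (x, y, z))).
exact: (sum_push_id (fun x y z => h (a, b, c) (x, y, z))).
Qed.

Lemma quad_law : exists x1 x2 x3 : R, forall T, antisym T -> forall mu nu p i,
  bil (f mu nu p i) (ev T) (ev T) =
  (i == p)%:R * (x1 * quad1 T mu nu + x2 * quad2 T mu nu + x3 * quad3 T mu nu).
Proof.
have [||x1 [x2 [x3 H]]] := @quad_invariant R m n
  (fun mu nu p i a b c a' b' c' => f mu nu p i (a, b, c) (a', b', c')); last first.
- exists x1, x2, x3 => T aT mu nu p i; rewrite -H // bil_triple.
  apply: eq_bigr => a _; apply: eq_bigr => b _; apply: eq_bigr => c _.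
  rewrite mulr_suml; apply: eq_bigr => a' _; rewrite mulr_suml; apply: eq_bigr => b' _.
  by rewrite mulr_suml; apply: eq_bigr => c' _; ring.
- move=> N uN mu nu p i a b c a' b' c'.
  have := polarN (push_basis 1%:M a b c) (push_basis 1%:M a' b' c') uN mu nu p i.
  by under eq_bigr do rewrite bil_basis; under [X in _ = X -> _]eq_bigr do rewrite bil_basis.
- move=> M uM mu nu p i a b c a' b' c'.
  have := polarM uM (related_basis M M a b c) (related_basis M M a' b' c') mu nu p i.
  rewrite bil_triple sum_pull.
  under eq_bigr do under eq_bigr do rewrite sum_pull mulr_suml.
  under [X in _ = X -> _]eq_bigr do under eq_bigr do rewrite bil_triple sum_push.
  move=> E; transitivity (\sum_x \sum_z \sum_x' (\sum_z' f mu nu p i (x, b, z) (x', b', z') *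
      (M x' a' * M z' c')) * (M x a * M z c)).
    apply: eq_bigr => x _; apply: eq_bigr => z _; apply: eq_bigr => x' _.
    by rewrite mulr_suml; apply: eq_bigr => z' _; ring.
  rewrite E; apply: eq_bigr => u _; apply: eq_bigr => w _; congr (_ * _ * _).
  apply: eq_bigr => y _; rewrite sum_push mulr_suml.
  by apply: eq_bigr => y' _; ring.
Qed.

Lemma base_deriv_law : exists q1 q2 q3 q4 q5 q6 : R, forall mu nu p i l1,
  S1 mu nu p i l1 =
  (i == p)%:R * (q1 * (\sum_b l1 mu b nu b) + q2 * (\sum_b l1 mu b b nu) +
    q3 * (\sum_b l1 nu b mu b) + q4 * (\sum_b l1 nu b b mu) +
    q5 * (\sum_b l1 b b mu nu) + q6 * (\sum_b l1 b b nu mu)).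
Proof.
apply: (@ga_invariant R m n g1) => [M uM mu nu p i a b c e|N uN mu nu p i a b c e].
  have := lawM uM (related_zero M M) (related_deriv_basis M M a b c e)
    (related_deriv_zero M 1%:M) mu nu p i.
  rewrite zG1 /S1 sum_pull1 => ->; apply: eq_bigr => u _; apply: eq_bigr => w _.
  by rewrite zG1 /S1 sum_push1.
have := lawN z3 (fun x y z t => push_basis 1%:M a b c x y z * (e == t)%:R) uN
  (related_deriv_zero 1%:M N) mu nu p i.
under eq_bigr do rewrite zG1 /S1 sum_push1.
under eq_bigr do rewrite (sum_push_id (fun a b c => g1 _ _ _ _ a b c e)).
move=> ->; apply: eq_bigr => q _; rewrite zG1 /S1 sum_push1.
by rewrite (sum_push_id (fun a b c => g1 _ _ _ _ a b c e)).
Qed.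

Lemma bundle_deriv_law : exists u1 u2 u3 u4 : R, forall mu nu p i k1,
  S2 mu nu p i k1 =
  u1 * k1 p i mu nu + u2 * k1 p i nu mu +
    (i == p)%:R * (u3 * (\sum_b k1 b b mu nu) + u4 * (\sum_b k1 b b nu mu)).
Proof.
apply: (@gaK_invariant R m n g2) => [M uM mu nu p i a b c e|N uN mu nu p i a b c e].
  have := lawM uM (related_zero M M) (related_deriv_zero M M)
    (related_deriv_basis M 1%:M a b c e) mu nu p i.
  rewrite zG2 /S2 sum_pull1 => E; transitivity (\sum_x \sum_z \sum_t
      g2 mu nu p i x b z t * ((1%:M : 'M[R]_n) x a * (M z c * M t e))).
    rewrite -(pick1 a (fun x => \sum_z \sum_t g2 mu nu p i x b z t * (M z c * M t e))).
    apply: eq_bigr => x _; rewrite mulr_sumr; apply: eq_bigr => z _; rewrite mulr_sumr.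
    by apply: eq_bigr => t _; rewrite mxE; ring.
  rewrite E; apply: eq_bigr => u _; apply: eq_bigr => w _; rewrite zG2 /S2 sum_push1.
  by rewrite (sum_push_id (fun a b c => g2 _ _ _ _ a b c e)).
have := lawN z3 z4 uN (related_deriv_basis 1%:M N a b c e) mu nu p i.
under eq_bigr do rewrite zG2 /S2 sum_pull1.
move=> E; transitivity (\sum_x (\sum_z \sum_v \sum_t g2 mu nu p x z b v t *
    (N z a * ((1%:M : 'M[R]_m) v c * (1%:M : 'M[R]_m) t e))) * N x i).
  apply: eq_bigr => x _; congr (_ * _); apply: eq_bigr => z _.
  rewrite -(pick1 c (fun v => g2 mu nu p x z b v e * N z a)); apply: eq_bigr => v _.
  rewrite -(pick1 e (fun t => g2 mu nu p x z b v t * N z a)) mulr_sumr.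
  by apply: eq_bigr => t _; rewrite !mxE; ring.
by rewrite E; apply: eq_bigr => q _; rewrite zG2 /S2 sum_push1.
Qed.

End Laws.

Lemma lrl_invariant : exists x1 x2 x3 q1 q2 q3 q4 q5 q6 u1 u2 u3 u4 : R,
  forall T, antisym T -> forall mu i nu l1 k1 y,
  D T l1 z3 k1 (row_mx 0 y) (lshift n mu) (rshift m i) (lshift n nu) =
  \sum_p y 0 p *
   ((i == p)%:R * (x1 * quad1 T mu nu + x2 * quad2 T mu nu + x3 * quad3 T mu nu) +
    (i == p)%:R * (q1 * (\sum_b l1 mu b nu b) + q2 * (\sum_b l1 mu b b nu) +
      q3 * (\sum_b l1 nu b mu b) + q4 * (\sum_b l1 nu b b mu) +
      q5 * (\sum_b l1 b b mu nu) + q6 * (\sum_b l1 b b nu mu)) +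
    (u1 * k1 p i mu nu + u2 * k1 p i nu mu +
    (i == p)%:R * (u3 * (\sum_b k1 b b mu nu) + u4 * (\sum_b k1 b b nu mu)))).
Proof.
have [f [g1 [g2 [sf DE]]]] := coef_lrl.
have [x1 [x2 [x3 Hf]]] := quad_law sf DE.
have [q1 [q2 [q3 [q4 [q5 [q6 H1]]]]]] := base_deriv_law DE.
have [u1 [u2 [u3 [u4 H2]]]] := bundle_deriv_law DE.
exists x1, x2, x3, q1, q2, q3, q4, q5, q6, u1, u2, u3, u4 => T aT mu i nu l1 k1 y.
by rewrite DE; apply: eq_bigr => p _; rewrite Hf // H1 H2.
Qed.

End LrlCoefficients.

(** * Nonlinear changes of coordinates *)

Section LocalDiffeomorphism.
Variables (R : realType) (m : nat).

Lemma derive_line (h : 'rV[R]_m -> R) y v (t : R) : differentiable h (y + t *: v) ->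
  is_derive t 1 (fun t : R => h (y + t *: v)) (\sum_k v 0 k * partial k h (y + t *: v)).
Proof.
move=> dh.
have E : (fun e : R => e^-1 *: (((fun t : R => h (y + t *: v)) \o shift t) (e *: 1) - h (y + t *: v))) =
    (fun e : R => e^-1 *: ((h \o shift (y + t *: v)) (e *: v) - h (y + t *: v))).
  by apply/funext => e /=; rewrite [e *: (1 : R)]mulr1 scalerDl addrCA.
have D : 'D_v h (y + t *: v) = \sum_k v 0 k * partial k h (y + t *: v).
  rewrite deriveE // [X in 'd h _ X]row_sum_delta linear_sum; apply: eq_bigr => k _.
  by rewrite linearZ /= /partial -deriveE.
split; first by rewrite /derivable E; exact: diff_derivable.
by rewrite -D /derive E.
Qed.

Lemma mean_value (h : 'rV[R]_m -> R) x y :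
  (forall z, differentiable h z) ->
  exists2 t : R, t \in `]0, 1[ &
    h x - h y = \sum_k (x - y) 0 k * partial k h (y + t *: (x - y)).
Proof.
move=> dh; pose phi (t : R) := h (y + t *: (x - y)).
have dphi (t : R) := derive_line (y := y) (v := x - y) (t := t) (dh _).
have [|t t01] := @MVT R phi _ 0 1 ltr01 (fun t _ => dphi t).
  apply: derivable_within_continuous => t _.
  by have [] := dphi t.
by rewrite /phi scale0r scale1r addr0 [y + _]addrC subrK subr0 mulr1 => E; exists t.
Qed.

(** Near 0 the partial derivatives of [f - id] are below [1/(2(m+1))]. If [f x = f y], the mean
    value theorem bounds the largest coordinate of [x - y] by half of itself, so it is zero. *)
Lemma locally_injective (f : 'rV[R]_m -> 'rV[R]_m) :
  (forall l, smooth_on setT (fun x => f x 0 l)) -> jac f 0 = 1%:M ->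
  exists W : set 'rV[R]_m, [/\ open W, W 0 & {in W &, injective f}].
Proof.
move=> sf J0; pose ep : R := (2 * m.+1%:R)^-1.
have ep0 : 0 < ep by rewrite invr_gt0 mulr_gt0.
have nr : \forall x \near (0 : 'rV[R]_m), forall p : 'I_m * 'I_m,
    `|partial p.1 (fun x => f x 0 p.2) x - (p.1 == p.2)%:R| < ep.
  apply: (filter_forall (I := ('I_m * 'I_m)%type) (F := nbhs (0 : 'rV[R]_m))) => -[k b] /=.
  have /differentiable_continuous c := smooth_diff (smooth_partial k (sf b)) (I : setT 0).
  have E : partial k (fun x => f x 0 b) 0 = (k == b)%:R by move/matrixP: J0 => /(_ k b); rewrite !mxE.
  have /cvgr_dist_lt := c; move=> /(_ ep ep0); rewrite E.
  by apply: filterS => x; rewrite distrC.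
have /nbhs_ballP[r /= r0 rP] := nr.
exists (ball (0 : 'rV[R]_m) r); split; [exact: ball_open | exact: ballxx |].
move=> x y /set_mem xe /set_mem ye fxy; apply/rowP => i; apply/eqP; rewrite -subr_eq0.
have [b _ bmax] := @arg_maxP _ _ _ i xpredT (fun b => `|(x - y) 0 b|) isT.
suff H : `|(x - y) 0 b| <= 0.
  by have := le_trans (bmax i isT) H; rewrite normr_le0 !mxE.
pose h z := f z 0 b - z 0 b.
have dh z : differentiable h z.
  apply: diffableD; first exact: (smooth_diff (sf b) (I : setT z)).
  by apply: diffableN; exact: diffable_coord.
have [t t01 hE] := mean_value x y dh.
have -> : (x - y) 0 b = - (h x - h y) by rewrite /h fxy !mxE; ring.
rewrite normrN hE; set z := y + _.
have ze : ball (0 : 'rV[R]_m) r z.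
  move: xe ye t01; rewrite -!ball_normE /= !sub0r !normrN in_itv /= => xe ye /andP[t0 t1].
  have -> : z = t *: x + (1 - t) *: y by rewrite /z scalerBr scalerBl scale1r addrCA.
  apply: (le_lt_trans (ler_normD _ _)); rewrite !normrZ gtr0_norm // gtr0_norm ?subr_gt0 //.
  have : t * `|x| < t * r by rewrite ltr_pM2l.
  have : (1 - t) * `|y| < (1 - t) * r by rewrite ltr_pM2l ?subr_gt0.
  lra.
have S : `|\sum_k (x - y) 0 k * partial k h z| <= m%:R * (ep * `|(x - y) 0 b|).
  apply: (le_trans (ler_norm_sum _ _ _)).
  rewrite mulr_natl -[X in _ *+ X](card_ord m) -sumr_const; apply: ler_sum => k _.
  rewrite normrM mulrC; apply: ler_pM => //; last exact: bmax.
  rewrite partialB; [|exact: (smooth_diff (sf b) (I : setT z))|exact: diffable_coord].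
  by rewrite partial_coord; apply: ltW; exact: (rP _ ze (k, b)).
have E : (x - y) 0 b = - (h x - h y) by rewrite /h fxy !mxE; ring.
move: S; rewrite -hE -[`|h x - h y|]normrN -E => S.
have : m%:R * ep <= 2^-1 :> R.
  rewrite /ep invfM mulrCA -[leRHS]mulr1 ler_wpM2l // ler_pdivrMr // mul1r ler_nat //.
have : 0 <= `|(x - y) 0 b| by [].
move: S; move: `|_| => w S w0 mw; have := ler_wpM2r w0 mw; lra.
Qed.

End LocalDiffeomorphism.

Section Pullback.
Variables (R : realType) (m k : nat).
Variables (V : set 'rV[R]_m) (oV : open V) (f : 'rV[R]_m -> 'rV[R]_m) (A : 'rV[R]_m -> 'M[R]_k).
Hypothesis sf : forall l, smooth_on V (fun x => f x 0 l).
Hypothesis sA : forall i j, smooth_on V (fun x => A x i j).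

(** The transformation law solved for the components at the source, by inverting [A]. *)
Definition pullback (G : coefs R m k) : coefs R m k := fun x j i l =>
  \sum_i' (\sum_j' \sum_l' G (f x) j' i' l' * A x j j' * jac f x l l'
           - partial l (fun z => A z j i') x) * invmx (A x) i' i.

Lemma pullback_transf G : (forall x, V x -> A x \in unitmx) ->
  transf V f (jac f) A (pullback G) G.
Proof.
move=> uA x Vx j i' l; under eq_bigr do rewrite mulr_suml.
rewrite exchange_big /=.
set F := fun i'' => \sum_j' \sum_l' G (f x) j' i'' l' * A x j j' * jac f x l l'
  - partial l (fun z => A z j i'') x.
rewrite -[RHS](sum_delta' F); apply: eq_bigr => i'' _; rewrite -/(F i'').
have := mulVmx (uA x Vx) => /matrixP/(_ i'' i'); rewrite !mxE => <-.
by rewrite mulr_sumr; apply: eq_bigr => i _; rewrite mulrA.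
Qed.

Lemma smooth_jac l l' : smooth_on V (fun x => jac f x l l').
Proof. by under eq_fun do rewrite mxE; exact: smooth_partial. Qed.

Lemma pullback_smooth (U : set 'rV[R]_m) G : smooth_coefs U G ->
  (forall x, V x -> U (f x)) -> (forall x, V x -> A x \in unitmx) ->
  smooth_coefs V (pullback G).
Proof.
move=> sG VU uA j i l; apply: smooth_sum => // i'; apply: smooth_mul => //; last exact: smooth_invmx.
apply: smooth_sub => //; last exact: smooth_partial.
apply: smooth_sum => // j'; apply: smooth_sum => // l'; apply: smooth_mul => //; last exact: smooth_jac.
by apply: smooth_mul => //; apply: (smooth_comp oV (sG j' i' l')).
Qed.

Section Jets.
Variables (U : set 'rV[R]_m) (G1 G2 : coefs R m k).
Hypothesis V0 : V 0.
Hypothesis VU : forall x, V x -> U (f x).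
Hypothesis J0 : jac f 0 = 1%:M.
Hypothesis A0 : A 0 = 1%:M.
Hypothesis s1 : smooth_coefs V G1.
Hypothesis s2 : smooth_coefs U G2.
Hypothesis H : transf V f (jac f) A G1 G2.

(* 1-jet at 0 of the pullback of [G], when [f] and [A] have the identity as
   linear part and value at 0. *)
Definition pull0 (f : 'rV[R]_m -> 'rV[R]_m) (A : 'rV[R]_m -> 'M[R]_k) (G : coefs R m k) j i l :=
  G (f 0) j i l - partial l (fun x => A x j i) 0.

Definition pull1 (f : 'rV[R]_m -> 'rV[R]_m) (A : 'rV[R]_m -> 'M[R]_k) (G : coefs R m k) j i l si :=
  partial si (fun x => G x j i l) (f 0)
  + \sum_j' G (f 0) j' i l * partial si (fun x => A x j j') 0
  + \sum_l' G (f 0) j i l' * partial si (partial l (fun x => f x 0 l')) 0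
  - partial si (partial l (fun x => A x j i)) 0
  - \sum_p pull0 f A G j p l * partial si (fun x => A x p i) 0.

Lemma jac0E l l' : jac f 0 l l' = (l == l')%:R.
Proof. by rewrite J0 mxE. Qed.

Lemma transf_jet0 j i l : G1 0 j i l = pull0 f A G2 j i l.
Proof.
have := H V0 j i l; rewrite /pull0 A0.
under eq_bigr do rewrite mxE; rewrite sum_delta' => ->; congr (_ - _).
rewrite -(sum_delta (fun j' => G2 (f 0) j' i l)); apply: eq_bigr => j' _.
rewrite -(sum_delta (fun l' => G2 (f 0) j' i l')) mulr_suml; apply: eq_bigr => l' _.
by rewrite jac0E mxE; ring.
Qed.

Let dG2 j i l si : partial si (fun x => G2 (f x) j i l) 0 = partial si (fun x => G2 x j i l) (f 0).
Proof.
rewrite (partial_comp (h := fun x => G2 x j i l) si (fun q => smooth_diff (sf q) V0)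
  (smooth_diff (s2 j i l) (VU V0))).
rewrite -[RHS](sum_delta (fun q => partial q (fun x => G2 x j i l) (f 0))).
by apply: eq_bigr => q _; rewrite -jac0E mxE.
Qed.

(** The law is differentiated at 0; the product rule on its left side produces the last sum of
    [pull1]. *)
Lemma transf_jet1 j i l si :
  partial si (fun x => G1 x j i l) 0 = pull1 f A G2 j i l si.
Proof.
have d1 j' i' l' := smooth_diff (s1 j' i' l') V0.
have dA i' j' := smooth_diff (sA i' j') V0.
have dJ l' l'' : differentiable (fun x => jac f x l' l'' : R) 0.
  exact: (smooth_diff (smooth_jac l' l'') V0).
have d2 j' i' l' : differentiable (fun x => G2 (f x) j' i' l' : R) 0.
  exact: (diffable_comp (h := fun x => G2 x j' i' l') (fun q => smooth_diff (sf q) V0)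
    (smooth_diff (s2 j' i' l') (VU V0))).
have E := eq_on_partial si oV V0 (fun x Vx => H Vx j i l).
move: E; rewrite partial_sum => [|q _]; last exact: diffableM.
under eq_bigr do rewrite partialM // A0 mxE.
rewrite big_split /= sum_delta'; under [in X in _ + X]eq_bigr do rewrite transf_jet0.
move/(canRL (addrK _)) => ->; rewrite /pull1; congr (_ - _).
have dS j' l' : differentiable (fun x => G2 (f x) j' i l' * A x j j' * jac f x l l' : R) 0.
  by apply: diffableM => //; exact: diffableM.
have dSS j' : differentiable (fun x => \sum_l' G2 (f x) j' i l' * A x j j' * jac f x l l' : R) 0.
  by apply: diffable_sum => l' _; exact: dS.
rewrite partialB; [|by apply: diffable_sum => j' _|exact: (smooth_diff (smooth_partial l (sA j i)) V0)].
congr (_ - _); rewrite partial_sum; last by move=> j' _; exact: dSS.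
transitivity (\sum_j' \sum_l' ((partial si (fun x => G2 x j' i l') (f 0) * (j == j')%:R +
    G2 (f 0) j' i l' * partial si (fun x => A x j j') 0) * (l == l')%:R +
    G2 (f 0) j' i l' * (j == j')%:R * partial si (partial l (fun x => f x 0 l')) 0)).
  apply: eq_bigr => j' _; rewrite partial_sum => [|l' _]; last exact: dS.
  apply: eq_bigr => l' _; rewrite partialM //; last exact: diffableM.
  rewrite partialM // dG2 A0 mxE jac0E; congr (_ + _ * _).
  by under eq_fun do rewrite mxE.
under eq_bigr => j' _.
  rewrite big_split /= sum_delta.
  over.
rewrite !big_split /=; congr (_ + _ + _); first by rewrite sum_delta.
rewrite exchange_big; apply: eq_bigr => l' _ /=.
rewrite -(sum_delta (fun j' => G2 (f 0) j' i l' * partial si (partial l (fun x => f x 0 l')) 0) j).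
by apply: eq_bigr => j' _; ring.
Qed.

End Jets.

End Pullback.

Section LocalChange.
Variables (R : realType) (m n : nat).
Variables (f : 'rV[R]_m -> 'rV[R]_m) (A : 'rV[R]_m -> 'M[R]_n).
Hypothesis sf : forall l, smooth_on setT (fun x => f x 0 l).
Hypothesis sA : forall i j, smooth_on setT (fun x => A x i j).
Hypothesis J0 : jac f 0 = 1%:M.
Hypothesis A0 : A 0 = 1%:M.
Variables (U : set 'rV[R]_m) (oU : open U).
Hypothesis U0 : U (f 0).

Lemma open_preimage k (W : set 'rV[R]_k) (g : 'rV[R]_m -> 'rV[R]_k) :
  (forall l, smooth_on setT (fun x => g x 0 l)) -> open W -> open (g @^-1` W).
Proof.
move=> sg oW; apply: open_comp => // x _.
by apply/differentiable_continuous/diffable_row => l; exact: (smooth_diff (sg l) (I : setT x)).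
Qed.

Lemma open_unit k (B : 'rV[R]_m -> 'M[R]_k) :
  (forall i j, smooth_on setT (fun x => B x i j)) -> open [set x | B x \in unitmx].
Proof.
move=> sB; rewrite (_ : [set x | _] = (fun x => \det (B x) : R) @^-1` [set y | y != 0]); last first.
  by apply/seteqP; split=> x /=; rewrite unitmxE unitfE.
apply: open_comp; last exact: open_neq.
move=> x _; apply: differentiable_continuous.
exact: (smooth_diff (smooth_det (@openT _) sB) (I : setT x)).
Qed.

Lemma local_diffeomorphism : exists V : set 'rV[R]_m,
  [/\ open V, V 0, forall x, V x -> U (f x), {in V &, injective f} &
      forall x, V x -> jac f x \in unitmx /\ A x \in unitmx].
Proof.
have [W [oW W0 finj]] := locally_injective sf J0.
exists (W `&` (f @^-1` U `&` ([set x | jac f x \in unitmx] `&` [set x | A x \in unitmx]))); split.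
- apply: openI => //; apply: openI; first exact: open_preimage.
  by apply: openI; apply: open_unit => // i j; exact: smooth_jac.
- by split=> //; split=> //; split=> /=; rewrite ?J0 ?A0 unitmx1.
- by move=> x [_ []].
- by move=> x y /set_mem[Wx _] /set_mem[Wy _]; apply: finj; exact/mem_set.
- by move=> x [_ [_ []]].
Qed.

Variable Dt : conn_rule R m n.
Hypothesis Dt_natural : natural Dt.
Variables (s r : nat).
Hypothesis Dt_order : of_order s r Dt.

(** Naturality relates the connections to their pullbacks on a small neighbourhood of 0, and
    [first_order] then replaces the pullbacks by their 1-jets. *)
Lemma local_change (L : base_conn (flat n oU)) (K : lin_conn (flat n oU)) y B A' C :
  \sum_A0 D0 Dt (pull0 f (jac f) (L tt)) (pull1 f (jac f) (L tt))
      (pull0 f A (K tt)) (pull1 f A (K tt)) (row_mx 0 y) B A0 C * tot_jac f A (row_mx 0 y) A0 A' =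
  \sum_B' \sum_C' Dt L K tt (row_mx (f 0) y) B' A' C' * tot_jac f A (row_mx 0 y) B B' *
      tot_jac f A (row_mx 0 y) C C' - tot_hess f A (row_mx 0 y) B A' C.
Proof.
have [V [oV V0 VU finj uu]] := local_diffeomorphism.
have sfV l := smooth_subset (@subsetT _ V) (sf l).
have sAV i j := smooth_subset (@subsetT _ V) (sA i j).
have sJV i j := smooth_jac sfV i j.
have sL := flat_base_smooth L; have sK := flat_lin_smooth K.
have tL := @pullback_transf R m m V f (jac f) (L tt) (fun x Vx => (uu x Vx).1).
have tK := @pullback_transf R m n V f A (K tt) (fun x Vx => (uu x Vx).2).
have pL := pullback_smooth oV sfV sJV sL VU (fun x Vx => (uu x Vx).1).
have pK := pullback_smooth oV sfV sAV sK VU (fun x Vx => (uu x Vx).2).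
have := @flat_naturality R m n Dt Dt_natural U V oU oV f A (flat_base n oV pL) (flat_lin oV pK) L K
  sfV sAV VU finj uu tL tK (row_mx 0 y).
rewrite row_mxKl => /(_ V0 B A' C).
rewrite [tot_map f A _](_ : _ = row_mx (f 0) y); last first.
  by rewrite /tot_map row_mxKl row_mxKr A0 mulmx1.
move=> <-; apply: eq_bigr => A1 _; congr (_ * _).
rewrite (first_order Dt_natural Dt_order (flat_base n oV pL) (flat_lin oV pK)) //=.
congr (D0 Dt _ _ _ _ _ _ _ _).
- by do 3![apply/funext => ?]; rewrite (transf_jet0 V0 J0 J0 tL).
- by do 4![apply/funext => ?]; rewrite (transf_jet1 oV sfV sJV V0 VU J0 J0 pL sL tL).
- by do 3![apply/funext => ?]; rewrite (transf_jet0 V0 J0 A0 tK).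
- by do 4![apply/funext => ?]; rewrite (transf_jet1 oV sfV sAV V0 VU J0 A0 pK sK tK).
Qed.

End LocalChange.

Section Components.
Variables (R : realType) (m n : nat).
Variables (f : 'rV[R]_m -> 'rV[R]_m) (A : 'rV[R]_m -> 'M[R]_n).
Hypothesis sf : forall l, smooth_on setT (fun x => f x 0 l).
Hypothesis sA : forall i j, smooth_on setT (fun x => A x i j).
Hypothesis J0 : jac f 0 = 1%:M.
Hypothesis A0 : A 0 = 1%:M.
Variables (U : set 'rV[R]_m) (oU : open U).
Hypothesis U0 : U (f 0).
Variable Dt : conn_rule R m n.
Hypothesis Dt_natural : natural Dt.
Variables (s r : nat).
Hypothesis Dt_order : of_order s r Dt.
Variables (L : base_conn (flat n oU)) (K : lin_conn (flat n oU)) (y : 'rV[R]_n).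

Let J := tot_jac f A (row_mx 0 y).
Let b l i := \sum_j y 0 j * partial l (fun x => A x j i) 0.

Let sum_cl F la : \sum_B F B * J B (lshift n la) = F (lshift n la).
Proof.
rewrite big_split_ord /= [X in _ + X]big1 ?addr0 => [|j _]; last by rewrite tot_jac_dl mulr0.
rewrite -[RHS](sum_delta' (fun l => F (lshift n l))); apply: eq_bigr => l _.
by rewrite tot_jac_ul row_mxKl; move/matrixP: J0 => /(_ l la); rewrite !mxE => ->.
Qed.

Let sum_cr F i : \sum_B F B * J B (rshift m i) = F (rshift m i) + \sum_l F (lshift n l) * b l i.
Proof.
rewrite big_split_ord /= addrC; congr (_ + _); last first.
  by apply: eq_bigr => l _; rewrite tot_jac_ur row_mxKl row_mxKr.
rewrite -[RHS](sum_delta' (fun j => F (rshift m j))); apply: eq_bigr => j _.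
by rewrite tot_jac_dr row_mxKl A0 mxE.
Qed.

Let sum_rl F mu : \sum_B F B * J (lshift n mu) B = F (lshift n mu) + \sum_j F (rshift m j) * b mu j.
Proof.
rewrite big_split_ord /=; congr (_ + _); last first.
  by apply: eq_bigr => j _; rewrite tot_jac_ur row_mxKl row_mxKr.
rewrite -[RHS](sum_delta (fun l => F (lshift n l))); apply: eq_bigr => l _.
by rewrite tot_jac_ul row_mxKl; move/matrixP: J0 => /(_ mu l); rewrite !mxE => ->.
Qed.

Let sum_rr F j : \sum_B F B * J (rshift m j) B = F (rshift m j).
Proof.
rewrite big_split_ord /= [X in X + _]big1 ?add0r => [|l _]; last by rewrite tot_jac_dl mulr0.
rewrite -[RHS](sum_delta (fun k => F (rshift m k))); apply: eq_bigr => k _.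
by rewrite tot_jac_dr row_mxKl A0 mxE.
Qed.

Let sum2 (G : 'I_(m + n) -> 'I_(m + n) -> R) B C :
  \sum_B' \sum_C' G B' C' * J B B' * J C C' = \sum_B' (\sum_C' G B' C' * J C C') * J B B'.
Proof. by apply: eq_bigr => B' _; rewrite mulr_suml; apply: eq_bigr => C' _; ring. Qed.

Local Notation D1 := (D0 Dt (pull0 f (jac f) (L tt)) (pull1 f (jac f) (L tt))
      (pull0 f A (K tt)) (pull1 f A (K tt)) (row_mx 0 y)).
Local Notation D2 := (Dt L K tt (row_mx (f 0) y)).

Let change := local_change sf sA J0 A0 U0 Dt_natural Dt_order L K y.

(** The off-diagonal block of the Jacobian drops out, because components with an upper base index
    and a lower fibre index vanish. *)
Lemma change_lll mu la nu :
  D2 (lshift n mu) (lshift n la) (lshift n nu) =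
  D1 (lshift n mu) (lshift n la) (lshift n nu) + partial nu (partial mu (fun x => f x 0 la)) 0.
Proof.
have := change (lshift n mu) (lshift n la) (lshift n nu).
rewrite -/J sum_cl sum2 sum_rl sum_rl.
under [X in _ = _ + X + _ - _ -> _]eq_bigr do rewrite (vanish_llr Dt_natural Dt_order U0) mul0r.
rewrite [X in _ = _ + X - _ -> _]big1 => [|j _]; last first.
  rewrite sum_rl (vanish_rll Dt_natural Dt_order U0) add0r.
  rewrite big1 ?mul0r // => k _.
  by rewrite (vanish_rlr Dt_natural Dt_order U0) mul0r.
by rewrite big1 // !addr0 /tot_hess !split_l row_mxKl => ->; rewrite subrK.
Qed.

Lemma change_lrr mu i k :
  D2 (lshift n mu) (rshift m i) (rshift m k) =
  D1 (lshift n mu) (rshift m i) (rshift m k) + partial mu (fun x => A x k i) 0.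
Proof.
have := change (lshift n mu) (rshift m i) (rshift m k).
rewrite -/J sum_cr sum2 sum_rl sum_rr.
rewrite [X in _ + X = _ -> _]big1 => [|l _]; last first.
  by rewrite /D0 (vanish_llr Dt_natural Dt_order) ?mul0r.
rewrite [X in _ = _ + X - _ -> _]big1 => [|j _]; last first.
  by rewrite sum_rr (vanish_rrr Dt_natural Dt_order U0) mul0r.
by rewrite !addr0 /tot_hess split_l !split_r row_mxKl => ->; rewrite subrK.
Qed.

Lemma change_rrl j i nu :
  D2 (rshift m j) (rshift m i) (lshift n nu) =
  D1 (rshift m j) (rshift m i) (lshift n nu) + partial nu (fun x => A x j i) 0.
Proof.
have := change (rshift m j) (rshift m i) (lshift n nu).
rewrite -/J sum_cr sum2 sum_rr sum_rl.
rewrite [X in _ + X = _ -> _]big1 => [|l _]; last first.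
  by rewrite /D0 (vanish_rll Dt_natural Dt_order) ?mul0r.
rewrite [X in _ = _ + X - _ -> _]big1 => [|k _]; last first.
  by rewrite (vanish_rrr Dt_natural Dt_order U0) mul0r.
by rewrite !addr0 /tot_hess split_l !split_r row_mxKl => ->; rewrite subrK.
Qed.

(** Of the four nonzero kinds of components this is the one that mixes with the others: the
    off-diagonal entries [b] of the Jacobian bring in each of the three other kinds once. Terms
    quadratic in [b] disappear with the vanishing components. *)
Lemma change_lrl mu i nu :
  D2 (lshift n mu) (rshift m i) (lshift n nu) =
  D1 (lshift n mu) (rshift m i) (lshift n nu)
  + \sum_l D1 (lshift n mu) (lshift n l) (lshift n nu) * b l i
  - \sum_j D2 (rshift m j) (rshift m i) (lshift n nu) * b mu j
  - \sum_k D2 (lshift n mu) (rshift m i) (rshift m k) * b nu k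
  + \sum_j y 0 j * partial nu (partial mu (fun x => A x j i)) 0.
Proof.
have aux (a d e s1 s2 h : R) : d + e = a + s2 + s1 - h -> a = d + e - s1 - s2 + h by lra.
have E : \sum_j (\sum_C' D2 (rshift m j) (rshift m i) C' * J (lshift n nu) C') * b mu j =
    \sum_j D2 (rshift m j) (rshift m i) (lshift n nu) * b mu j.
  apply: eq_bigr => j _; rewrite sum_rl [X in _ + X]big1 ?addr0 // => k _.
  by rewrite (vanish_rrr Dt_natural Dt_order U0) mul0r.
have := change (lshift n mu) (rshift m i) (lshift n nu).
rewrite -/J sum_cr sum2 sum_rl sum_rl [X in _ = _ + X - _ -> _]E.
rewrite {1}/tot_hess !split_l split_r row_mxKl row_mxKr.
exact: aux.
Qed.

End Components.

(** * Quadratic test functions and constraints on the coefficients *)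

Section QuadraticFunctions.
Variables (R : realType) (m : nat).

(** The factor [2^-1] makes [M] the Hessian when [M] is symmetric; [c] and [l] are the value and the
    gradient at 0. *)
Definition quadf (c : R) (l : 'I_m -> R) (M : 'I_m -> 'I_m -> R) (x : 'rV[R]_m) : R :=
  c + \sum_s x 0 s * (l s + 2^-1 * \sum_t M s t * x 0 t).

Lemma smooth_quadf c l M : smooth_on setT (quadf c l M).
Proof.
have oT := @openT 'rV[R]_m; apply: smooth_add => //; first exact: smooth_cst.
apply: smooth_sum => // s; apply: smooth_mul => //; first exact: smooth_coord.
apply: smooth_add => //; first exact: smooth_cst.
apply: smooth_mul => //; first exact: smooth_cst.
by apply: smooth_sum => // t; apply: smooth_mul => //; [exact: smooth_cst | exact: smooth_coord].
Qed.

Lemma quadf0 c l M : quadf c l M 0 = c.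
Proof. by rewrite /quadf big1 ?addr0 // => s _; rewrite mxE mul0r. Qed.

Lemma partial_quadf c l M i : (forall s t, M s t = M t s) ->
  partial i (quadf c l M) = quadf (l i) (M i) (fun _ _ => 0).
Proof.
move=> sM; apply/funext => x.
have dl s t : differentiable (fun x : 'rV[R]_m => M s t * x 0 t : R) x.
  by apply: diffableM; [exact: diffable_cst | exact: diffable_coord].
have ds s : differentiable (fun x : 'rV[R]_m => \sum_t M s t * x 0 t : R) x.
  by apply: diffable_sum.
have dz s : differentiable (fun x : 'rV[R]_m => 2^-1 * \sum_t M s t * x 0 t : R) x.
  by apply: diffableM => //; exact: diffable_cst.
have da s : differentiable (fun x : 'rV[R]_m => l s + 2^-1 * \sum_t M s t * x 0 t : R) x.
  by apply: diffableD => //; exact: diffable_cst.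
have dm s : differentiable (fun x : 'rV[R]_m => x 0 s * (l s + 2^-1 * \sum_t M s t * x 0 t) : R) x.
  by apply: diffableM => //; exact: diffable_coord.
rewrite partialD; [|exact: diffable_cst|exact: diffable_sum].
rewrite partial_cst add0r partial_sum //.
transitivity (\sum_s ((l s + 2^-1 * \sum_t M s t * x 0 t) * (i == s)%:R + x 0 s * (2^-1 * M s i))).
  apply: eq_bigr => s _; rewrite partialM //; last exact: diffable_coord.
  rewrite partial_coord mulrC; congr (_ + _ * _).
  rewrite partialD //.
  rewrite partial_cst add0r partialZ // partial_sum //; congr (_ * _).
  rewrite -[RHS](sum_delta (M s)); apply: eq_bigr => t _.
  by rewrite partialZ ?partial_coord //; exact: diffable_coord.
rewrite big_split /= sum_delta -addrA; congr (_ + _).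
rewrite mulr_sumr -big_split; apply: eq_bigr => s _ /=.
rewrite (sM s i) big1 => [|t _]; last by rewrite mul0r.
by field.
Qed.

Lemma partial2_quadf c l M i k : (forall s t, M s t = M t s) ->
  partial k (partial i (quadf c l M)) = fun=> M i k.
Proof.
move=> sM; rewrite partial_quadf // partial_quadf //; apply/funext => x.
by rewrite /quadf big1 ?addr0 // => s _; rewrite big1 ?mulr0 ?addr0 ?mulr0 // => t _; rewrite mul0r.
Qed.

Lemma partial3_quadf c l M i k q x : (forall s t, M s t = M t s) ->
  partial q (partial k (partial i (quadf c l M))) x = 0.
Proof. by move=> sM; rewrite partial2_quadf // partial_cst. Qed.

Lemma quadf_lin c l x : quadf c l (fun _ _ => 0) x = c + \sum_s x 0 s * l s.
Proof.
by congr (_ + _); apply: eq_bigr => s _; rewrite big1 ?mulr0 ?addr0 // => t _; rewrite mul0r.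
Qed.

End QuadraticFunctions.

Section Constraints.
Variables (R : realType) (m n s r : nat) (Dt : conn_rule R m n).
Hypothesis Dt_natural : natural Dt.
Hypothesis Dt_order : of_order s r Dt.

Local Notation D := (D0 Dt).
Local Notation z3 := (fun _ _ _ => 0).
Local Notation z4 := (fun _ _ _ _ => 0).
Variables (x1 x2 x3 q1 q2 q3 q4 q5 q6 u1 u2 u3 u4 : R).
Hypothesis lrlE :   forall T, antisym T -> forall mu i nu l1 k1 y,
  D T l1 z3 k1 (row_mx 0 y) (lshift n mu) (rshift m i) (lshift n nu) =
  \sum_p y 0 p *
   ((i == p)%:R * (x1 * quad1 T mu nu + x2 * quad2 T mu nu + x3 * quad3 T mu nu) +
    (i == p)%:R * (q1 * (\sum_b l1 mu b nu b) + q2 * (\sum_b l1 mu b b nu) +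
      q3 * (\sum_b l1 nu b mu b) + q4 * (\sum_b l1 nu b b mu) +
      q5 * (\sum_b l1 b b mu nu) + q6 * (\sum_b l1 b b nu mu)) +
    (u1 * k1 p i mu nu + u2 * k1 p i nu mu +
    (i == p)%:R * (u3 * (\sum_b k1 b b mu nu) + u4 * (\sum_b k1 b b nu mu)))).

Let quad_zero mu nu : quad1 (z3 : 'I_m -> 'I_m -> 'I_m -> R) mu nu = 0 /\
  quad2 (z3 : 'I_m -> 'I_m -> 'I_m -> R) mu nu = 0 /\
  quad3 (z3 : 'I_m -> 'I_m -> 'I_m -> R) mu nu = 0.
Proof.
by split; [|split]; rewrite /quad1 /quad2 /quad3 big1 // => b _; rewrite big1 // => e _; rewrite mul0r.
Qed.

(** The constraints involve only sums of coefficients over exchanged base indices, so the diagonal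
    case [nu = mu] is enough. *)
Lemma lrl_at_flat l1 k1 mu i p :
  D z3 l1 z3 k1 (row_mx 0 (delta_mx 0 p)) (lshift n mu) (rshift m i) (lshift n mu) =
    (i == p)%:R * (q1 * (\sum_b l1 mu b mu b) + q2 * (\sum_b l1 mu b b mu) +
      q3 * (\sum_b l1 mu b mu b) + q4 * (\sum_b l1 mu b b mu) +
      q5 * (\sum_b l1 b b mu mu) + q6 * (\sum_b l1 b b mu mu)) +
    (u1 * k1 p i mu mu + u2 * k1 p i mu mu +
    (i == p)%:R * (u3 * (\sum_b k1 b b mu mu) + u4 * (\sum_b k1 b b mu mu))).
Proof.
rewrite lrlE => [|a b c]; last by rewrite oppr0.
rewrite (bigD1 p) //= [X in _ + X]big1 ?addr0 => [|p' pp]; last first.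
  by rewrite mxE (negbTE pp) andbF mul0r.
have [-> [-> ->]] := quad_zero mu mu.
by rewrite mxE !eqxx mul1r !mulr0 !addr0 mulr0 add0r.
Qed.

Let L0 : base_conn (flat n (@openT 'rV[R]_m)) := flat_base n (@openT _) (aff_smooth z3 z4).
Let K0 : lin_conn (flat n (@openT 'rV[R]_m)) := flat_lin (@openT _) (aff_smooth z3 z4).

Lemma zero_conn mu i nu y :
  Dt L0 K0 tt (row_mx 0 y) (lshift n mu) (rshift m i) (lshift n nu) = 0.
Proof.
rewrite -/(D z3 z4 z3 z4 _ _ _ _) lrlE => [|a b c]; last by rewrite oppr0.
apply: big1 => p _; have [-> [-> ->]] := quad_zero mu nu; rewrite !big1_eq; ring.
Qed.

(* A change of coordinates of the zero connections whose pullbacks have zero values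
   at 0: the rule gives 0 on one side and the second derivative of [A] on the
   other. *)
Lemma flat_change (f : 'rV[R]_m -> 'rV[R]_m) (A : 'rV[R]_m -> 'M[R]_n) l1 k1 mu i p :
  (forall l, smooth_on setT (fun x => f x 0 l)) -> (forall i j, smooth_on setT (fun x => A x i j)) ->
  f 0 = 0 -> jac f 0 = 1%:M -> A 0 = 1%:M ->
  (forall a b c, partial c (partial a (fun x => f x 0 b)) 0 = 0) ->
  (forall a b c, partial c (fun x => A x a b) 0 = 0) ->
  (forall a b c e, partial e (partial c (partial a (fun x => f x 0 b))) 0 = - l1 a b c e) ->
  (forall a b c e, partial e (partial c (fun x => A x a b)) 0 = - k1 a b c e) ->
  (i == p)%:R * (q1 * (\sum_b l1 mu b mu b) + q2 * (\sum_b l1 mu b b mu) +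
      q3 * (\sum_b l1 mu b mu b) + q4 * (\sum_b l1 mu b b mu) +
      q5 * (\sum_b l1 b b mu mu) + q6 * (\sum_b l1 b b mu mu)) +
    (u1 * k1 p i mu mu + u2 * k1 p i mu mu +
    (i == p)%:R * (u3 * (\sum_b k1 b b mu mu) + u4 * (\sum_b k1 b b mu mu))) =
  k1 p i mu mu.
Proof.
move=> sf sA f0 J0 A0 f2 A1 f3 A2; rewrite -lrl_at_flat.
have := change_lrl sf sA J0 A0 (I : [set: 'rV[R]_m] (f 0)) Dt_natural Dt_order L0 K0
  (delta_mx 0 p) mu i mu.
rewrite f0 zero_conn.
have b0 l (k : 'I_n) : \sum_j (delta_mx 0 p : 'rV[R]_n) 0 j * partial l (fun x => A x j k) 0 = 0.
  by rewrite big1 // => j _; rewrite A1 mulr0.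
rewrite 3?[\sum_(_ < _) _ * \sum_(_ < _) _]big1; [|by move=> ? _; rewrite b0 mulr0..].
rewrite addr0 !subr0 (bigD1 p) //= [X in _ + (_ + X)]big1 ?addr0 => [|p' pp]; last first.
  by rewrite mxE (negbTE pp) andbF mul0r.
have -> : (delta_mx 0 p : 'rV[R]_n) 0 p = 1 by rewrite mxE !eqxx.
rewrite A2.
have aux (d d' h : R) : d' = d -> 0 = d + 1 * - h -> d' = h by lra.
apply: aux.
have jE a b : (fun x => jac f x a b) = partial a (fun x => f x 0 b).
  by apply/funext => x; rewrite mxE.
congr (D _ _ _ _ _ _ _ _).
- by do 3![apply/funext => ?]; rewrite /pull0 f0 aff_at0 jE f2 subr0.
- do 4![apply/funext => ?]; rewrite /pull1 f0 partial_aff jE f3.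
  rewrite 3?[\sum_(_ < _) _]big1; first ring.
  + by move=> ? _; rewrite /pull0 f0 aff_at0 jE f2 subr0 mul0r.
  + by move=> ? _; rewrite aff_at0 mul0r.
  + by move=> ? _; rewrite aff_at0 mul0r.
- by do 3![apply/funext => ?]; rewrite /pull0 f0 aff_at0 A1 subr0.
- do 4![apply/funext => ?]; rewrite /pull1 f0 partial_aff A2.
  rewrite 3?[\sum_(_ < _) _]big1; first ring.
  + by move=> ? _; rewrite /pull0 f0 aff_at0 A1 subr0 mul0r.
  + by move=> ? _; rewrite aff_at0 mul0r.
  + by move=> ? _; rewrite aff_at0 mul0r.
Qed.

(* Fibre change A = 1 + x_mu^2 be / 2. *)
Lemma bundle_constraint (mu : 'I_m) (be : 'M[R]_n) p i :
  (u1 + u2) * be p i + (i == p)%:R * ((u3 + u4) * \tr be) = be p i.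
Proof.
(* The sign cancels the one with which second derivatives of [A] enter [pull1], so that the
   pulled-back derivative in the directions [mu], [mu] is [be]. *)
pose M j k (s t : 'I_m) : R := - be j k * ((s == mu)%:R * (t == mu)%:R).
have sM j k a b : M j k a b = M j k b a by rewrite /M; ring.
pose A x : 'M[R]_n := \matrix_(j, k) quadf (j == k)%:R (fun=> 0) (M j k) x.
have AE j k : (fun x => A x j k) = quadf (j == k)%:R (fun=> 0) (M j k).
  by apply/funext => x; rewrite mxE.
have idE (b : 'I_m) : (fun x : 'rV[R]_m => x 0 b) = quadf 0 (fun a => (a == b)%:R) (fun _ _ => 0).
  by apply/funext => x; rewrite quadf_lin add0r sum_delta'.
have := @flat_change id A z4 (fun j k a b => - M j k a b) mu i p.
rewrite !big1_eq.
have -> : \sum_b - M b b mu mu = \tr be.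
  by apply: eq_bigr => b _; rewrite /M !eqxx !mulr1 opprK.
have -> : - M p i mu mu = be p i by rewrite /M !eqxx !mulr1 opprK.
move=> H; rewrite -[RHS]H; first by ring.
- by move=> l; exact: smooth_coord.
- by move=> j k; rewrite AE; exact: smooth_quadf.
- by [].
- exact: jac_id.
- by apply/matrixP => j k; rewrite !mxE quadf0.
- by move=> a b c; rewrite idE partial2_quadf.
- by move=> a b c; rewrite AE partial_quadf // quadf0.
- by move=> a b c e; rewrite idE partial3_quadf // oppr0.
- by move=> a b c e; rewrite AE partial2_quadf // opprK.
Qed.

(* Base change x_mu |-> x_mu + x_mu^3. *)
Lemma base_constraint (mu : 'I_m) (p : 'I_n) : q1 + q2 + q3 + q4 + q5 + q6 = 0.
Proof.
(* The Hessian of the partial derivative [a] of the coordinate [b] of the change; 6 is the third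
   derivative of the cube. *)
pose M (b a : 'I_m) (c e : 'I_m) : R := 6 * ((b == mu)%:R * (a == mu)%:R) * ((c == mu)%:R * (e == mu)%:R).
have sM b a c e : M b a c e = M b a e c by rewrite /M; ring.
pose f (x : 'rV[R]_m) : 'rV[R]_m := \row_b (x 0 b + (b == mu)%:R * (x 0 mu * (x 0 mu * x 0 mu))).
have oT := @openT 'rV[R]_m.
have sc k : smooth_on setT (fun x : 'rV[R]_m => x 0 k) by exact: smooth_coord.
have fE b : (fun x => f x 0 b) = (fun x => x 0 b + (b == mu)%:R * (x 0 mu * (x 0 mu * x 0 mu))).
  by apply/funext => x; rewrite mxE.
have sf l : smooth_on setT (fun x => f x 0 l).
  rewrite fE; apply: smooth_add => //; apply: smooth_mul => //; first exact: smooth_cst.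
  by do 2![apply: smooth_mul => //].
have f1 a b : partial a (fun x => f x 0 b) = quadf (a == b)%:R (fun=> 0) (M b a).
  have dc k x : differentiable (fun x : 'rV[R]_m => x 0 k : R) x by exact: diffable_coord.
  have d2 x : differentiable (fun x : 'rV[R]_m => x 0 mu * x 0 mu : R) x by exact: diffableM.
  have d3 x : differentiable (fun x : 'rV[R]_m => x 0 mu * (x 0 mu * x 0 mu) : R) x by exact: diffableM.
  have d4 x : differentiable (fun x : 'rV[R]_m => (b == mu)%:R * (x 0 mu * (x 0 mu * x 0 mu)) : R) x.
    by apply: diffableM => //; exact: diffable_cst.
  apply/funext => x; rewrite fE partialD // partialZ // partialM // partialM // !partial_coord.
  rewrite /quadf; congr (_ + _).
  transitivity (\sum_c (x 0 c * (2^-1 * (6 * ((b == mu)%:R * (a == mu)%:R)) * x 0 mu)) * (c == mu)%:R).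
    by rewrite sum_delta'; field.
  apply: eq_bigr => c _; rewrite add0r -[x 0 mu in LHS](sum_delta' (fun e => x 0 e)) !mulr_sumr mulr_suml.
  by apply: eq_bigr => e _; rewrite /M; ring.
have := @flat_change f (fun=> 1%:M) (fun a b c e => - M b a c e) z4 mu p p.
(* The derivative is totally symmetric and supported on the direction [mu], so all six contractions
   equal -6 and their coefficients are added. *)
have S1 : \sum_b - M b mu mu b = - 6.
  rewrite -[RHS](sum_delta' (fun b => - 6) mu); apply: eq_bigr => b _.
  by rewrite /M !eqxx; case: (b == mu) => /=; ring.
have S2 : \sum_b - M b mu b mu = - 6.
  rewrite -[RHS](sum_delta' (fun b => - 6) mu); apply: eq_bigr => b _.
  by rewrite /M !eqxx; case: (b == mu) => /=; ring.
have S3 : \sum_b - M b b mu mu = - 6.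
  rewrite -[RHS](sum_delta' (fun b => - 6) mu); apply: eq_bigr => b _.
  by rewrite /M !eqxx; case: (b == mu) => /=; ring.
rewrite S1 S2 S3 big1_eq eqxx => H.
suff : 1%:R * (q1 * -6 + q2 * -6 + q3 * -6 + q4 * -6 + q5 * -6 + q6 * -6) +
    (u1 * 0 + u2 * 0 + 1%:R * (u3 * 0 + u4 * 0)) = 0 by lra.
apply: H => //.
- by move=> i j; exact: smooth_cst.
- by apply/rowP => b; rewrite !mxE !mul0r mulr0 addr0.
- by apply/matrixP => a b; rewrite !mxE f1 quadf0.
- by move=> a b c; rewrite f1 partial_quadf // quadf0.
- by move=> a b c; exact: partial_cst.
- by move=> a b c e; rewrite f1 partial2_quadf // opprK.
- move=> a b c e; rewrite (_ : partial c _ = fun=> 0) ?partial_cst ?oppr0 //.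
  by apply/funext => x; exact: partial_cst.
Qed.

End Constraints.

(** * Components of the tensors in the formula *)

Section Expansion.
Variables (R : realType) (m n : nat).
Implicit Types (K : coefs R m n) (z : 'rV[R]_(m + n)) (la mu nu : 'I_m) (i j k : 'I_n).

Lemma bas_l la mu : bas R n la 0 (lshift n mu) = (mu == la)%:R.
Proof. by rewrite mxE eqxx (inj_eq (@lshift_inj _ _)). Qed.

Lemma bas_r (la : 'I_m) j : bas R n la 0 (rshift m j) = 0.
Proof. by rewrite mxE eqxx eq_rlshift. Qed.

Lemma fib_l (i : 'I_n) mu : fib R m i 0 (lshift n mu) = 0.
Proof. by rewrite mxE eqxx eq_lrshift. Qed.

Lemma fib_r (i j : 'I_n) : fib R m i 0 (rshift m j) = (j == i)%:R.
Proof. by rewrite mxE eqxx (inj_eq (@rshift_inj _ _)). Qed.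

(** The fibre component [K_j^i_la y^j] of the horizontal lift of [d_la]. *)
Definition lift_coef K z (i : 'I_n) (la : 'I_m) := \sum_j K (lsubmx z) j i la * rsubmx z 0 j.

Lemma hor_l K z la mu : hor K z la 0 (lshift n mu) = (mu == la)%:R.
Proof.
rewrite mxE bas_l summxE big1 ?addr0 // => i _; rewrite summxE big1 // => j _.
by rewrite mxE fib_l mulr0.
Qed.

Lemma hor_r K z la i : hor K z la 0 (rshift m i) = lift_coef K z i la.
Proof.
rewrite mxE bas_r add0r summxE -[RHS](sum_delta (fun k => lift_coef K z k la)).
by apply: eq_bigr => k _; rewrite summxE mulr_suml; apply: eq_bigr => j _; rewrite mxE fib_r.
Qed.

Lemma nu_form_l K z i la : nu_form K z i 0 (lshift n la) = - lift_coef K z i la.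
Proof.
rewrite mxE fib_l add0r mxE summxE; congr (- _).
rewrite -[RHS](sum_delta (fun nu => lift_coef K z i nu)).
by apply: eq_bigr => k _; rewrite summxE mulr_suml; apply: eq_bigr => j _; rewrite mxE bas_l.
Qed.

Lemma nu_form_r K z i j : nu_form K z i 0 (rshift m j) = (j == i)%:R.
Proof.
rewrite mxE fib_r mxE summxE big1 ?subr0 // => la _; rewrite summxE big1 // => k _.
by rewrite mxE bas_r mulr0.
Qed.

Lemma hor_S_ll K S z mu A nu :
  hor_S K S z (lshift n mu) A (lshift n nu) = \sum_la S (lsubmx z) mu la nu * hor K z la 0 A.
Proof.
rewrite /hor_S /tens3.
rewrite -[RHS](sum_delta (fun mu => \sum_la S (lsubmx z) mu la nu * hor K z la 0 A)).
apply: eq_bigr => a _; rewrite mulr_suml; apply: eq_bigr => la _.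
rewrite -(sum_delta (fun nu => S (lsubmx z) a la nu) nu) !mulr_suml; apply: eq_bigr => b _.
by rewrite !bas_l; ring.
Qed.

Lemma hor_S_r K S z j A C : hor_S K S z (rshift m j) A C = 0.
Proof.
rewrite /hor_S /tens3; apply: big1 => a _; apply: big1 => b _; apply: big1 => c _.
by rewrite bas_r; ring.
Qed.

Lemma hor_S_lr K S z B A k : hor_S K S z B A (rshift m k) = 0.
Proof.
rewrite /hor_S /tens3; apply: big1 => a _; apply: big1 => b _; apply: big1 => c _.
by rewrite bas_r; ring.
Qed.

Lemma vertical_lrl (W : 'I_n -> 'I_m -> 'I_m -> R) mu i nu :
  \sum_i' \sum_mu' \sum_nu' W i' mu' nu' * tens3 (bas R n mu') (fib R m i') (bas R n nu')
    (lshift n mu) (rshift m i) (lshift n nu) = W i mu nu.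
Proof.
rewrite -[RHS](sum_delta (fun i => W i mu nu)); apply: eq_bigr => i' _.
rewrite -(sum_delta (fun mu => W i' mu nu)) mulr_suml; apply: eq_bigr => mu' _.
rewrite -(sum_delta (fun nu => W i' mu' nu)) !mulr_suml; apply: eq_bigr => nu' _.
by rewrite /tens3 !bas_l fib_r; ring.
Qed.

Lemma vertical_other (W : 'I_n -> 'I_m -> 'I_m -> R) B A C :
  (if (fintype.split B, fintype.split A, fintype.split C) is (inl _, inr _, inl _) then false else true) ->
  \sum_i' \sum_mu' \sum_nu' W i' mu' nu' * tens3 (bas R n mu') (fib R m i') (bas R n nu') B A C = 0.
Proof.
move=> H; apply: big1 => a _; apply: big1 => b _; apply: big1 => c _; rewrite /tens3.
rewrite -(splitK B) -(splitK A) -(splitK C).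
move: H; case: (fintype.split B) => [mu|j]; case: (fintype.split A) => [la|i];
  case: (fintype.split C) => [nu|k] //= _; rewrite ?bas_r ?fib_l; ring.
Qed.

Lemma liouville_GE G z : liouville_G G z = fun B A C =>
  \sum_i' \sum_mu' \sum_nu' (rsubmx z 0 i' * G (lsubmx z) mu' nu') *
    tens3 (bas R n mu') (fib R m i') (bas R n nu') B A C.
Proof. by []. Qed.

Lemma curv_liouvilleE K z B A C : curv_liouville K z B A C =
  \sum_i' \sum_mu' \sum_nu' (\sum_j curvature K (lsubmx z) j i' mu' nu' * rsubmx z 0 j) *
    tens3 (bas R n mu') (fib R m i') (bas R n nu') B A C.
Proof.
rewrite /curv_liouville exchange_big; apply: eq_bigr => i' _ /=.
rewrite exchange_big; apply: eq_bigr => mu' _ /=.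
by rewrite exchange_big; apply: eq_bigr => nu' _ /=; rewrite mulr_suml.
Qed.

Lemma H_tensor_l h1 h2 L K z B mu C : H_tensor h1 h2 L K z B (lshift n mu) C = 0.
Proof.
rewrite /H_tensor /tens3 big1 => [|i _]; last by rewrite big1 // => nu _; rewrite fib_l; ring.
rewrite [X in _ + _ * X]big1 => [|nu _]; last by rewrite big1 // => i _; rewrite fib_l; ring.
by rewrite !mulr0 addr0.
Qed.

Lemma H_tensor_lrl h1 h2 L K z mu i nu :
  H_tensor h1 h2 L K z (lshift n mu) (rshift m i) (lshift n nu) =
  - h1 * (torsion_tr L (lsubmx z) nu * lift_coef K z i mu)
  - h2 * (torsion_tr L (lsubmx z) mu * lift_coef K z i nu).
Proof.
rewrite /H_tensor /tens3 !mulNr -!mulrN; congr (_ * _ + _ * _).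
  rewrite -[RHS](sum_delta (fun i => torsion_tr L (lsubmx z) nu * - lift_coef K z i mu)).
  apply: eq_bigr => k _.
  rewrite -(sum_delta (fun nu => torsion_tr L (lsubmx z) nu)) !mulr_suml; apply: eq_bigr => l _.
  by rewrite nu_form_l fib_r bas_l; ring.
rewrite -[RHS](sum_delta (fun i => torsion_tr L (lsubmx z) mu * - lift_coef K z i nu)).
rewrite exchange_big; apply: eq_bigr => k _ /=.
rewrite -(sum_delta (fun nu => torsion_tr L (lsubmx z) nu)) !mulr_suml; apply: eq_bigr => l _.
by rewrite nu_form_l fib_r bas_l; ring.
Qed.

Lemma H_tensor_lrr h1 h2 L K z mu i k :
  H_tensor h1 h2 L K z (lshift n mu) (rshift m i) (rshift m k) =
  h2 * (torsion_tr L (lsubmx z) mu * (i == k)%:R).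
Proof.
rewrite /H_tensor /tens3 [X in h1 * X]big1 => [|j _]; last first.
  by rewrite big1 // => l _; rewrite bas_r; ring.
rewrite mulr0 add0r; congr (_ * _).
rewrite -(sum_delta (fun mu => torsion_tr L (lsubmx z) mu * (i == k)%:R)); apply: eq_bigr => l _.
rewrite -(sum_delta (fun j => torsion_tr L (lsubmx z) l * (j == k)%:R)) mulr_suml.
by apply: eq_bigr => j _; rewrite nu_form_r fib_r bas_l [k == j]eq_sym; ring.
Qed.

Lemma H_tensor_rrl h1 h2 L K z j i nu :
  H_tensor h1 h2 L K z (rshift m j) (rshift m i) (lshift n nu) =
  h1 * (torsion_tr L (lsubmx z) nu * (i == j)%:R).
Proof.
rewrite /H_tensor /tens3 [X in h2 * X]big1 => [|l _]; last first.
  by rewrite big1 // => k _; rewrite bas_r; ring.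
rewrite mulr0 addr0; congr (_ * _).
rewrite -(sum_delta (fun k => torsion_tr L (lsubmx z) nu * (k == j)%:R)); apply: eq_bigr => k _.
rewrite -(sum_delta (fun nu => torsion_tr L (lsubmx z) nu)) !mulr_suml; apply: eq_bigr => l _.
by rewrite nu_form_r fib_r bas_l [j == k]eq_sym; ring.
Qed.

Lemma H_tensor_rrr h1 h2 L K z j i k :
  H_tensor h1 h2 L K z (rshift m j) (rshift m i) (rshift m k) = 0.
Proof.
rewrite /H_tensor /tens3 [X in h2 * X]big1 => [|l _]; last first.
  by rewrite big1 // => q _; rewrite bas_r; ring.
rewrite big1 => [|q _]; first by ring.
by rewrite big1 // => l _; rewrite bas_r; ring.
Qed.

End Expansion.

(** * Normal coordinates *)

Section NormalJets.
Variables (R : realType) (m n : nat) (U : set 'rV[R]_m) (oU : open U).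
Variables (G : coefs R m m) (K : coefs R m n) (x0 : 'rV[R]_m).
Hypothesis Ux0 : U x0.
Hypothesis sG : smooth_coefs U G.

Local Notation S := (symmetrized G x0).
Local Notation T := (torsion G x0).

(* Coordinates centred at [x0] in which [K] and the symmetric part of [G] vanish at
   the origin. *)
Definition normal_base (x : 'rV[R]_m) : 'rV[R]_m :=
  \row_b quadf (x0 0 b) (fun a => (a == b)%:R) (fun a c => S a b c) x.

Definition normal_fibre (x : 'rV[R]_m) : 'M[R]_n :=
  \matrix_(j, i) quadf (j == i)%:R (fun a => K x0 j i a) (fun _ _ => 0) x.

Local Notation f := normal_base.
Local Notation A := normal_fibre.

Lemma symmetrizedC a b c : S a b c = S c b a.
Proof. by rewrite /symmetrized addrC. Qed.

Lemma torsion_antisym : antisym T.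
Proof. by move=> a b c; rewrite /torsion; ring. Qed.

Lemma torsion_symmetrized a b c : G x0 a b c = T a b c + S a b c.
Proof. by rewrite /torsion /symmetrized; field. Qed.

Let fE b : (fun x => f x 0 b) = quadf (x0 0 b) (fun a => (a == b)%:R) (fun a c => S a b c).
Proof. by apply/funext => x; rewrite mxE. Qed.

Let AE j i : (fun x => A x j i) = quadf (j == i)%:R (fun a => K x0 j i a) (fun _ _ => 0).
Proof. by apply/funext => x; rewrite mxE. Qed.

Lemma normal_base_smooth l : smooth_on setT (fun x => f x 0 l).
Proof. by rewrite fE; exact: smooth_quadf. Qed.

Lemma normal_fibre_smooth j i : smooth_on setT (fun x => A x j i).
Proof. by rewrite AE; exact: smooth_quadf. Qed.

Lemma normal_base0 : f 0 = x0.
Proof. by apply/rowP => b; rewrite mxE quadf0. Qed.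

Lemma normal_fibre0 : A 0 = 1%:M.
Proof. by apply/matrixP => j i; rewrite !mxE quadf0. Qed.

Let sS b a c : S a b c = S c b a. Proof. exact: symmetrizedC. Qed.

Let jE a b : (fun x => jac f x a b) = quadf (a == b)%:R (fun c => S a b c) (fun _ _ => 0).
Proof. by apply/funext => x; rewrite mxE fE partial_quadf. Qed.

Lemma normal_base_jac : jac f 0 = 1%:M.
Proof.
by apply/matrixP => a b; rewrite -[LHS]/((fun x => jac f x a b) 0) jE quadf0 mxE.
Qed.

Lemma normal_base2 a b c : partial c (partial a (fun x => f x 0 b)) 0 = S a b c.
Proof. by rewrite fE partial2_quadf. Qed.

Lemma normal_fibre1 j i a : partial a (fun x => A x j i) 0 = K x0 j i a.
Proof. by rewrite AE partial_quadf // quadf0. Qed.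

Lemma normal_fibre2 j i a c : partial c (partial a (fun x => A x j i)) 0 = 0.
Proof. by rewrite AE partial2_quadf. Qed.

Lemma pull0_normal_base : pull0 f (jac f) G = T.
Proof.
apply/funext => a; apply/funext => b; apply/funext => c.
by rewrite /pull0 normal_base0 jE partial_quadf // quadf0 torsion_symmetrized addrK.
Qed.

Lemma pull0_normal_fibre : pull0 f A K = fun _ _ _ => 0.
Proof.
apply/funext => j; apply/funext => i; apply/funext => c.
by rewrite /pull0 normal_base0 normal_fibre1 subrr.
Qed.

Lemma pull1_normal_fibre j i l e : pull1 f A K j i l e =
  partial e (fun x => K x j i l) x0 + \sum_p K x0 p i l * K x0 j p e + \sum_a K x0 j i a * S l a e.
Proof.
rewrite /pull1 normal_base0 normal_fibre2 subr0 pull0_normal_fibre.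
rewrite [X in _ - X]big1 ?subr0 => [|p _]; last by rewrite mul0r.
congr (_ + _ + _); first by apply: eq_bigr => p _; rewrite normal_fibre1.
by apply: eq_bigr => a _; rewrite normal_base2.
Qed.

(** First derivatives of the symmetrized connection in the normal coordinates: the formula [pull1]
    with [symmetrized G] in place of [G], its values at the origin being zero. *)
Definition sym_deriv a b c e : R :=
  partial e (fun x => symmetrized G x a b c) x0
  + \sum_p S p b c * S a p e + \sum_p S a b p * S c p e.

Lemma sym_derivC a b c e : sym_deriv a b c e = sym_deriv c b a e.
Proof.
rewrite /sym_deriv; have -> : (fun x => symmetrized G x a b c) = (fun x => symmetrized G x c b a).
  by apply/funext => x; rewrite /symmetrized addrC.
rewrite -!addrA; congr (_ + _); rewrite addrC; congr (_ + _); apply: eq_bigr => p _.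
  by rewrite (sS b a p).
by rewrite (sS b p c).
Qed.

(** Where the components of a connection vanish its curvature has no quadratic part and is a
    difference of first derivatives. *)
Lemma sym_deriv_curvature a b c e :
  sym_deriv a b c e - sym_deriv a b e c = curvature (symmetrized G) x0 a b c e.
Proof.
rewrite /sym_deriv /curvature.
have -> : \sum_p S a b p * S e p c = \sum_p S a b p * S c p e.
  by apply: eq_bigr => p _; rewrite (sS p e c).
have -> : \sum_p S p b c * S a p e = \sum_p S a p e * S p b c by apply: eq_bigr => p _; rewrite mulrC.
have -> : \sum_p S p b e * S a p c = \sum_p S a p c * S p b e by apply: eq_bigr => p _; rewrite mulrC.
by ring.
Qed.

Let dG a b c : differentiable (fun x => G x a b c : R) x0.
Proof. exact: (smooth_diff (sG a b c) Ux0). Qed.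

(** At the origin of the normal coordinates the covariant derivative of the torsion is its partial
    derivative, and the rest is the derivative of the symmetric part. *)
Lemma pull1_normal_base a b c e :
  pull1 f (jac f) G a b c e = nabla_torsion G x0 a b c e + sym_deriv a b c e.
Proof.
have dT : partial e (fun x => torsion G x a b c) x0 =
    2^-1 * (partial e (fun x => G x a b c) x0 - partial e (fun x => G x c b a) x0).
  by rewrite partialZ ?partialB //; apply: diffableD => //; exact: diffableN.
have dS : partial e (fun x => symmetrized G x a b c) x0 =
    2^-1 * (partial e (fun x => G x a b c) x0 + partial e (fun x => G x c b a) x0).
  by rewrite partialZ ?partialD //; exact: diffableD.
have dTS : partial e (fun x => G x a b c) x0 = partial e (fun x => torsion G x a b c) x0 +
    partial e (fun x => symmetrized G x a b c) x0 by rewrite dT dS; field.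
rewrite /pull1 normal_base0 pull0_normal_base.
have -> : partial e (partial c (fun x => jac f x a b)) 0 = 0.
  by rewrite jE partial2_quadf.
have -> : \sum_p G x0 p b c * partial e (fun x => jac f x a p) 0 =
    \sum_p S a p e * T p b c + \sum_p S p b c * S a p e.
  rewrite -big_split; apply: eq_bigr => p _ /=.
  by rewrite jE partial_quadf // quadf0 torsion_symmetrized; ring.
have -> : \sum_p G x0 a b p * partial e (partial c (fun x => f x 0 p)) 0 =
    \sum_p S c p e * T a b p + \sum_p S a b p * S c p e.
  rewrite -big_split; apply: eq_bigr => p _ /=.
  by rewrite normal_base2 torsion_symmetrized; ring.
have -> : \sum_p T a p c * partial e (fun x => jac f x p b) 0 = \sum_p S p b e * T a p c.
  by apply: eq_bigr => p _; rewrite jE partial_quadf // quadf0 mulrC.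
by rewrite dTS /nabla_torsion /sym_deriv; ring.
Qed.

End NormalJets.

Section NormalContractions.
Variables (R : realType) (m n : nat) (U : set 'rV[R]_m).
Variables (G : coefs R m m) (K : coefs R m n) (x0 : 'rV[R]_m).
Hypothesis Ux0 : U x0.
Hypothesis sG : smooth_coefs U G.

Local Notation dG := (pull1 (normal_base G x0) (jac (normal_base G x0)) G).
Local Notation dK := (pull1 (normal_base G x0) (normal_fibre K x0) K).
Local Notation dT := (nabla_torsion G x0).
Local Notation Rt := (curvature (symmetrized G) x0).

Lemma nabla_torsionC a b c e : dT a b c e = - dT c b a e.
Proof.
have aT p q t : torsion G x0 p q t = - torsion G x0 t q p by exact: torsion_antisym.
rewrite /nabla_torsion; have -> : partial e (fun x => torsion G x a b c) x0 =
    - partial e (fun x => torsion G x c b a) x0.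
  rewrite -partialN.
    by congr (partial _ _ _); apply/funext => x; exact: torsion_antisym.
  have d := smooth_diff (sG _ _ _) Ux0.
  by apply: diffableM; [exact: diffable_cst | apply: diffableD => //; exact: diffableN].
have -> : \sum_p symmetrized G x0 p b e * torsion G x0 a p c =
    - \sum_p symmetrized G x0 p b e * torsion G x0 c p a.
  by rewrite -sumrN; apply: eq_bigr => p _; rewrite aT mulrN.
have -> : \sum_p symmetrized G x0 a p e * torsion G x0 p b c =
    - \sum_p symmetrized G x0 a p e * torsion G x0 c b p.
  by rewrite -sumrN; apply: eq_bigr => p _; rewrite aT mulrN.
have -> : \sum_p symmetrized G x0 c p e * torsion G x0 a b p =
    - \sum_p symmetrized G x0 c p e * torsion G x0 p b a.
  by rewrite -sumrN; apply: eq_bigr => p _; rewrite aT mulrN.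
ring.
Qed.

(* The vanishing sum of the q's makes the symmetric derivatives occur through
   their differences only, which are curvatures. *)
Lemma base_contraction q1 q2 q3 q4 q5 q6 mu nu : q1 + q2 + q3 + q4 + q5 + q6 = 0 ->
  q1 * (\sum_b dG mu b nu b) + q2 * (\sum_b dG mu b b nu) + q3 * (\sum_b dG nu b mu b) +
  q4 * (\sum_b dG nu b b mu) + q5 * (\sum_b dG b b mu nu) + q6 * (\sum_b dG b b nu mu) =
  (q5 - q2) * (\sum_rho dT rho rho mu nu) + (q6 - q4) * (\sum_rho dT rho rho nu mu) +
  (q1 - q3) * (\sum_rho dT mu rho nu rho) - (q4 + q6) * (\sum_rho Rt rho rho mu nu) -
  (q1 + q3) * (\sum_rho Rt mu rho rho nu).
Proof.
move=> q0.
(* Antisymmetry of the torsion and symmetry of [sym_deriv] express the six contractions through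
   three derivatives [t] of the torsion and three symmetric terms [s]. Eliminating [q1] leaves the
   latter only in the differences [R5] and [R1]. *)
have aux (A1 A2 A3 A4 A5 A6 t1 t5 t6 s1 s5 s6 R5 R1 : R) :
    A1 = t1 + s1 -> A2 = - t5 + s5 -> A3 = - t1 + s1 -> A4 = - t6 + s6 -> A5 = t5 + s5 ->
    A6 = t6 + s6 -> R5 = s5 - s6 -> R1 = s5 - s1 ->
    q1 * A1 + q2 * A2 + q3 * A3 + q4 * A4 + q5 * A5 + q6 * A6 =
    (q5 - q2) * t5 + (q6 - q4) * t6 + (q1 - q3) * t1 - (q4 + q6) * R5 - (q1 + q3) * R1.
  move=> -> -> -> -> -> -> -> ->; have -> : q1 = - (q2 + q3 + q4 + q5 + q6) by lra.
  ring.
have E := pull1_normal_base Ux0 sG.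
pose s := sym_deriv G x0.
have e1 : \sum_b dG mu b nu b = \sum_b dT mu b nu b + \sum_b s mu b nu b.
  by rewrite -big_split; apply: eq_bigr => b _ /=; rewrite E.
have e2 : \sum_b dG mu b b nu = - (\sum_b dT b b mu nu) + \sum_b s b b mu nu.
  by rewrite -sumrN -big_split; apply: eq_bigr => b _ /=; rewrite E nabla_torsionC /s sym_derivC.
have e3 : \sum_b dG nu b mu b = - (\sum_b dT mu b nu b) + \sum_b s mu b nu b.
  by rewrite -sumrN -big_split; apply: eq_bigr => b _ /=; rewrite E nabla_torsionC /s sym_derivC.
have e4 : \sum_b dG nu b b mu = - (\sum_b dT b b nu mu) + \sum_b s b b nu mu.
  by rewrite -sumrN -big_split; apply: eq_bigr => b _ /=; rewrite E nabla_torsionC /s sym_derivC.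
have e5 : \sum_b dG b b mu nu = \sum_b dT b b mu nu + \sum_b s b b mu nu.
  by rewrite -big_split; apply: eq_bigr => b _ /=; rewrite E.
have e6 : \sum_b dG b b nu mu = \sum_b dT b b nu mu + \sum_b s b b nu mu.
  by rewrite -big_split; apply: eq_bigr => b _ /=; rewrite E.
have r1 : \sum_b Rt b b mu nu = \sum_b s b b mu nu - \sum_b s b b nu mu.
  by rewrite -sumrB; apply: eq_bigr => b _; rewrite -sym_deriv_curvature.
have r2 : \sum_b Rt mu b b nu = \sum_b s b b mu nu - \sum_b s mu b nu b.
  rewrite -sumrB; apply: eq_bigr => b _; rewrite -sym_deriv_curvature.
  by rewrite /s [sym_deriv G x0 b b mu nu]sym_derivC.
exact: aux e1 e2 e3 e4 e5 e6 r1 r2.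
Qed.

(** The term containing the Hessian of the base change is symmetric in the two base indices, hence
    cancels and leaves the curvature of [K]. *)
Lemma fibre_curvature p i mu nu :
  dK p i nu mu = dK p i mu nu - curvature K x0 p i mu nu.
Proof.
rewrite !pull1_normal_fibre /curvature.
have -> : \sum_r K x0 r i nu * K x0 p r mu = \sum_r K x0 p r mu * K x0 r i nu.
  by apply: eq_bigr => r _; rewrite mulrC.
have -> : \sum_r K x0 r i mu * K x0 p r nu = \sum_r K x0 p r nu * K x0 r i mu.
  by apply: eq_bigr => r _; rewrite mulrC.
have -> : \sum_a K x0 p i a * symmetrized G x0 nu a mu =
    \sum_a K x0 p i a * symmetrized G x0 mu a nu.
  by apply: eq_bigr => a _; rewrite symmetrizedC.
ring.
Qed.

Lemma fibre_contraction u1 u2 u3 u4 mu nu p i :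
  (forall be : 'M[R]_n, (u1 + u2) * be p i + (i == p)%:R * ((u3 + u4) * \tr be) = be p i) ->
  u1 * dK p i mu nu + u2 * dK p i nu mu +
    (i == p)%:R * (u3 * (\sum_b dK b b mu nu) + u4 * (\sum_b dK b b nu mu)) =
  dK p i mu nu - u2 * curvature K x0 p i mu nu
   - (i == p)%:R * (u4 * \sum_b curvature K x0 b b mu nu).
Proof.
have aux (k k' c t t' w d : R) : k' = k - c -> t' = t - w ->
    (u1 + u2) * k + d * ((u3 + u4) * t) = k ->
    u1 * k + u2 * k' + d * (u3 * t + u4 * t') = k - u2 * c - d * (u4 * w).
  by move=> -> -> E; rewrite -[X in _ = X - _ - _]E; ring.
(* The constraint holds for every matrix and is used here for the matrix of first derivatives of [K]
   itself. *)
move=> /(_ (\matrix_(j, k) dK j k mu nu)); rewrite mxE => E.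
have trE : \tr (\matrix_(j, k) dK j k mu nu) = \sum_b dK b b mu nu.
  by apply: eq_bigr => b _; rewrite mxE.
rewrite trE in E; apply: aux E; first exact: fibre_curvature.
by rewrite -sumrB; apply: eq_bigr => b _; exact: fibre_curvature.
Qed.

End NormalContractions.

(** * The classification *)

Section FlatFormula.
Variables (R : realType) (m n s r : nat) (Dt : conn_rule R m n).
Hypothesis Dt_natural : natural Dt.
Hypothesis Dt_order : of_order s r Dt.

Definition classified a1 a2 a3 b1 b2 b3 c1 c2 c3 d1 d2 e1 e2 h1 h2
    (L : coefs R m m) (K : coefs R m n) : coefs R (m + n) (m + n) := fun z B A C =>
  std_conn L K z B A C + hor_S K (S_tensor a1 a2 a3 L) z B A C
  + liouville_G (G_tensor b1 b2 b3 c1 c2 c3 d1 d2 e1 L K) z B A C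
  + e2 * curv_liouville K z B A C + H_tensor h1 h2 L K z B A C.

(** Assembles [D_mu^i_nu]. The correction sums [s1], [s2], [s3] of [change_lrl] split into parts
    [w], [x2], [x3], which are combined with [s0], and the contributions [h] of [hor_S] and [t1],
    [t2] of [H_tensor]. *)
Let lrl_regroup (s0 s1 s2 s3 s4 w h x2 x3 t1 t2 st g cv t : R) :
  s1 = w + h -> s2 = t1 + x2 -> s3 = t2 + x3 -> s4 = 0 -> t = - t1 - t2 ->
  s0 + w - x2 - x3 = st + g + cv ->
  s0 + s1 - s2 - s3 + s4 = st + h + g + cv + t.
Proof. by move=> -> -> -> -> -> e; lra. Qed.

(** The remaining identity for one fibre index [p]. The product of [K] with [Lambda] in [std_conn]
    splits into a torsion part [KT] and a symmetric part [ks], which is supplied by the derivative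
    of [K] in normal coordinates. *)
Let lrl_balance (yp d Q Bs F u2 u4 k cv w Gt dk kk ks KT KL N : R) :
  F = k - u2 * cv - d * (u4 * w) -> Gt = Q + Bs - u4 * w -> k = dk + kk + ks -> KL = KT + ks ->
  yp * (d * Q + d * Bs + F) + yp * KT - yp * N - yp * kk =
  (dk - N + KL) * yp + yp * Gt * d + - u2 * (cv * yp).
Proof. by move=> -> -> -> ->; ring. Qed.

Lemma flat_formula : exists a1 a2 a3 b1 b2 b3 c1 c2 c3 d1 d2 e1 e2 h1 h2 : R,
  forall (U : set 'rV[R]_m) (oU : open U) (L : base_conn (flat n oU)) (K : lin_conn (flat n oU))
    (x : 'rV[R]_m) y B A C, U x ->
  Dt L K tt (row_mx x y) B A C =
  classified a1 a2 a3 b1 b2 b3 c1 c2 c3 d1 d2 e1 e2 h1 h2 (L tt) (K tt) (row_mx x y) B A C.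
Proof.
have [a1 [a2 [a3 lllE]]] := lll_invariant Dt_natural Dt_order.
have [h2 lrrE] := lrr_invariant Dt_natural Dt_order.
have [h1 rrlE] := rrl_invariant Dt_natural Dt_order.
have [b1 [b2 [b3 [q1 [q2 [q3 [q4 [q5 [q6 [u1 [u2 [u3 [u4 lrlE]]]]]]]]]]]]] :=
  lrl_invariant Dt_natural Dt_order.
(* The standard connection already contains the torsion once, whence [a1 - 1]. The combinations of
   the [q] are those of [base_contraction], and [- u4], [- u2] are the curvature terms of
   [fibre_contraction]. *)
exists (a1 - 1), a2, a3, b1, b2, b3, (q5 - q2), (q6 - q4), (q1 - q3), (- (q4 + q6)), (- (q1 + q3)),
  (- u4), (- u2), h1, h2 => U oU L K x y B A C Ux.
have sL := flat_base_smooth L.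
pose f := normal_base (L tt) x; pose Af := normal_fibre (K tt) x.
have f0 : f 0 = x := normal_base0 _ x.
have sf : forall l, smooth_on setT (fun w => f w 0 l) := @normal_base_smooth R m (L tt) x.
have sA : forall j i, smooth_on setT (fun w => Af w j i) := @normal_fibre_smooth R m n (K tt) x.
have J0 : jac f 0 = 1%:M := normal_base_jac _ _.
have A0 : Af 0 = 1%:M := normal_fibre0 _ _.
have U0 : U (f 0) by rewrite f0.
have aT : antisym (torsion (L tt) x) := @torsion_antisym _ _ _ _.
have trE a : torsion_tr (L tt) x a = ttr (torsion (L tt) x) a by [].
have clll := change_lll sf sA J0 A0 U0 Dt_natural Dt_order L K y.
have clrr := change_lrr sf sA J0 A0 U0 Dt_natural Dt_order L K y.
have crrl := change_rrl sf sA J0 A0 U0 Dt_natural Dt_order L K y.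
have clrl := change_lrl sf sA J0 A0 U0 Dt_natural Dt_order L K y.
rewrite f0 pull0_normal_base pull0_normal_fibre in clll clrr crrl clrl.
pose dG := pull1 f (jac f) (L tt); pose dK := pull1 f Af (K tt).
rewrite /classified -(splitK B) -(splitK A) -(splitK C).
case: (fintype.split B) => [mu|j]; case: (fintype.split A) => [la|i];
  case: (fintype.split C) => [nu|k] /=.
- rewrite clll lllE // normal_base2 /std_conn !split_l row_mxKl hor_S_ll H_tensor_l.
  rewrite liouville_GE !(vertical_other, curv_liouvilleE) ?split_l // mulr0 !addr0.
  under eq_bigr do rewrite hor_l row_mxKl.
  rewrite sum_delta /S_tensor !trE (torsion_symmetrized (L tt) x mu la nu); ring.
- rewrite (vanish_llr Dt_natural Dt_order Ux).
  rewrite /std_conn !split_l split_r hor_S_lr H_tensor_l.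
  by rewrite liouville_GE !(vertical_other, curv_liouvilleE) ?split_l ?split_r // mulr0 !addr0.
(* The matrix [W] is the off-diagonal block of the Jacobian of the normal coordinates. It also gives
   the horizontal lift, which is how [hor_S] and [H_tensor] arise from the change of coordinates. *)
- pose W l k := lift_coef (K tt) (row_mx x y) k l.
  have WE l k : W l k = \sum_p K tt x p k l * y 0 p.
    by apply: eq_bigr => p _; rewrite row_mxKl row_mxKr.
  have bE l k : \sum_j y 0 j * partial l (fun w => Af w j k) 0 = W l k.
    by rewrite WE; apply: eq_bigr => j _; rewrite normal_fibre1 mulrC.
  have swap (I : finType) (c : I -> R) (g : I -> 'I_n -> R) :
      \sum_l c l * (\sum_p g l p * y 0 p) = \sum_p y 0 p * (\sum_l c l * g l p).
    under eq_bigr do rewrite mulr_sumr; rewrite exchange_big; apply: eq_bigr => p _ /=.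
    by rewrite mulr_sumr; apply: eq_bigr => l _; ring.
  rewrite clrl; apply: (lrl_regroup (w := \sum_l torsion (L tt) x mu l nu * W l i)
    (x2 := \sum_j K tt x j i nu * W mu j) (x3 := \sum_j K tt x j i mu * W nu j)
    (t1 := h1 * (ttr (torsion (L tt) x) nu * W mu i))
    (t2 := h2 * (ttr (torsion (L tt) x) mu * W nu i))).
  + rewrite hor_S_ll -big_split; apply: eq_bigr => l _ /=.
    by rewrite lllE // bE hor_r row_mxKl /S_tensor !trE -/(W l i); ring.
  + rewrite -[h1 * _](sum_delta (fun j => h1 * (ttr (torsion (L tt) x) nu * W mu j))) -big_split.
    by apply: eq_bigr => j _ /=; rewrite crrl rrlE // normal_fibre1 bE; ring.
  + rewrite -[h2 * _](sum_delta (fun j => h2 * (ttr (torsion (L tt) x) mu * W nu j))) -big_split.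
    by apply: eq_bigr => j _ /=; rewrite clrr lrrE // normal_fibre1 bE; ring.
  + by rewrite big1 // => j _; rewrite normal_fibre2 mulr0.
  + by rewrite H_tensor_lrl row_mxKl !trE -/(W mu i) -/(W nu i); ring.
  rewrite liouville_GE curv_liouvilleE !vertical_lrl row_mxKl row_mxKr lrlE //.
  under [X in _ + X - _ - _]eq_bigr do rewrite WE.
  under [X in _ - X - _]eq_bigr do rewrite WE.
  under [X in _ - X]eq_bigr do rewrite WE.
  rewrite !swap /std_conn !split_l split_r row_mxKl row_mxKr.
  set Gt := G_tensor _ _ _ _ _ _ _ _ _ _ _ _ _ _.
  rewrite -(sum_delta (fun p => y 0 p * Gt) i) mulr_sumr -big_split -!sumrB -!big_split.
  apply: eq_bigr => p _ /=.
  (* The relation between the [q] is derived from indices [mu] and [p], which are at hand here. *)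
  have q0 := base_constraint Dt_natural Dt_order lrlE mu p.
  have GtE : Gt = b1 * quad1 (torsion (L tt) x) mu nu + b2 * quad2 (torsion (L tt) x) mu nu
      + b3 * quad3 (torsion (L tt) x) mu nu
      + (q1 * (\sum_b dG mu b nu b) + q2 * (\sum_b dG mu b b nu) + q3 * (\sum_b dG nu b mu b) +
         q4 * (\sum_b dG nu b b mu) + q5 * (\sum_b dG b b mu nu) + q6 * (\sum_b dG b b nu mu))
      - u4 * \sum_b curvature (K tt) x b b mu nu.
    rewrite (base_contraction Ux sL mu nu q0) /Gt /G_tensor /quad1 /quad2 /quad3 !mulNr.
    rewrite -!addrA; do 8![congr (_ + _)].
  have constraint be := bundle_constraint Dt_natural Dt_order lrlE mu be p i.
  have fc := fibre_contraction (L tt) (K tt) x mu nu constraint.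
  have kE := pull1_normal_fibre (L tt) (K tt) x p i mu nu.
  refine (lrl_balance (y 0 p) _ fc GtE kE _).
  rewrite -big_split; apply: eq_bigr => l _ /=.
  by rewrite (torsion_symmetrized (L tt) x mu l nu); ring.
- rewrite clrr lrrE // normal_fibre1 /std_conn !split_l !split_r row_mxKl hor_S_lr H_tensor_lrr.
  rewrite liouville_GE !(vertical_other, curv_liouvilleE) ?split_l ?split_r //.
  rewrite row_mxKl trE; ring.
- rewrite (vanish_rll Dt_natural Dt_order Ux).
  rewrite /std_conn !split_l split_r hor_S_r H_tensor_l.
  by rewrite liouville_GE !(vertical_other, curv_liouvilleE) ?split_l ?split_r // mulr0 !addr0.
- rewrite (vanish_rlr Dt_natural Dt_order Ux).
  rewrite /std_conn !split_l !split_r hor_S_r H_tensor_l.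
  by rewrite liouville_GE !(vertical_other, curv_liouvilleE) ?split_l ?split_r // mulr0 !addr0.
- rewrite crrl rrlE // normal_fibre1 /std_conn !split_l !split_r row_mxKl hor_S_r H_tensor_rrl.
  rewrite liouville_GE !(vertical_other, curv_liouvilleE) ?split_l ?split_r //.
  rewrite row_mxKl trE; ring.
- rewrite (vanish_rrr Dt_natural Dt_order Ux).
  rewrite /std_conn !split_r hor_S_r H_tensor_rrr.
  by rewrite liouville_GE !(vertical_other, curv_liouvilleE) ?split_l ?split_r // mulr0 !addr0.
Qed.

End FlatFormula.

Section FirstOrder.
Variables (R : realType) (m n s r : nat) (Dt : conn_rule R m n).
Hypothesis Dt_natural : natural Dt.
Hypothesis Dt_order : of_order s r Dt.

Section Translation.
Variables (U : set 'rV[R]_m) (oU : open U) (x : 'rV[R]_m).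
Hypothesis Ux : U x.
Variables (L : base_conn (flat n oU)) (K : lin_conn (flat n oU)).

(** With zero components the normal coordinates reduce to the translation by [x] and the fibre
    change to the identity. *)
Let f := normal_base (fun _ _ _ _ => 0) x.
Let A := normal_fibre (fun _ _ _ _ => 0) x : 'rV[R]_m -> 'M[R]_n.

Let f0 : f 0 = x. Proof. exact: normal_base0. Qed.

Let f2 a b c : partial c (partial a (fun w => f w 0 b)) 0 = 0.
Proof. by rewrite normal_base2 /symmetrized addr0 mulr0. Qed.

Let J1 a b c : partial c (fun w => jac f w a b) 0 = 0.
Proof. by rewrite -(f2 a b c); congr (partial _ _ _); apply/funext => w; rewrite mxE. Qed.

Let J2 a b c e : partial e (partial c (fun w => jac f w a b)) 0 = 0.
Proof.
have -> : (fun w => jac f w a b) = partial a (fun w => f w 0 b) by apply/funext => w; rewrite mxE.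
have -> : (fun w => f w 0 b) = quadf (x 0 b) (fun a => (a == b)%:R) (fun _ _ => 0).
  apply/funext => w; rewrite mxE; congr (quadf _ _ _ _).
  by apply/funext => p; apply/funext => q; rewrite /symmetrized addr0 mulr0.
exact: partial3_quadf.
Qed.

Lemma translation y B A' C : Dt L K tt (row_mx x y) B A' C =
  D0 Dt (L tt x) (fun a b c e => partial e (fun w => L tt w a b c) x)
     (K tt x) (fun a b c e => partial e (fun w => K tt w a b c) x) (row_mx 0 y) B A' C.
Proof.
have U0 : U (f 0) by rewrite f0.
have sf l : smooth_on setT (fun w => f w 0 l) by exact: normal_base_smooth.
have sA j i : smooth_on setT (fun w => A w j i) by exact: normal_fibre_smooth.
have J0 : jac f 0 = 1%:M by exact: normal_base_jac.
have A0 : A 0 = 1%:M by exact: normal_fibre0.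
have := local_change sf sA J0 A0 U0 Dt_natural Dt_order L K y.
have -> : tot_jac f A (row_mx 0 y) = 1%:M.
  rewrite /tot_jac row_mxKl row_mxKr J0 A0.
  rewrite (_ : \matrix_(l, i) _ = 0) -?scalar_mx_block //.
  by apply/matrixP => l i; rewrite !mxE big1 // => j _; rewrite normal_fibre1 mulr0.
have hess B' A1 C' : tot_hess f A (row_mx 0 y) B' A1 C' = 0.
  rewrite /tot_hess row_mxKl row_mxKr; case: (fintype.split B') => [l|j];
    case: (fintype.split A1) => [l'|i]; case: (fintype.split C') => [e|k]; rewrite ?normal_fibre1 ?f2 //.
  by rewrite big1 // => j _; rewrite normal_fibre2 mulr0.
have -> : pull0 f (jac f) (L tt) = L tt x.
  by do 3![apply/funext => ?]; rewrite /pull0 f0 J1 subr0.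
have -> : pull0 f A (K tt) = K tt x.
  by do 3![apply/funext => ?]; rewrite /pull0 f0 normal_fibre1 subr0.
have -> : pull1 f (jac f) (L tt) = fun a b c e => partial e (fun w => L tt w a b c) x.
  do 4![apply/funext => ?]; rewrite /pull1 f0 J2.
  rewrite 3?[\sum_(_ < _) _]big1 ?addr0 ?subr0 // => ? _; by rewrite ?J1 ?f2 mulr0.
have -> : pull1 f A (K tt) = fun a b c e => partial e (fun w => K tt w a b c) x.
  do 4![apply/funext => ?]; rewrite /pull1 f0 normal_fibre2.
  rewrite 3?[\sum_(_ < _) _]big1 ?addr0 ?subr0 // => ? _; by rewrite ?normal_fibre1 ?f2 mulr0.
move=> E; apply/esym; move: B A' C; apply/related1 => B A' C.
by rewrite E hess subr0 f0.
Qed.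

End Translation.

Lemma partials_aff d k (l0 : 'I_k -> 'I_k -> 'I_d -> R) l1 l j i c :
  partials l (fun x => aff l0 l1 x j i c) =
  match l with
  | [::] => fun x => aff l0 l1 x j i c
  | [:: e] => fun=> l1 j i c e
  | _ => fun=> 0
  end.
Proof.
elim: l => // e l /= ->; apply/funext => x.
by case: l => [|e' [|? ?]]; rewrite ?partial_aff ?partial_cst.
Qed.

(* The jet at 0 of the affine connections with a given 1-jet. *)
Definition pad (w : 'rV[R]_#|jet_index m n 1 1|) : 'rV[R]_#|jet_index m n s r| :=
  \row_k match enum_val k : jet_index m n s r with
  | inl (inl (inl _)) => 0
  | inl (inl (inr i)) => w 0 (enum_rank (inl (inl (inr i)) : jet_index m n 1 1))
  | inl (inr (l, a, b, c)) => if (size l <= 1)%N then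
      w 0 (enum_rank (inl (inr (insub_bseq 1 l, a, b, c)) : jet_index m n 1 1)) else 0
  | inr (l, a, b, c) => if (size l <= 1)%N then
      w 0 (enum_rank (inr (insub_bseq 1 l, a, b, c) : jet_index m n 1 1)) else 0
  end.

Lemma pad_smooth k : smooth_on setT (fun w => pad w 0 k).
Proof.
have oT := @openT 'rV[R]_#|jet_index m n 1 1|.
under eq_fun do rewrite mxE.
case: (enum_val k) => [[[la|i]|[[[l a] b] c]]|[[[l a] b] c]];
  try case: (size l <= 1)%N; by [exact: smooth_cst | exact: smooth_coord].
Qed.

Lemma pad_jets (L : coefs R m m) (K : coefs R m n) x y :
  pad (jets 1 1 L K (row_mx x y)) =
  jets s r (aff (L x) (fun a b c e => partial e (fun w => L w a b c) x))
    (aff (K x) (fun a b c e => partial e (fun w => K w a b c) x)) (row_mx 0 y).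
Proof.
apply/rowP => k; rewrite !mxE.
case: (enum_val k) => [[[la|i]|[[[l a] b] c]]|[[[l a] b] c]] /=.
- by rewrite row_mxKl mxE.
- by rewrite mxE enum_rankK /= !row_mxKr.
- rewrite partials_aff row_mxKl; case: l => -[|e [|? ?]] ? //=; rewrite mxE enum_rankK /= row_mxKl;
    by rewrite [bseqval _]insubdK ?aff_at0.
- rewrite partials_aff row_mxKl; case: l => -[|e [|? ?]] ? //=; rewrite mxE enum_rankK /= row_mxKl;
    by rewrite [bseqval _]insubdK ?aff_at0.
Qed.

(** One smooth function serves every chart: the one for the trivial bundle over the whole space,
    evaluated on the jets at 0 of affine connections. These jets depend smoothly on the 1-jet
    through [pad], and [translation] moves the point to 0. *)
Lemma order_one : of_order 1 1 Dt.
Proof.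
move=> E c B A C.
have [F sF FE] := flat_order Dt_order (@openT 'rV[R]_m) B A C.
exists (F \o pad) => [|L K z Uz].
  apply: (smooth_subset (@subsetT _ _)).
  by apply: (smooth_comp (@openT _) sF) => // k; exact: pad_smooth.
by rewrite (chart_reduction Dt_natural) // -[z]hsubmxK translation // /D0 FE //= pad_jets.
Qed.

End FirstOrder.

Theorem theorem2p7 (R : realType) (m n s r : nat) (hsr : (r <= s + 2)%N)
    (Dt : conn_rule R m n) (Dt_natural : natural Dt)
    (Dt_order : of_order s r Dt) :
  of_order 1 1 Dt /\
  exists (a1 a2 a3 b1 b2 b3 c1 c2 c3 d1 d2 e1 e2 h1 h2 : R),
  forall (E : vbundle R m n) (L : base_conn E) (K : lin_conn E) (c : chart E)
    (z : 'rV[R]_(m + n)) (B A C : 'I_(m + n)),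
  img c (lsubmx z) ->
  Dt E L K c z B A C =
    std_conn (L c) (K c) z B A C
    + hor_S (K c) (S_tensor a1 a2 a3 (L c)) z B A C
    + liouville_G (G_tensor b1 b2 b3 c1 c2 c3 d1 d2 e1 (L c) (K c)) z B A C
    + e2 * curv_liouville (K c) z B A C
    + H_tensor h1 h2 (L c) (K c) z B A C.
Proof.
split; first exact: order_one Dt_natural Dt_order.
have [a1 [a2 [a3 [b1 [b2 [b3 [c1 [c2 [c3 [d1 [d2 [e1 [e2 [h1 [h2 H]]]]]]]]]]]]]]] :=
  flat_formula Dt_natural Dt_order.
exists a1, a2, a3, b1, b2, b3, c1, c2, c3, d1, d2, e1, e2, h1, h2 => E L K c z B A C Uz.
rewrite (chart_reduction Dt_natural) // -[z]hsubmxK.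
by rewrite H.
Qed.
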